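(* Let $(G,E)$ be a connected simple graph with countably infinite vertex set and bounded degree, $\mu$ a conductance on $E$ with $\mu_{xy}\asymp1$ for $(x,y)\in E$, and $K$ a minimal and connected partition of $(G,E)$ parametrized by a bi-infinite tree $(T,\pi,\phi)$. Let $d$ be a metric on $G$ with $\mathrm{diam}(G,d)=\infty$ that fits to $(G,E)$ and satisfies the basic framework w.r.t. $K$ (with constant $r$); replace $T$ by the refined tree $T_r$. Suppose that for some $\beta>\alpha\ge1$: $d(x,y)\asymp1$ for $(x,y)\in E$; $h_{2n}(x,x)\asymp 1/V_d(x,n^{1/\beta})$ for all $x\in G$, $n\ge1$; there are $\lambda,C>0$ with $R(B_d(x,\lambda s),B_d(x,s)^c)V_d(x,s)\ge Cs^\beta$ for all $x$ and $s>r_x$; there is $C'>0$ with $R(x,B_d(x,s)^c)V_d(x,s)\le C's^\beta$ for all $x$ and $s>r_x$; and there is $C''>0$ with $V_d(x,s)\le C''(s/t)^\alpha V_d(x,t)$ for all $x\in G$, $s>t>0$. Then for any $N\ge1$, $N_1\ge0$ and sufficiently large $N_2=N_2(N_1)$, $$\underline{d}_S(G,\mu)=2\frac{\log\underline{\mathcal{N}}}{\log\underline{\mathcal{N}}-\log\underline{\mathcal{R}}_2(N_1,N_2,N)},\qquad \overline{d}_S(G,\mu)=2\frac{\log\overline{\mathcal{N}}}{\log\underline{\mathcal{N}}-\log\underline{\mathcal{R}}_2(N_1,N_2,N)}.$$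
   Context: Weighted graph: $\mu:E\to(0,\infty)$ symmetric; $\mu_x=\sum_{y\sim x}\mu_{xy}$, $\mu(A)=\sum_{x\in A}\mu_x$; $V_d(x,s)=\mu(B_d(x,s))$; $r_x=\inf_{y\ne x}d(x,y)$. Transition probabilities $p(x,y)=\mu_{xy}/\mu_x$, $p_0(x,y)=\delta_{xy}$, $p_n(x,y)=\sum_z p_{n-1}(x,z)p(z,y)$, heat kernel $h_n(x,y)=p_n(x,y)/\mu_y$. Energy $\mathcal{E}(f)=\frac12\sum_{(x,y)\in E}(f(x)-f(y))^2\mu_{xy}$; effective resistance $R(A,B)=(\inf\{\mathcal{E}(f):f|_A=1,f|_B=0\})^{-1}$, $R(x,A)=R(\{x\},A)$. Spectral dimensions (independent of $x$): $\overline{d}_S=2\limsup_n\frac{-\log p_{2n}(x,x)}{\log n}$, $\underline{d}_S=2\liminf_n\frac{-\log p_{2n}(x,x)}{\log n}$. Fitting: (F1) there is $C>0$ with $d(x,y)\le Cd(x,z)$ whenever $x\sim y$, $x\ne z$; (F2) for every $\epsilon>0$ there exist $s>0$, $n\ge1$, $x_0,\dots,x_n$ with $x_i\in B_d(x_0,s)$ for $i<n$, $x_n\notin B_d(x_0,s)$, $x_i\sim x_{i-1}$ and $d(x_i,x_{i-1})\le\epsilon s$. Bi-infinite tree $(T,\pi)$: $T$ countable, (T1) any $w,v$ have $n,m\ge0$ with $\pi^n(w)=\pi^m(v)$, (T2) $\pi^n(w)\ne w$ for $n\ge1$; height $[w]=n-m$ where $\pi^n(w)=\pi^m(\phi)$;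 $(T)_n$, $S(w)=\pi^{-1}(w)$, $S^k(A)=\{v:\pi^k(v)\in A\}$, $T_w=\{v:\pi^n(v)=w,n\ge0\}$, $\Sigma^*$ = sequences $(\omega_n)_{n\in\mathbb{Z}}$, $\omega_n\in(T)_n$, $\pi(\omega_{n+1})=\omega_n$. Partition: $K_w\subseteq G$ finite with (PG1) $\bigcup_{v\in S(w)}K_v=K_w$; (PG2) each $\omega\in\Sigma^*$ has $n_0$ and an edge $x\sim y$ with $K_{\omega_n}=\{x,y\}$ for $n\ge n_0$; (PG3) each edge equals some $K_w$. $\Lambda_e=\{w:\#K_w=2,\#K_{\pi(w)}>2\}$, $T_e=\{w:\#K_{\pi(w)}>2\}$; minimal: $K_w\ne K_v$ for distinct $w,v\in\Lambda_e$; connected: the subgraph induced on $K_w$ is connected for every $w\in T_e$. Scales and basic framework: $g_d(w)=\max_{x,y\in K_w}d(x,y)$ ($w\in T_e$); $\Lambda_s=\{w\in T_e:g_d(w)\le s<g_d(\pi(w))\}$; $E_s$ = distinct pairs in $\Lambda_s$ with intersecting $K$'s; $\Lambda_{s,M}(w)=\{v\in\Lambda_s:l_{E_s}(w,v)\le M\}$; $\Lambda_{s,M}(x)=\bigcup_{w\in\Lambda_s,x\in K_w}\Lambda_{s,M}(w)$; $U_M(x,s)=\{x\}$ if $\Lambda_{s,M}(x)=\emptyset$, else $\bigcup_{w\in\Lambda_{s,M}(x)}K_w$. Uniformly finite: $\sup\{\#\Lambda_{s,1}(w)\}<\infty$; thick: there is $\alpha>0$ such that each $w\in T_e$ has $x\in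 K_w$ with $\Lambda_{\alpha g_d(\pi(w)),1}(x)\subseteq T_w$; adapted: for some $M$ and $\alpha_1,\alpha_2>0$, $B_d(x,\alpha_1s)\subseteq U_M(x,s)\subseteq B_d(x,\alpha_2s)$ for all $x$, $s>0$. Basic framework: $\sup_{w\in T_e\setminus\Lambda_e}\#S(w)<\infty$, uniformly finite, thick, adapted, and $g_d(w)\asymp r^{[w]}$ on $T_e$ for some $r\in(0,1)$. Refined tree $T_r$: for $w\in\Lambda_e$, $K_w=\{w^+,w^-\}$; $n(m)\in\mathbb{N}$ with $2^{-n(m)}\le r^m<2^{1-n(m)}$; $T_r=T_e\sqcup\{u_{w,m,k}:w\in\Lambda_e,m\ge1,0\le k<2^{n(m)}\}$, $\pi_r=\pi$ on $T_e$, $\pi_r(u_{w,1,k})=w$, $\pi_r(u_{w,m,k})=u_{w,m-1,l}$ with $[k2^{-n(m)},(k+1)2^{-n(m)}]\subseteq[l2^{-n(m-1)},(l+1)2^{-n(m-1)}]$, $[u_{w,m,k}]=[w]+m$. In the cable system (each edge a copy of $[0,1]$ glued at vertices), $\mathcal{K}_v$ for $v\in T_e$ is the union of the cables of edges $K_u$, $u\in\Lambda_e\cap T_v$, and $\mathcal{K}_{u_{w,m,k}}$ is the part of the cable of $\{w^+,w^-\}$ with parameter (from $w^+$) in $[k2^{-n(m)},(k+1)2^{-n(m)}]$. $J^h_m=\{(u,v)\in(T_r)_m^2:u\ne v,\mathcal{K}_u\cap\mathcal{K}_v\ne\emptyset\}$, $J^h_{N,m}=\{(u,v)\in(T_r)_m^2:0<l_{J^h_m}(u,v)\le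 N\}$, $\Gamma_n(w)=\{v\in(T_r)_{[w]}:l_{J^h_{[w]}}(w,v)\le n\}$. $\mathcal{E}_{p,k,w}(N_1,N_2,N)=\inf\{\frac12\sum_{(x,y)\in J^h_{N,[w]+k}}|f(x)-f(y)|^p: f:(T_r)_{[w]+k}\to\mathbb{R}, f=1$ on $S^k(\Gamma_{N_1}(w))$, $f=0$ off $S^k(\Gamma_{N_2}(w))\}$. Then $\overline{\mathcal{N}}=\sup_{w\in T_r}\limsup_k\#(S^k(\pi^k(w)))^{1/k}$, $\underline{\mathcal{N}}=\sup_{w\in T_r}\liminf_k\#(S^k(\pi^k(w)))^{1/k}$, $\underline{\mathcal{R}}_p(N_1,N_2,N)=\sup_{w\in T_r}\liminf_k\mathcal{E}_{p,k,\pi^k(w)}(N_1,N_2,N)^{1/k}$. *)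

(* Defs.v *)
From Stdlib Require Import Reals List Arith ZArith Relations ClassicalEpsilon.
From Coquelicot Require Import Coquelicot.
Set Implicit Arguments.
Open Scope R_scope.

Definition sumR (l : list R) : R := fold_right Rplus 0 l.

Definition Rbar_sup (S : Rbar -> Prop) : Rbar :=
  Lub_Rbar (fun x => S (Finite x) \/ S p_infty).
Definition Rbar_inf (S : Rbar -> Prop) : Rbar :=
  Glb_Rbar (fun x => S (Finite x) \/ S m_infty).
Definition liminfR (u : nat -> Rbar) : Rbar :=
  Rbar_sup (fun e => exists n, e = Rbar_inf (fun e' => exists k, (n <= k)%nat /\ e' = u k)).
Definition limsupR (u : nat -> Rbar) : Rbar :=
  Rbar_inf (fun e => exists n, e = Rbar_sup (fun e' => exists k, (n <= k)%nat /\ e' = u k)).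

Definition rootk (x : Rbar) (k : nat) : Rbar :=
  match x with
  | Finite y => Finite (if Rle_dec y 0 then 0 else Rpower y (/ INR k))
  | p_infty => p_infty
  | m_infty => m_infty
  end.

Definition Rbar_recip (x : Rbar) : Rbar :=
  match x with
  | Finite y => if Req_dec_T y 0 then p_infty else Finite (/ y)
  | _ => Finite 0
  end.

Definition cardR {X : Type} (A : X -> Prop) : Rbar :=
  Lub_Rbar (fun z => exists l, NoDup l /\ (forall a, In a l -> A a) /\ z = INR (length l)).
Definition card_le {X : Type} (B : nat) (A : X -> Prop) : Prop :=
  forall l, NoDup l -> (forall a, In a l -> A a) -> (length l <= B)%nat.

Fixpoint within {X : Type} (E : X -> X -> Prop) (M : nat) (a b : X) : Prop :=
  match M with
  | O => a = b
  | S M' => within E M' a b \/ exists c, within E M' a c /\ E c b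
  end.

Definition countable (X : Type) : Prop :=
  exists e : nat -> X, forall x, exists n, e n = x.
Definition countably_infinite (X : Type) : Prop :=
  exists e : nat -> X, (forall x, exists n, e n = x) /\ (forall n m, e n = e m -> n = m).

Definition same_set {X : Type} (l : list X) (P : X -> Prop) : Prop :=
  forall x, In x l <-> P x.

Section Graph.
Variables (V : Type) (nbrs : V -> list V) (mu : V -> V -> R).

Definition adj (x y : V) : Prop := In y (nbrs x).
Definition mu_v (x : V) : R := sumR (map (mu x) (nbrs x)).
Definition mu_set (A : V -> Prop) : Rbar :=
  Lub_Rbar (fun z => exists l, NoDup l /\ (forall y, In y l -> A y) /\ z = sumR (map mu_v l)).

Definition ptrans (x y : V) : R := mu x y / mu_v x.
Fixpoint pn (n : nat) (x y : V) : R :=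
  match n with
  | O => if excluded_middle_informative (x = y) then 1 else 0
  | S n' => sumR (map (fun z => pn n' x z * ptrans z y) (nbrs y))
  end.
Definition hk (n : nat) (x y : V) : R := pn n x y / mu_v y.

(* energy: (1/2) sum over ordered adjacent pairs, as a sup over finite sets *)
Definition energy (f : V -> R) : Rbar :=
  Lub_Rbar (fun z => exists l, NoDup l /\
     z = / 2 * sumR (map (fun x => sumR (map (fun y => (f x - f y) ^ 2 * mu x y) (nbrs x))) l)).
Definition resistance (A B : V -> Prop) : Rbar :=
  Rbar_recip (Glb_Rbar (fun e => exists f : V -> R,
     (forall x, A x -> f x = 1) /\ (forall x, B x -> f x = 0) /\ energy f = Finite e)).

Definition dS_lower (x : V) : Rbar :=
  Rbar_mult (Finite 2) (liminfR (fun n => Finite (- ln (pn (2 * n) x x) / ln (INR n)))).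
Definition dS_upper (x : V) : Rbar :=
  Rbar_mult (Finite 2) (limsupR (fun n => Finite (- ln (pn (2 * n) x x) / ln (INR n)))).

Variable d : V -> V -> R.
Definition is_metric : Prop :=
  (forall x y, 0 <= d x y) /\ (forall x y, d x y = 0 <-> x = y) /\
  (forall x y, d x y = d y x) /\ (forall x y z, d x z <= d x y + d y z).
Definition dball (x : V) (s : R) (y : V) : Prop := d x y < s.
Definition Vd (x : V) (s : R) : Rbar := mu_set (dball x s).
Definition rx (x : V) : Rbar := Glb_Rbar (fun z => exists y, y <> x /\ z = d x y).
Definition infinite_diam : Prop := forall M, exists x y, M < d x y.
Definition fits : Prop :=
  (exists C, 0 < C /\ forall x y z, adj x y -> x <> z -> d x y <= C * d x z) /\
  (forall eps, 0 < eps -> exists s (n : nat) (xs : nat -> V), 0 < s /\ (1 <= n)%nat /\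
     (forall i, (i < n)%nat -> dball (xs 0%nat) s (xs i)) /\ ~ dball (xs 0%nat) s (xs n) /\
     (forall i, (1 <= i <= n)%nat -> adj (xs (i - 1)%nat) (xs i) /\ d (xs i) (xs (i - 1)%nat) <= eps * s)).
End Graph.

Section Tree.
Variables (V : Type) (nbrs : V -> list V) (d : V -> V -> R)
          (T : Type) (pi : T -> T) (phi : T) (K : T -> list V).

Definition tree_T1 : Prop := forall w v, exists n m, Nat.iter n pi w = Nat.iter m pi v.
Definition tree_T2 : Prop := forall w n, (1 <= n)%nat -> Nat.iter n pi w <> w.
Definition is_height (w : T) (z : Z) : Prop :=
  exists n m, Nat.iter n pi w = Nat.iter m pi phi /\ z = (Z.of_nat n - Z.of_nat m)%Z.
Definition desc (v w : T) : Prop := exists n, Nat.iter n pi v = w.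
Definition in_Sigma (om : Z -> T) : Prop :=
  forall n, is_height (om n) n /\ pi (om (n + 1)%Z) = om n.

(* K_w is a finite set of vertices, represented by a duplicate-free list *)
Definition PG1 : Prop := forall w x, In x (K w) <-> exists v, pi v = w /\ In x (K v).
Definition PG2 : Prop := forall om, in_Sigma om ->
  exists n0 x y, adj nbrs x y /\ forall n, (n0 <= n)%Z -> same_set (K (om n)) (fun z => z = x \/ z = y).
Definition PG3 : Prop := forall x y, adj nbrs x y -> exists w, same_set (K w) (fun z => z = x \/ z = y).
Definition is_partition : Prop := (forall w, NoDup (K w)) /\ PG1 /\ PG2 /\ PG3.

Definition Lam_e (w : T) : Prop := length (K w) = 2%nat /\ (2 < length (K (pi w)))%nat.
Definition T_e (w : T) : Prop := (2 < length (K (pi w)))%nat.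
Definition minimal_part : Prop :=
  forall w v, Lam_e w -> Lam_e v -> w <> v -> ~ (forall x, In x (K w) <-> In x (K v)).
Definition connected_part : Prop :=
  forall w, T_e w -> forall x y, In x (K w) -> In y (K w) ->
    clos_refl_trans V (fun a b => adj nbrs a b /\ In a (K w) /\ In b (K w)) x y.

Definition gd (w : T) : R :=
  fold_right Rmax 0 (map (fun x => fold_right Rmax 0 (map (d x) (K w))) (K w)).
Definition Lam_s (s : R) (w : T) : Prop := T_e w /\ gd w <= s < gd (pi w).
Definition E_s (s : R) (w v : T) : Prop :=
  Lam_s s w /\ Lam_s s v /\ w <> v /\ exists x, In x (K w) /\ In x (K v).
Definition Lam_sM (s : R) (M : nat) (w v : T) : Prop := Lam_s s v /\ within (E_s s) M w v.
Definition Lam_sMx (s : R) (M : nat) (x : V) (v : T) : Prop :=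
  exists w, Lam_s s w /\ In x (K w) /\ Lam_sM s M w v.
Definition U_M (M : nat) (x : V) (s : R) (y : V) : Prop :=
  ((~ exists v, Lam_sMx s M x v) /\ y = x) \/ (exists v, Lam_sMx s M x v /\ In y (K v)).

Definition unif_finite : Prop :=
  exists B, forall s w, 0 < s -> card_le B (Lam_sM s 1 w).
Definition thick : Prop :=
  exists al, 0 < al /\ forall w, T_e w -> exists x, In x (K w) /\
    forall v, Lam_sMx (al * gd (pi w)) 1 x v -> desc v w.
Definition adapted : Prop :=
  exists (M : nat) a1 a2, 0 < a1 /\ 0 < a2 /\ forall x s, 0 < s ->
    (forall y, dball d x (a1 * s) y -> U_M M x s y) /\ (forall y, U_M M x s y -> dball d x (a2 * s) y).
Definition basic_framework (r : R) : Prop :=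
  (exists B, forall w, T_e w -> ~ Lam_e w -> card_le B (fun v => pi v = w)) /\
  unif_finite /\ thick /\ adapted /\ 0 < r < 1 /\
  (exists c, 0 < c /\ forall w z, T_e w -> is_height w z ->
     c * powerRZ r z <= gd w <= powerRZ r z / c).
End Tree.

Inductive Tr (T : Type) : Type :=
| Old (w : T)
| New (w : T) (m k : nat).
Arguments Old {T} w.
Arguments New {T} w m k.

(* points of the cable system: vertices, or interior points of the cable of the edge
   K_w (w in Lambda_e), with parameter t in (0,1) measured from w^+ *)
Inductive CP (V T : Type) : Type :=
| CV (x : V)
| CI (w : T) (t : R).
Arguments CV {V T} x.
Arguments CI {V T} w t.

(* n(m): 2^{-n(m)} <= r^m < 2^{1-n(m)}, i.e. n(m) = ceil(-m log_2 r) *)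
Definition nref (r : R) (m : nat) : nat := Z.to_nat (1 - up (INR m * ln r / ln 2)).

Section Refined.
Variables (V : Type) (T : Type) (pi : T -> T) (phi : T) (K : T -> list V) (r : R).

Definition pir (u : Tr T) : Tr T :=
  match u with
  | Old w => Old (pi w)
  | New w 0 _ => Old w
  | New w 1 _ => Old w
  | New w (S m') k => New w m' (Nat.div k (2 ^ (nref r (S m') - nref r m')))
  end.
Definition validTr (u : Tr T) : Prop :=
  match u with
  | Old w => T_e pi K w
  | New w m k => Lam_e pi K w /\ (1 <= m)%nat /\ (k < 2 ^ nref r m)%nat
  end.
Definition htr (u : Tr T) (z : Z) : Prop :=
  match u with
  | Old w => is_height pi phi w z
  | New w m _ => exists z0, is_height pi phi w z0 /\ z = (z0 + Z.of_nat m)%Z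
  end.

(* K_w = {w^+, w^-} written as the list [w^+; w^-]; the point of the cable of K_w
   at parameter t in [0,1] from w^+ *)
Definition cable_pt (w : T) (t : R) (p : CP V T) : Prop :=
  (t = 0 /\ exists a b, K w = a :: b :: nil /\ p = CV a) \/
  (t = 1 /\ exists a b, K w = a :: b :: nil /\ p = CV b) \/
  (0 < t < 1 /\ p = CI w t).
Definition cellK (u : Tr T) (p : CP V T) : Prop :=
  match u with
  | Old v => exists u0, Lam_e pi K u0 /\ desc pi u0 v /\ exists t, 0 <= t <= 1 /\ cable_pt u0 t p
  | New w m k => exists t, INR k / 2 ^ nref r m <= t <= (INR k + 1) / 2 ^ nref r m /\ cable_pt w t p
  end.

Definition Jh (m : Z) (u v : Tr T) : Prop :=
  validTr u /\ validTr v /\ htr u m /\ htr v m /\ u <> v /\ exists p, cellK u p /\ cellK v p.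
Definition JhN (N : nat) (m : Z) (u v : Tr T) : Prop := u <> v /\ within (Jh m) N u v.
Definition Gam (n : nat) (w v : Tr T) : Prop :=
  exists z, htr w z /\ htr v z /\ validTr v /\ within (Jh z) n w v.
Definition Sk (k : nat) (A : Tr T -> Prop) (v : Tr T) : Prop := validTr v /\ A (Nat.iter k pir v).

Definition level_energy (p N : nat) (m : Z) (f : Tr T -> R) : Rbar :=
  Lub_Rbar (fun z => exists l : list (Tr T * Tr T), NoDup l /\
     (forall q, In q l -> JhN N m (fst q) (snd q)) /\
     z = / 2 * sumR (map (fun q => Rabs (f (fst q) - f (snd q)) ^ p) l)).
Definition Epk (p k : nat) (w : Tr T) (N1 N2 N : nat) : Rbar :=
  Glb_Rbar (fun e => exists z (f : Tr T -> R), htr w z /\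
     (forall v, htr v (z + Z.of_nat k)%Z -> validTr v ->
        (Sk k (Gam N1 w) v -> f v = 1) /\ (~ Sk k (Gam N2 w) v -> f v = 0)) /\
     level_energy p N (z + Z.of_nat k)%Z f = Finite e).

Definition Nupper : Rbar :=
  Rbar_sup (fun e => exists w, validTr w /\
    e = limsupR (fun k => rootk (cardR (Sk k (fun u => u = Nat.iter k pir w))) k)).
Definition Nlower : Rbar :=
  Rbar_sup (fun e => exists w, validTr w /\
    e = liminfR (fun k => rootk (cardR (Sk k (fun u => u = Nat.iter k pir w))) k)).
Definition Rlower (p N1 N2 N : nat) : Rbar :=
  Rbar_sup (fun e => exists w, validTr w /\
    e = liminfR (fun k => rootk (Epk p k (Nat.iter k pir w) N1 N2 N) k)).
End Refined.

(* Main.v *)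
(** Every quantity is compared with the volume [v k] of the ball of radius [r^(-k)] about one vertex.
    For a fixed cell [w], the cells at the level of [w] below its [k]-th ancestor are [v k] in number
    up to constants: such cells have bounded size and multiplicity, and thickness puts a ball of
    comparable radius inside the ancestor.  The energy of the ancestor is the inverse of an effective
    resistance at scale [r^(-k)], again up to constants: cells at a fixed level and vertices differ by
    a bounded-multiplicity rough isometry, and at coarse levels a ball of radius comparable to
    [r^m] and a [Gamma]-neighbourhood in level [m] contain each other.  So the energy is comparable
    to [v k * r^(beta k)].  Hence the logarithms of the two cardinality exponents are the lower and
    upper limits of [ln (v k) / k], and [ln Nlower - ln Rlower = - beta ln r].  The heat kernel
    estimate turns [- ln p_2n / ln n] into the same limits divided by [- beta ln r] (times 2). *)

From Pilot Require Import Defs.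
From Stdlib Require Import Reals List Arith ZArith Relations.
From Stdlib Require Import Lra Lia Classical ClassicalEpsilon.
From Coquelicot Require Import Coquelicot.
(* Coquelicot's filter [within] hides the walk relation [within]. *)
Import Pilot.Defs.
Open Scope R_scope.

(** * Finite cardinality bounds and walks *)

(** The energy of the [k]-th ancestor of a cell [w] lives on the level of [w] itself: going up [k]
    levels and down again changes only the two sets on which the function is prescribed. Cells are
    therefore compared with vertices at one fixed level, and the constants, which depend on that
    level, vanish under [k]-th roots. They may even depend on [w], since each root limit has the
    same value for every [w] and the suprema over cells are suprema of constants. In contrast the
    threshold for [N2] must be uniform in [w], so balls and Gamma-neighbourhoods are compared
    uniformly over all sufficiently coarse levels. The obstacle there is that adaptedness speaks of
    cells of comparable diameter, which lie on several levels, and of a fixed number of steps,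
    whereas Gamma-neighbourhoods walk on one level and must cover a ball of prescribed radius. Walks
    are projected to ancestors on a common level; large radii are reached by moving to coarser
    ancestors and coming back through their descendants, which are linked to each other because
    cells are connected. *)

Definition fin_le {X : Type} (n : nat) (A : X -> Prop) : Prop :=
  exists l, (length l <= n)%nat /\ forall a, A a -> In a l.

Lemma fin_le_card {X : Type} n (A : X -> Prop) : fin_le n A -> card_le n A.
Proof.
  intros [l [Hl HA]] l' Hnd Hin.
  apply Nat.le_trans with (length l); [|exact Hl].
  apply NoDup_incl_length; [exact Hnd|]. intros a Ha. auto.
Qed.

Lemma card_fin_le {X : Type} n (A : X -> Prop) : card_le n A -> fin_le n A.
Proof.
  intros HA.
  assert (H : forall k, (exists l, NoDup l /\ (forall a, In a l -> A a) /\ length l = k) \/ fin_le n A).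
  { induction k as [|k [[l [Hnd [Hin Hk]]]|H]]; auto.
    - left. exists nil. repeat split; [constructor|]. intros a [].
    - destruct (classic (forall a, A a -> In a l)) as [Hall|Hnot].
      + right. exists l. split; auto.
      + apply not_all_ex_not in Hnot. destruct Hnot as [a Ha].
        apply imply_to_and in Ha. destruct Ha as [Ha Hn].
        left. exists (a :: l). repeat split; [constructor; auto| |simpl; lia].
        intros b [->|Hb]; auto. }
  destruct (H (S n)) as [[l [Hnd [Hin Hk]]]|H']; auto.
  specialize (HA l Hnd Hin). lia.
Qed.

Lemma fin_le_sub {X : Type} n m (A B : X -> Prop) :
  fin_le n B -> (n <= m)%nat -> (forall a, A a -> B a) -> fin_le m A.
Proof. intros [l [Hl HB]] Hnm HAB. exists l. split; [lia|auto]. Qed.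

Lemma fin_le_union {X : Type} n m (A B : X -> Prop) :
  fin_le n A -> fin_le m B -> fin_le (n + m) (fun a => A a \/ B a).
Proof.
  intros [l [Hl HA]] [l' [Hl' HB]]. exists (l ++ l').
  rewrite length_app. split; [lia|]. intros a [H|H]; apply in_or_app; auto.
Qed.

Lemma fin_le_bind {X Y : Type} n m (B : Y -> Prop) (P : Y -> X -> Prop) :
  fin_le n B -> (forall b, B b -> fin_le m (P b)) ->
  fin_le (n * m) (fun a => exists b, B b /\ P b a).
Proof.
  intros [l [Hl HB]] HP.
  (* The list may contain points outside [B], whose sets [P b] are not bounded; hence [B b] is kept
     in the union. *)
  assert (H : forall l', fin_le (length l' * m) (fun a => exists b, In b l' /\ B b /\ P b a)).
  { induction l' as [|b l' IH].
    - exists nil. split; [simpl; lia|]. intros a [b [[] _]].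
    - destruct (classic (B b)) as [Hb|Hb].
      + apply fin_le_sub with (n := (m + length l' * m)%nat)
          (B := fun a => P b a \/ exists b, In b l' /\ B b /\ P b a).
        * apply fin_le_union; auto.
        * simpl; lia.
        * intros a [b' [[->|Hin] [Hb' Hp]]]; [left; auto|right; eauto].
      + eapply fin_le_sub; [exact IH|simpl; lia|].
        intros a [b' [[->|Hin] [Hb' Hp]]]; [contradiction|eauto]. }
  eapply fin_le_sub; [apply (H l)|apply Nat.mul_le_mono_r; exact Hl|].
  intros a [b [Hb Hp]]. exists b. auto.
Qed.

Lemma within_trans {X : Type} (E : X -> X -> Prop) n m a b c :
  within E n a b -> within E m b c -> within E (n + m) a c.
Proof.
  revert c. induction m as [|m IH]; intros c Hab Hbc.
  - simpl in Hbc. subst. rewrite Nat.add_0_r. exact Hab.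
  - rewrite Nat.add_succ_r. destruct Hbc as [H|[d [H1 H2]]].
    + left; auto.
    + right; eauto.
Qed.

Lemma within_refl {X : Type} (E : X -> X -> Prop) n a : within E n a a.
Proof. induction n; simpl; auto. Qed.

Lemma within_one {X : Type} (E : X -> X -> Prop) a b : E a b -> within E 1 a b.
Proof. intros H. right. exists a. split; simpl; auto. Qed.

Lemma within_sym {X : Type} (E : X -> X -> Prop) n a b :
  (forall a b, E a b -> E b a) -> within E n a b -> within E n b a.
Proof.
  intros Hs. revert b. induction n as [|n IH]; intros b H; [symmetry; exact H|].
  destruct H as [H|[c [H1 H2]]]; [left; auto|].
  change (S n) with (1 + n)%nat. apply within_trans with c; auto. apply within_one; auto.
Qed.

Lemma within_mono {X : Type} (E F : X -> X -> Prop) n m a b :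
  (forall a b, E a b -> F a b) -> (n <= m)%nat -> within E n a b -> within F m a b.
Proof.
  intros HEF Hnm H. replace m with (n + (m - n))%nat by lia.
  apply within_trans with b; [|apply within_refl].
  clear Hnm. revert b H. induction n as [|n IH]; intros b H; [exact H|].
  destruct H as [H|[c [H1 H2]]]; [left; auto|right; eauto].
Qed.

Lemma within_steps {X : Type} (E F : X -> X -> Prop) M n a b :
  (forall a b, E a b -> within F M a b) -> within E n a b -> within F (n * M) a b.
Proof.
  intros HEF. revert b. induction n as [|n IH]; intros b H; [exact H|].
  rewrite Nat.mul_succ_l.
  destruct H as [H|[c [H1 H2]]].
  - apply within_trans with b; [auto|apply within_refl].
  - apply within_trans with c; auto.
Qed.

(** Projects a walk along a correspondence [P]. A step may collapse, so the number of steps survives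
    only as an upper bound. Instances are the passage to ancestors on a common level and to cells of
    a larger scale. *)
Lemma within_lift {X Y : Type} (E : X -> X -> Prop) (F : Y -> Y -> Prop) (P : X -> Y -> Prop) :
  (forall a b y, E a b -> P a y -> exists y', P b y' /\ (y = y' \/ F y y')) ->
  forall n a b y, within E n a b -> P a y -> exists y', P b y' /\ within F n y y'.
Proof.
  intros H n. induction n as [|n IH]; intros a b y Hw Hp.
  - simpl in Hw. subst. exists y. split; auto. reflexivity.
  - destruct Hw as [Hw|[c [Hw He]]].
    + destruct (IH _ _ _ Hw Hp) as [y' [H1 H2]]. exists y'. split; auto. left; auto.
    + destruct (IH _ _ _ Hw Hp) as [y' [H1 H2]].
      destruct (H _ _ _ He H1) as [y'' [H3 [H4|H4]]].
      * subst. exists y''. split; auto. left; auto.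
      * exists y''. split; auto. right; eauto.
Qed.

(* Cutting a walk after its last visit of the starting point lets one induct on the number of vertices. *)
Lemma within_shorten {X : Type} (E : X -> X -> Prop) n : forall (P : X -> Prop) x y,
  fin_le n P -> P x ->
  clos_refl_trans X (fun a b => E a b /\ P a /\ P b) x y -> within E n x y.
Proof.
  induction n as [|n IH]; intros P x y Hfin Hx Hrt.
  - destruct Hfin as [l [Hl H]]. destruct l; [destruct (H x Hx)|simpl in Hl; lia].
  - destruct (classic (y = x)) as [->|Hyx]; [apply within_refl|].
    assert (Hcut : forall x0, clos_refl_trans X (fun a b => E a b /\ P a /\ P b) x0 y ->
      (x0 <> x /\ clos_refl_trans X (fun a b => E a b /\ (P a /\ a <> x) /\ (P b /\ b <> x)) x0 y) \/
      exists x1, E x x1 /\ P x1 /\ x1 <> x /\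
        clos_refl_trans X (fun a b => E a b /\ (P a /\ a <> x) /\ (P b /\ b <> x)) x1 y).
    { intros x0 H. apply clos_rt_rt1n in H. induction H as [z|x0 x1 z [He [Hp0 Hp1]] _ IHr].
      - left. split; auto. apply rt_refl.
      - destruct IHr as [[Hne Hr]|Hr]; auto.
        destruct (classic (x0 = x)) as [->|Hne0].
        + right. exists x1. auto.
        + left. split; auto. eapply rt_trans; [apply rt_step|exact Hr]. auto. }
    destruct (Hcut x Hrt) as [[H _]|[x1 [He [Hp1 [Hne Hr]]]]]; [congruence|].
    replace (S n) with (1 + n)%nat by lia. apply within_trans with x1.
    + apply within_one; auto.
    + apply (IH (fun a => P a /\ a <> x)); auto.
      apply card_fin_le. intros l Hnd Hin.
      assert (Hc : card_le (S n) P) by (apply fin_le_card; exact Hfin).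
      specialize (Hc (x :: l)). simpl in Hc.
      cut (S (length l) <= S n)%nat; [lia|]. apply Hc.
      * constructor; auto. intros Hxl. destruct (Hin x Hxl) as [_ HH]; congruence.
      * intros a [<-|Ha]; auto. apply Hin; auto.
Qed.

(** * Sums and quadratic forms on pairs *)

Lemma functional_choice {X Y : Type} (R : X -> Y -> Prop) :
  (forall x, exists y, R x y) -> exists f : X -> Y, forall x, R x (f x).
Proof.
  intros H. exists (fun x => proj1_sig (constructive_indefinite_description _ (H x))).
  intros x. apply proj2_sig.
Qed.

Lemma sumR_app l l' : sumR (l ++ l') = sumR l + sumR l'.
Proof. induction l as [|a l IH]; simpl; [lra|]. unfold sumR in *. simpl. lra. Qed.

Lemma sumR_cons a l : sumR (a :: l) = a + sumR l.
Proof. reflexivity. Qed.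

Lemma sumR_map_le {X : Type} (f g : X -> R) l :
  (forall x, In x l -> f x <= g x) -> sumR (map f l) <= sumR (map g l).
Proof.
  induction l as [|a l IH]; intros H; [unfold sumR; simpl; lra|].
  rewrite !map_cons, !sumR_cons. apply Rplus_le_compat; [apply H; simpl; auto|apply IH; intros; apply H; simpl; auto].
Qed.

Lemma sumR_map_const {X : Type} (c : R) (l : list X) : sumR (map (fun _ => c) l) = INR (length l) * c.
Proof.
  induction l as [|a l IH]; [unfold sumR; simpl; lra|].
  rewrite map_cons, sumR_cons, IH. change (length (a :: l)) with (S (length l)). rewrite S_INR. lra.
Qed.

Lemma sumR_map_nonneg {X : Type} (f : X -> R) l : (forall x, In x l -> 0 <= f x) -> 0 <= sumR (map f l).
Proof.
  intros H. apply Rle_trans with (sumR (map (fun _ => 0) l)).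
  - rewrite sumR_map_const. lra.
  - apply sumR_map_le. exact H.
Qed.

Lemma sumR_map_lin {X : Type} (f g : X -> R) a b l :
  sumR (map (fun x => a * f x + b * g x) l) = a * sumR (map f l) + b * sumR (map g l).
Proof.
  induction l as [|x l IH]; [unfold sumR; simpl; lra|].
  rewrite !map_cons, !sumR_cons, IH. lra.
Qed.

Lemma sumR_flat_map {X Y : Type} (h : Y -> R) (g : X -> list Y) l :
  sumR (map h (flat_map g l)) = sumR (map (fun x => sumR (map h (g x))) l).
Proof.
  induction l as [|x l IH]; [reflexivity|].
  cbn [flat_map map]. rewrite map_app, sumR_app, sumR_cons, IH. reflexivity.
Qed.

Lemma sumR_incl {X : Type} (g : X -> R) l : forall l',
  (forall x, 0 <= g x) -> NoDup l -> incl l l' -> sumR (map g l) <= sumR (map g l').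
Proof.
  induction l as [|a l IH]; intros l' Hg Hnd Hinc.
  - apply sumR_map_nonneg. auto.
  - destruct (in_split a l') as [l1 [l2 ->]]; [apply Hinc; simpl; auto|].
    inversion Hnd as [|? ? Hna Hnd']; subst.
    assert (H : sumR (map g l) <= sumR (map g (l1 ++ l2))).
    { apply IH; auto. intros x Hx.
      assert (Hx' := Hinc x (or_intror Hx)).
      apply in_app_or in Hx'. apply in_or_app.
      destruct Hx' as [?|[->|?]]; auto. contradiction. }
    rewrite map_app, sumR_app in *. rewrite !map_cons, !sumR_cons. lra.
Qed.

Definition cdec {X : Type} (P : X -> Prop) (x : X) : bool :=
  if excluded_middle_informative (P x) then true else false.

Lemma cdec_true {X : Type} (P : X -> Prop) x : cdec P x = true -> P x.
Proof. unfold cdec. destruct excluded_middle_informative; auto; discriminate. Qed.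

Lemma cdec_false {X : Type} (P : X -> Prop) x : negb (cdec P x) = true -> ~ P x.
Proof. unfold cdec. destruct excluded_middle_informative; simpl; auto; discriminate. Qed.

Lemma sumR_split {X : Type} (p : X -> bool) (f : X -> R) l :
  sumR (map f l) = sumR (map f (filter p l)) + sumR (map f (filter (fun x => negb (p x)) l)).
Proof.
  induction l as [|a l IH]; [unfold sumR; simpl; lra|].
  cbn [filter]. destruct (p a); cbn [negb map]; rewrite !sumR_cons, IH; lra.
Qed.

(** Each value of [psi] is taken at most [M] times, so summing over its image loses at most a factor
    [M]. Multiplicities enter the energy comparisons through this estimate. *)
Lemma sumR_pushforward {X Y : Type} (g : Y -> R) (psi : X -> Y) M l :
  (forall y, 0 <= g y) -> NoDup l ->
  (forall y, card_le M (fun x => In x l /\ psi x = y)) ->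
  exists t, NoDup t /\ (forall y, In y t -> exists x, In x l /\ psi x = y) /\
    sumR (map (fun x => g (psi x)) l) <= INR M * sumR (map g t).
Proof.
  intros Hg Hnd HM.
  assert (H : forall t, NoDup t -> forall l, NoDup l -> incl (map psi l) t ->
    (forall y, card_le M (fun x => In x l /\ psi x = y)) ->
    sumR (map (fun x => g (psi x)) l) <= INR M * sumR (map g t)).
  { clear l Hnd HM. induction t as [|y t IH]; intros Ht l Hnd Hinc HM.
    - destruct l as [|a l]; [unfold sumR; simpl; lra|].
      destruct (Hinc (psi a)); simpl; auto.
    - inversion Ht as [|? ? Hny Ht']; subst.
      rewrite (sumR_split (cdec (fun x => psi x = y))).
      rewrite map_cons, sumR_cons, Rmult_plus_distr_l. apply Rplus_le_compat.
      + apply Rle_trans with (sumR (map (fun _ => g y) (filter (cdec (fun x => psi x = y)) l))).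
        * apply sumR_map_le. intros x Hx. apply filter_In in Hx. destruct Hx as [_ Hx].
          apply cdec_true in Hx. rewrite Hx. lra.
        * rewrite sumR_map_const. apply Rmult_le_compat_r; auto. apply le_INR.
          apply (HM y); [apply NoDup_filter; auto|].
          intros x Hx. apply filter_In in Hx. destruct Hx as [Hx1 Hx2]. apply cdec_true in Hx2. auto.
      + apply IH; auto.
        * apply NoDup_filter; auto.
        * intros z Hz. apply in_map_iff in Hz. destruct Hz as [x [<- Hx]].
          apply filter_In in Hx. destruct Hx as [Hx Hne]. apply cdec_false in Hne.
          destruct (Hinc (psi x)) as [Hz|Hz]; auto; [apply in_map; auto|congruence].
        * intros z l' Hnd' Hin'. apply (HM z l' Hnd'). intros x Hx.
          destruct (Hin' x Hx) as [Hx1 Hx2]. apply filter_In in Hx1. tauto. }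
  assert (Hdec : forall a b : Y, {a = b} + {a <> b}) by (intros; apply excluded_middle_informative).
  exists (nodup Hdec (map psi l)). split; [apply NoDup_nodup|]. split.
  - intros y Hy. apply nodup_In in Hy. apply in_map_iff in Hy.
    destruct Hy as [x [? ?]]. eauto.
  - apply H; auto; [apply NoDup_nodup|]. intros y Hy. apply nodup_In. exact Hy.
Qed.

Definition sqd {X : Type} (f : X -> R) (q : X * X) : R := (f (fst q) - f (snd q)) ^ 2.

(** An energy bound without factor 1/2 and without conductances, tested on finite lists of ordered
    pairs. Vertex energies and cell energies both reduce to it up to constants, and no infinite sum
    appears. *)
Definition qbound {X : Type} (E : X -> X -> Prop) (f : X -> R) (e : R) : Prop :=
  forall l, NoDup l -> (forall q, In q l -> E (fst q) (snd q)) -> sumR (map (sqd f) l) <= e.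

Lemma sqd_nonneg {X : Type} (f : X -> R) q : 0 <= sqd f q.
Proof. apply pow2_ge_0. Qed.

Lemma qbound_nonneg {X : Type} (E : X -> X -> Prop) f e : qbound E f e -> 0 <= e.
Proof. intros H. apply (H nil); [constructor|intros q []]. Qed.

Lemma qbound_sub {X : Type} (E F : X -> X -> Prop) f e :
  qbound F f e -> (forall a b, E a b -> F a b) -> qbound E f e.
Proof. intros H HEF l Hnd Hl. apply H; auto. Qed.

(** The map induced on ordered pairs is at most [M * M]-to-one and sends edges to edges. [D] is the
    set on which the fibres of [phi] are bounded. *)
Lemma qbound_pullback {X Y : Type} (E : X -> X -> Prop) (F : Y -> Y -> Prop) (D : Y -> Prop)
  (phi : Y -> X) (f : X -> R) e M :
  qbound E f e -> (forall x, fin_le M (fun y => D y /\ phi y = x)) ->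
  (forall y y', F y y' -> D y /\ D y' /\ E (phi y) (phi y')) ->
  qbound F (fun y => f (phi y)) (INR (M * M) * e).
Proof.
  intros HE HM HF l Hnd Hl.
  destruct (sumR_pushforward (sqd f) (fun q => (phi (fst q), phi (snd q))) (M * M) l)
    as [t [Ht [Hin Hs]]]; auto using sqd_nonneg.
  - intros [x x']. apply fin_le_card.
    eapply fin_le_sub with (m := (M * M)%nat);
      [apply fin_le_bind with (n := M) (m := M) (B := fun y => D y /\ phi y = x)
         (P := fun y q => exists y', (D y' /\ phi y' = x') /\ q = (y, y')); [apply HM|] |lia|].
    + intros y _. rewrite <- (Nat.mul_1_r M). apply fin_le_bind; [apply HM|].
      intros y' _. exists ((y, y') :: nil). split; [simpl; lia|]. intros q ->. simpl; auto.
    + intros [y y'] [Hq He]. simpl in He. injection He as H1 H2.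
      destruct (HF _ _ (Hl _ Hq)) as [H3 [H4 _]]. simpl in H3, H4.
      exists y. split; auto. exists y'. auto.
  - unfold sqd in *. simpl in *. eapply Rle_trans; [exact Hs|].
    apply Rmult_le_compat_l; [apply pos_INR|]. apply HE; auto.
    intros q Hq. destruct (Hin q Hq) as [q' [Hq' <-]]. simpl. apply HF. auto.
Qed.

Lemma fin_le_within {X : Type} (E : X -> X -> Prop) D :
  (forall x, fin_le D (fun y => E y x)) ->
  forall n x, fin_le ((1 + D) ^ n) (fun y => within E n y x).
Proof.
  intros HD n. induction n as [|n IH]; intros x.
  - exists (x :: nil). split; [simpl; lia|]. intros a Ha. simpl in *. auto.
  - apply fin_le_sub with (n := ((1 + D) ^ n + D * (1 + D) ^ n)%nat)
      (B := fun y => within E n y x \/ exists c, E c x /\ within E n y c).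
    + apply fin_le_union; [apply IH|]. apply fin_le_bind; auto.
    + simpl. lia.
    + intros a [H|[c [H1 H2]]]; eauto.
Qed.

(** A walk of [n + 1] steps is cut before its last step at a point [c], and [(f a - f b)^2 <= 2 (f a
    - f c)^2 + 2 (f c - f b)^2]. Bounded degree limits how often each half is used. *)
Lemma qbound_within {X : Type} (E : X -> X -> Prop) D :
  (forall x, fin_le D (fun y => E x y)) -> (forall x, fin_le D (fun y => E y x)) ->
  forall n, exists C, 0 <= C /\ forall f e, qbound E f e -> qbound (within E n) f (C * e).
Proof.
  intros HD1 HD2 n. induction n as [|n [C [HC IH]]].
  - exists 0. split; [lra|]. intros f e _ l Hnd Hl. rewrite Rmult_0_l.
    apply Rle_trans with (sumR (map (fun _ => 0) l)).
    + apply sumR_map_le. intros q Hq. specialize (Hl q Hq). simpl in Hl.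
      unfold sqd. rewrite Hl. lra.
    + rewrite sumR_map_const. lra.
  - set (D' := ((1 + D) ^ n)%nat).
    exists (C + (2 * (INR D * C) + 2 * INR D')). split.
    { assert (0 <= INR D) by apply pos_INR. assert (0 <= INR D') by apply pos_INR.
      assert (0 <= INR D * C) by (apply Rmult_le_pos; auto). lra. }
    intros f e He l Hnd Hl.
    assert (He0 := qbound_nonneg _ _ _ He).
    set (W := fun q : X * X => within E n (fst q) (snd q)).
    rewrite (sumR_split (cdec W)).
    rewrite Rmult_plus_distr_r. apply Rplus_le_compat.
    { apply (IH f e He); [apply NoDup_filter; auto|].
      intros q Hq. apply filter_In in Hq. destruct Hq as [_ Hq]. apply cdec_true in Hq. exact Hq. }
    set (l2 := filter (fun x => negb (cdec W x)) l).
    assert (Hnd2 : NoDup l2) by (apply NoDup_filter; auto).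
    assert (Hmid : exists mid : X * X -> X, forall q, In q l2 ->
              within E n (fst q) (mid q) /\ E (mid q) (snd q)).
    { apply (functional_choice (fun q c => In q l2 -> within E n (fst q) c /\ E c (snd q))).
      intros q. destruct (classic (In q l2)) as [Hq|Hq]; [|exists (fst q); tauto].
      assert (Hq' := Hq). apply filter_In in Hq'. destruct Hq' as [Hq1 Hq2].
      apply cdec_false in Hq2. destruct (Hl q Hq1) as [H|[c Hc]]; [contradiction|eauto]. }
    destruct Hmid as [mid Hmid].
    (* A pair [(a, c)] comes from at most [D] choices of [b], a successor of [c]; in the second half
       a pair [(c, b)] comes from at most [D'] choices of [a], from which [c] is reached in [n]
       steps. *)
    destruct (sumR_pushforward (sqd f) (fun q => (fst q, mid q)) D l2) as [t1 [Ht1 [Hin1 Hs1]]];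
      auto using sqd_nonneg.
    { intros [a c]. apply fin_le_card.
      eapply fin_le_sub with (n := (D * 1)%nat); [apply fin_le_bind with (P := fun b q => q = (a, b)); [apply (HD1 c)|]| |].
      - intros b _. exists ((a, b) :: nil). split; [apply le_n|]. intros q ->; simpl; auto.
      - rewrite Nat.mul_1_r. apply le_n.
      - intros [a' b] [Hq Heq]. simpl in Heq. injection Heq as -> <-.
        exists b. split; auto. apply (Hmid _ Hq). }
    destruct (sumR_pushforward (sqd f) (fun q => (mid q, snd q)) D' l2) as [t2 [Ht2 [Hin2 Hs2]]];
      auto using sqd_nonneg.
    { intros [c b]. apply fin_le_card.
      eapply fin_le_sub with (n := (D' * 1)%nat); [apply fin_le_bind with (P := fun a q => q = (a, b));
        [apply (fin_le_within E D HD2 n c)|]| |].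
      - intros a _. exists ((a, b) :: nil). split; [apply le_n|]. intros q ->; simpl; auto.
      - rewrite Nat.mul_1_r. apply le_n.
      - intros [a b'] [Hq Heq]. simpl in Heq. injection Heq as <- ->.
        exists a. split; auto. apply (Hmid _ Hq). }
    assert (B1 : sumR (map (sqd f) t1) <= C * e).
    { apply (IH f e He); auto. intros q Hq. destruct (Hin1 q Hq) as [q' [Hq' <-]].
      simpl. apply (Hmid q'); auto. }
    assert (B2 : sumR (map (sqd f) t2) <= e).
    { apply He; auto. intros q Hq. destruct (Hin2 q Hq) as [q' [Hq' <-]].
      simpl. apply (Hmid q'); auto. }
    apply Rle_trans with (sumR (map (fun q => 2 * sqd f (fst q, mid q) + 2 * sqd f (mid q, snd q)) l2)).
    { apply sumR_map_le. intros q _. unfold sqd. simpl.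
      assert (H := pow2_ge_0 ((f (fst q) - f (mid q)) - (f (mid q) - f (snd q)))). nra. }
    rewrite sumR_map_lin.
    assert (INR D * sumR (map (sqd f) t1) <= INR D * (C * e)) by (apply Rmult_le_compat_l; auto using pos_INR).
    assert (INR D' * sumR (map (sqd f) t2) <= INR D' * e) by (apply Rmult_le_compat_l; auto using pos_INR).
    lra.
Qed.

(** * Limits inferior and superior in the extended reals *)

Lemma Rbar_inf_lb S e : S e -> Rbar_le (Rbar_inf S) e.
Proof.
  intros He. unfold Rbar_inf.
  destruct (Glb_Rbar_correct (fun x => S (Finite x) \/ S m_infty)) as [Hlb _].
  destruct e as [x| |].
  - apply Hlb. auto.
  - destruct (Glb_Rbar _); simpl; auto.
  - destruct (Glb_Rbar _) as [g| |]; simpl; auto.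
    + specialize (Hlb (g - 1) (or_intror He)). simpl in Hlb. lra.
    + exact (Hlb 0 (or_intror He)).
Qed.

Lemma Rbar_inf_glb S b : (forall e, S e -> Rbar_le b e) -> Rbar_le b (Rbar_inf S).
Proof.
  intros H. apply (Glb_Rbar_correct (fun x => S (Finite x) \/ S m_infty)).
  intros x [Hx|Hx]; [auto|].
  apply Rbar_le_trans with m_infty; [auto|exact I].
Qed.

Lemma Rbar_sup_ub S e : S e -> Rbar_le e (Rbar_sup S).
Proof.
  intros He. unfold Rbar_sup.
  destruct (Lub_Rbar_correct (fun x => S (Finite x) \/ S p_infty)) as [Hub _].
  destruct e as [x| |].
  - apply Hub. auto.
  - destruct (Lub_Rbar _) as [g| |]; simpl; auto.
    + specialize (Hub (g + 1) (or_intror He)). simpl in Hub. lra.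
    + exact (Hub 0 (or_intror He)).
  - destruct (Lub_Rbar _); simpl; auto.
Qed.

Lemma Rbar_sup_lub S b : (forall e, S e -> Rbar_le e b) -> Rbar_le (Rbar_sup S) b.
Proof.
  intros H. apply (Lub_Rbar_correct (fun x => S (Finite x) \/ S p_infty)).
  intros x [Hx|Hx]; [auto|].
  apply Rbar_le_trans with p_infty; [exact I|auto].
Qed.

(** For the suprema over all cells: the exponent is the same for each cell, and at least one cell
    exists. *)
Lemma Rbar_sup_const (S : Rbar -> Prop) l : (exists e, S e) -> (forall e, S e -> e = l) -> Rbar_sup S = l.
Proof.
  intros [e He] H. apply Rbar_le_antisym.
  - apply Rbar_sup_lub. intros e' He'. rewrite (H e' He'). apply Rbar_le_refl.
  - rewrite <- (H e He). apply Rbar_sup_ub. exact He.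
Qed.

Lemma Rbar_le_of_above x l : (forall y, l < y -> Rbar_le x (Finite y)) -> Rbar_le x (Finite l).
Proof.
  intros H. destruct x as [x| |]; simpl; auto.
  - apply Rnot_lt_le. intros Hlt. specialize (H ((x + l) / 2)). simpl in H. lra.
  - apply (H (l + 1)). lra.
Qed.

Lemma Rbar_ge_of_below x l : (forall y, y < l -> Rbar_le (Finite y) x) -> Rbar_le (Finite l) x.
Proof.
  intros H. destruct x as [x| |]; simpl; auto.
  - apply Rnot_lt_le. intros Hlt. specialize (H ((x + l) / 2)). simpl in H. lra.
  - apply (H (l - 1)). lra.
Qed.

Lemma liminfR_unique v l :
  (forall y, y < l -> exists N, forall k, (N <= k)%nat -> Rbar_le (Finite y) (v k)) ->
  (forall y N, l < y -> exists k, (N <= k)%nat /\ Rbar_le (v k) (Finite y)) ->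
  liminfR v = Finite l.
Proof.
  intros H1 H2. unfold liminfR. apply Rbar_le_antisym.
  - apply Rbar_sup_lub. intros e [n ->]. apply Rbar_le_of_above. intros y Hy.
    destruct (H2 y n Hy) as [k [Hk Hv]]. apply Rbar_le_trans with (v k); auto.
    apply Rbar_inf_lb. eauto.
  - apply Rbar_ge_of_below. intros y Hy. destruct (H1 y Hy) as [N HN].
    eapply Rbar_le_trans; [|apply Rbar_sup_ub; exists N; reflexivity].
    apply Rbar_inf_glb. intros e [k [Hk ->]]. auto.
Qed.

Lemma limsupR_unique v l :
  (forall y, l < y -> exists N, forall k, (N <= k)%nat -> Rbar_le (v k) (Finite y)) ->
  (forall y N, y < l -> exists k, (N <= k)%nat /\ Rbar_le (Finite y) (v k)) ->
  limsupR v = Finite l.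
Proof.
  intros H1 H2. unfold limsupR. apply Rbar_le_antisym.
  - apply Rbar_le_of_above. intros y Hy. destruct (H1 y Hy) as [N HN].
    eapply Rbar_le_trans; [apply Rbar_inf_lb; exists N; reflexivity|].
    apply Rbar_sup_lub. intros e [k [Hk ->]]. auto.
  - apply Rbar_inf_glb. intros e [n ->]. apply Rbar_ge_of_below. intros y Hy.
    destruct (H2 y n Hy) as [k [Hk Hv]]. apply Rbar_le_trans with (v k); auto.
    apply Rbar_sup_ub. eauto.
Qed.

Lemma liminfR_real p l : is_LimInf_seq p (Finite l) -> liminfR (fun n => Finite (p n)) = Finite l.
Proof.
  intros H. apply liminfR_unique.
  - intros y Hy. assert (He : 0 < l - y) by lra.
    destruct (H (mkposreal _ He)) as [_ [N HN]]. exists N. intros k Hk.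
    specialize (HN k Hk). simpl in *. lra.
  - intros y N Hy. assert (He : 0 < y - l) by lra.
    destruct (H (mkposreal _ He)) as [Hn _]. destruct (Hn N) as [k [Hk Hv]].
    exists k. split; auto. simpl in *. lra.
Qed.

Lemma limsupR_real p l : is_LimSup_seq p (Finite l) -> limsupR (fun n => Finite (p n)) = Finite l.
Proof.
  intros H. apply limsupR_unique.
  - intros y Hy. assert (He : 0 < y - l) by lra.
    destruct (H (mkposreal _ He)) as [_ [N HN]]. exists N. intros k Hk.
    specialize (HN k Hk). simpl in *. lra.
  - intros y N Hy. assert (He : 0 < l - y) by lra.
    destruct (H (mkposreal _ He)) as [Hn _]. destruct (Hn N) as [k [Hk Hv]].
    exists k. split; auto. simpl in *. lra.
Qed.

(* [kappa] and [nu] translate the index of each of the two sequences into that of the other. *)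
Lemma LimInf_reparam a b q l (kappa nu : nat -> nat) :
  0 < q ->
  (forall M, exists N, forall n, (N <= n)%nat -> (M <= kappa n)%nat) ->
  (forall M, exists N, forall k, (N <= k)%nat -> (M <= nu k)%nat) ->
  (forall eps, 0 < eps -> exists N, forall n, (N <= n)%nat -> Rabs (b n - q * a (kappa n)) <= eps) ->
  (forall eps, 0 < eps -> exists N, forall k, (N <= k)%nat -> Rabs (b (nu k) - q * a k) <= eps) ->
  is_LimInf_seq a (Finite l) -> is_LimInf_seq b (Finite (q * l)).
Proof.
  intros Hq Hkap Hnu Hb1 Hb2 Ha eps.
  assert (Hh : 0 < eps / 2) by (destruct eps; simpl; lra).
  assert (Hhq : 0 < eps / 2 / q) by (apply Rdiv_lt_0_compat; auto).
  destruct (Ha (mkposreal _ Hhq)) as [HA1 [NA HA2]]. simpl in HA1, HA2.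
  assert (Hqq : q * (eps / 2 / q) = eps / 2) by (field; lra).
  split.
  - intros N. destruct (Hb2 _ Hh) as [N2 HN2]. destruct (Hnu N) as [N3 HN3].
    destruct (HA1 (max N2 N3)) as [k [Hk Hak]].
    exists (nu k). split; [apply HN3; lia|].
    assert (H := HN2 k ltac:(lia)). apply Rabs_le_between in H.
    assert (q * a k < q * (l + eps / 2 / q)) by (apply Rmult_lt_compat_l; auto).
    destruct eps; simpl in *; lra.
  - destruct (Hb1 _ Hh) as [N2 HN2]. destruct (Hkap NA) as [N3 HN3].
    exists (max N2 N3). intros n Hn.
    assert (H := HN2 n ltac:(lia)). apply Rabs_le_between in H.
    assert (H' := HA2 (kappa n) (HN3 n ltac:(lia))).
    assert (q * (l - eps / 2 / q) < q * a (kappa n)) by (apply Rmult_lt_compat_l; auto).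
    destruct eps; simpl in *; lra.
Qed.

Lemma LimSup_reparam a b q l (kappa nu : nat -> nat) :
  0 < q ->
  (forall M, exists N, forall n, (N <= n)%nat -> (M <= kappa n)%nat) ->
  (forall M, exists N, forall k, (N <= k)%nat -> (M <= nu k)%nat) ->
  (forall eps, 0 < eps -> exists N, forall n, (N <= n)%nat -> Rabs (b n - q * a (kappa n)) <= eps) ->
  (forall eps, 0 < eps -> exists N, forall k, (N <= k)%nat -> Rabs (b (nu k) - q * a k) <= eps) ->
  is_LimSup_seq a (Finite l) -> is_LimSup_seq b (Finite (q * l)).
Proof.
  intros Hq Hkap Hnu Hb1 Hb2 Ha.
  apply is_LimInf_opp_LimSup_seq in Ha. apply is_LimInf_opp_LimSup_seq.
  change (Rbar_opp (Finite (q * l))) with (Finite (- (q * l))).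
  replace (- (q * l)) with (q * - l) by ring.
  apply LimInf_reparam with (a := fun n => - a n) (kappa := kappa) (nu := nu); auto.
  - intros eps He. destruct (Hb1 eps He) as [N HN]. exists N. intros n Hn.
    rewrite <- Rabs_Ropp. replace (- (- b n - q * - a (kappa n))) with (b n - q * a (kappa n)) by ring. auto.
  - intros eps He. destruct (Hb2 eps He) as [N HN]. exists N. intros n Hn.
    rewrite <- Rabs_Ropp. replace (- (- b (nu n) - q * - a n)) with (b (nu n) - q * a n) by ring. auto.
Qed.

Lemma ex_INR_gt M : exists N, forall n, (N <= n)%nat -> M < INR n.
Proof.
  destruct (archimed M) as [H _]. exists (Z.to_nat (up M)). intros n Hn.
  apply Rlt_le_trans with (IZR (up M)); [lra|]. rewrite INR_IZR_INZ. apply IZR_le. lia.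
Qed.

Lemma div_INR_small C eps : 0 < eps -> exists N, forall n, (N <= n)%nat -> C / INR n <= eps.
Proof.
  intros He. destruct (ex_INR_gt (Rmax 0 (C / eps))) as [N HN]. exists N. intros n Hn.
  specialize (HN n Hn). assert (H1 := Rmax_l 0 (C / eps)). assert (H2 := Rmax_r 0 (C / eps)).
  apply Rmult_le_reg_r with (INR n); [lra|].
  unfold Rdiv. rewrite Rmult_assoc, Rinv_l by lra.
  assert (C = C / eps * eps) by (field; lra). nra.
Qed.

Lemma rootk_exp y k : 0 < y -> rootk (Finite y) k = Finite (exp (ln y / INR k)).
Proof.
  intros Hy. unfold rootk. destruct (Rle_dec y 0); [lra|].
  unfold Rpower. f_equal. f_equal. unfold Rdiv. ring.
Qed.

(** A bounded additive error [C] in the logarithm becomes [C / k] after division by [k]. *)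
Lemma root_perturb (y a : nat -> R) b C k0 :
  (forall k, (k0 <= k)%nat -> Rabs (ln (y k) - INR k * (a k + b)) <= C) ->
  forall eps, 0 < eps ->
  exists N, forall k, (N <= k)%nat -> Rabs ((ln (y k) / INR k - b) - 1 * a k) <= eps.
Proof.
  intros H eps He. destruct (div_INR_small C eps He) as [N HN].
  exists (max (max N k0) 1). intros k Hk.
  assert (Hk1 : 0 < INR k) by (apply lt_0_INR; lia).
  apply Rle_trans with (C / INR k); [|apply HN; lia].
  replace (ln (y k) / INR k - b - 1 * a k) with ((ln (y k) - INR k * (a k + b)) * / INR k) by (field; lra).
  rewrite Rabs_mult, (Rabs_pos_eq (/ INR k)) by (left; apply Rinv_0_lt_compat; auto).
  apply Rmult_le_compat_r; [left; apply Rinv_0_lt_compat; auto|]. apply H. lia.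
Qed.

(** Multiplicative constants disappear under [k]-th roots. The drift [b] separates the two
    applications: it is 0 for cardinalities and [beta * ln r] for energies. Nothing is asked of [u]
    before [k0], where it may be infinite. *)
Lemma liminf_root (u : nat -> Rbar) (y a : nat -> R) l b C k0 :
  is_LimInf_seq a (Finite l) ->
  (forall k, (k0 <= k)%nat -> u k = Finite (y k) /\ 0 < y k) ->
  (forall k, (k0 <= k)%nat -> Rabs (ln (y k) - INR k * (a k + b)) <= C) ->
  liminfR (fun k => rootk (u k) k) = Finite (exp (l + b)).
Proof.
  intros Ha Hu Hy.
  assert (Hp : is_LimInf_seq (fun k => ln (y k) / INR k - b) (Finite (1 * l))).
  { assert (Hc := root_perturb _ _ _ _ _ Hy).
    apply (LimInf_reparam a _ 1 l (fun n => n) (fun n => n)); auto; try lra; intros M; exists M; auto. }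
  rewrite Rmult_1_l in Hp. apply liminfR_unique.
  - intros t Ht. destruct (Rle_or_lt t 0) as [Ht0|Ht0].
    + exists k0. intros k Hk. destruct (Hu k Hk) as [-> Hyk]. rewrite rootk_exp by auto.
      simpl. assert (0 < exp (ln (y k) / INR k)) by apply exp_pos. lra.
    + assert (Hl : ln t < l + b) by (rewrite <- (ln_exp (l + b)); apply ln_increasing; auto).
      assert (He : 0 < l + b - ln t) by lra.
      destruct (Hp (mkposreal _ He)) as [_ [N HN]]. exists (max N k0). intros k Hk.
      destruct (Hu k ltac:(lia)) as [-> Hyk]. rewrite rootk_exp by auto. simpl.
      specialize (HN k ltac:(lia)). simpl in HN.
      rewrite <- (exp_ln t) at 1 by auto. left. apply exp_increasing. lra.
  - intros t N Ht. assert (Ht0 : 0 < t) by (assert (H := exp_pos (l + b)); lra).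
    assert (Hl : l + b < ln t) by (rewrite <- (ln_exp (l + b)); apply ln_increasing; auto using exp_pos).
    assert (He : 0 < ln t - (l + b)) by lra.
    destruct (Hp (mkposreal _ He)) as [Hn _]. destruct (Hn (max N k0)) as [k [Hk Hv]].
    exists k. split; [lia|].
    destruct (Hu k ltac:(lia)) as [-> Hyk]. rewrite rootk_exp by auto. simpl in *.
    rewrite <- (exp_ln t) by auto. left. apply exp_increasing. lra.
Qed.

Lemma limsup_root (u : nat -> Rbar) (y a : nat -> R) l b C k0 :
  is_LimSup_seq a (Finite l) ->
  (forall k, (k0 <= k)%nat -> u k = Finite (y k) /\ 0 < y k) ->
  (forall k, (k0 <= k)%nat -> Rabs (ln (y k) - INR k * (a k + b)) <= C) ->
  limsupR (fun k => rootk (u k) k) = Finite (exp (l + b)).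
Proof.
  intros Ha Hu Hy.
  assert (Hp : is_LimSup_seq (fun k => ln (y k) / INR k - b) (Finite (1 * l))).
  { assert (Hc := root_perturb _ _ _ _ _ Hy).
    apply (LimSup_reparam a _ 1 l (fun n => n) (fun n => n)); auto; try lra; intros M; exists M; auto. }
  rewrite Rmult_1_l in Hp. apply limsupR_unique.
  - intros t Ht. assert (Ht0 : 0 < t) by (assert (H := exp_pos (l + b)); lra).
    assert (Hl : l + b < ln t) by (rewrite <- (ln_exp (l + b)); apply ln_increasing; auto using exp_pos).
    assert (He : 0 < ln t - (l + b)) by lra.
    destruct (Hp (mkposreal _ He)) as [_ [N HN]]. exists (max N k0). intros k Hk.
    destruct (Hu k ltac:(lia)) as [-> Hyk]. rewrite rootk_exp by auto. simpl.
    specialize (HN k ltac:(lia)). simpl in HN.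
    rewrite <- (exp_ln t) by auto. left. apply exp_increasing. lra.
  - intros t N Ht. destruct (Rle_or_lt t 0) as [Ht0|Ht0].
    + exists (max N k0). split; [lia|]. destruct (Hu (max N k0) ltac:(lia)) as [-> Hyk].
      rewrite rootk_exp by auto.
      simpl. left. apply Rle_lt_trans with 0; auto using exp_pos.
    + assert (Hl : ln t < l + b) by (rewrite <- (ln_exp (l + b)); apply ln_increasing; auto).
      assert (He : 0 < l + b - ln t) by lra.
      destruct (Hp (mkposreal _ He)) as [Hn _]. destruct (Hn (max N k0)) as [k [Hk Hv]].
      exists k. split; [lia|].
      destruct (Hu k ltac:(lia)) as [-> Hyk]. rewrite rootk_exp by auto. simpl in *.
      rewrite <- (exp_ln t) at 1 by auto. left. apply exp_increasing. lra.
Qed.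

Lemma ex_LimInf_bounded (a : nat -> R) A B k0 :
  (forall k, (k0 <= k)%nat -> A <= a k <= B) -> exists l, is_LimInf_seq a (Finite l).
Proof.
  intros H. destruct (ex_LimInf_seq a) as [[l| |] Hl]; [eauto| |].
  - destruct (Hl (B + 1)) as [N HN]. specialize (HN (max N k0) ltac:(lia)).
    specialize (H (max N k0) ltac:(lia)). lra.
  - destruct (Hl (A - 1) k0) as [n [Hn Hn']]. specialize (H n Hn). lra.
Qed.

Lemma ex_LimSup_bounded (a : nat -> R) A B k0 :
  (forall k, (k0 <= k)%nat -> A <= a k <= B) -> exists l, is_LimSup_seq a (Finite l).
Proof.
  intros H. destruct (ex_LimSup_seq a) as [[l| |] Hl]; [eauto| |].
  - destruct (Hl (B + 1) k0) as [n [Hn Hn']]. specialize (H n Hn). lra.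
  - destruct (Hl (A - 1)) as [N HN]. specialize (HN (max N k0) ltac:(lia)).
    specialize (H (max N k0) ltac:(lia)). lra.
Qed.

(** * Finite suprema, infima and cardinalities *)

Lemma Lub_bounded (E : R -> Prop) b : (exists x, E x) -> (forall x, E x -> x <= b) ->
  exists v, Lub_Rbar E = Finite v /\ v <= b /\ forall x, E x -> x <= v.
Proof.
  intros [x Hx] Hb. destruct (Lub_Rbar_correct E) as [H1 H2].
  assert (H3 : Rbar_le (Lub_Rbar E) (Finite b)) by (apply H2; intros y Hy; simpl; auto).
  assert (H4 := H1 x Hx).
  destruct (Lub_Rbar E) as [v| |]; simpl in *; try contradiction.
  exists v. repeat split; auto.
Qed.

(** The last conjunct provides near-minimisers, since an infimum of energies is not assumed to be
    attained. *)
Lemma Glb_bounded (E : R -> Prop) b : (exists x, E x) -> (forall x, E x -> b <= x) ->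
  exists v, Glb_Rbar E = Finite v /\ b <= v /\ (forall x, E x -> v <= x) /\
    forall c, v < c -> exists x, E x /\ x < c.
Proof.
  intros [x Hx] Hb. destruct (Glb_Rbar_correct E) as [H1 H2].
  assert (H3 : Rbar_le (Finite b) (Glb_Rbar E)) by (apply H2; intros y Hy; simpl; auto).
  assert (H4 := H1 x Hx).
  destruct (Glb_Rbar E) as [v| |] eqn:HE; simpl in *; try contradiction.
  exists v. split; [reflexivity|]. split; [exact H3|]. split; [exact H1|].
  intros c Hc. apply NNPP. intros Hn.
  assert (H5 : Rbar_le (Finite c) (Finite v)).
  { apply H2. intros y Hy. simpl. apply Rnot_lt_le. intros Hlt. apply Hn. eauto. }
  simpl in H5. lra.
Qed.

Lemma cardR_finite {X : Type} n (A : X -> Prop) : fin_le n A ->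
  exists l, NoDup l /\ (forall a, A a <-> In a l) /\ cardR A = Finite (INR (length l)).
Proof.
  intros [l0 [_ Hl0]].
  assert (Hdec : forall a b : X, {a = b} + {a <> b}) by (intros; apply excluded_middle_informative).
  set (l := nodup Hdec (filter (cdec A) l0)).
  assert (Hl : forall a, A a <-> In a l).
  { intros a. unfold l. rewrite nodup_In, filter_In. split.
    - intros Ha. split; auto. unfold cdec. destruct excluded_middle_informative; tauto.
    - intros [_ Ha]. apply (cdec_true A a Ha). }
  exists l. split; [apply NoDup_nodup|]. split; auto.
  apply is_lub_Rbar_unique. split.
  - intros z [l' [Hnd [Hin ->]]]. simpl. apply le_INR. apply NoDup_incl_length; auto.
    intros a Ha. apply Hl. auto.
  - intros b Hb. apply Hb. exists l. split; [apply NoDup_nodup|].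
    split; [intros a Ha; apply Hl; exact Ha|reflexivity].
Qed.

Lemma NoDup_edge_pairs {X : Type} (g : X -> list X) l :
  NoDup l -> (forall x, NoDup (g x)) -> NoDup (flat_map (fun x => map (pair x) (g x)) l).
Proof.
  intros Hl Hg. induction Hl as [|x l Hx Hl IH]; [constructor|]. simpl. apply NoDup_app; auto.
  - apply NoDup_map_NoDup_ForallPairs; auto. intros a b _ _ E. congruence.
  - intros q Hq Hq'. apply in_map_iff in Hq. destruct Hq as [y [<- Hy]].
    apply in_flat_map in Hq'. destruct Hq' as [x' [Hx' Hq']]. apply in_map_iff in Hq'.
    destruct Hq' as [y' [E _]]. injection E as -> ->. contradiction.
Qed.

(** * Heights and the partition *)

Lemma clos_rt_first {X : Type} (E : X -> X -> Prop) x y :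
  clos_refl_trans X E x y -> x <> y -> exists z, E x z.
Proof.
  intros H. apply clos_rt_rt1n in H. destruct H as [|z y' He _]; [congruence|eauto].
Qed.

Lemma NoDup_pair {X : Type} (l : list X) x y :
  NoDup l -> x <> y -> same_set l (fun z => z = x \/ z = y) -> length l = 2%nat.
Proof.
  intros Hnd Hne Hs.
  assert (H1 : (length l <= 2)%nat).
  { apply (NoDup_incl_length Hnd (l' := x :: y :: nil)).
    intros z Hz. apply Hs in Hz. simpl. intuition. }
  assert (H2 : (2 <= length l)%nat).
  { assert (Hxy : NoDup (x :: y :: nil)).
    { repeat constructor; simpl; intuition. }
    apply (NoDup_incl_length Hxy (l' := l)).
    intros z Hz. apply Hs. simpl in Hz. intuition. }
  lia.
Qed.

Section Framework.
Variables (V : Type) (nbrs : V -> list V) (mu : V -> V -> R)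
  (T : Type) (pi : T -> T) (phi : T) (K : T -> list V)
  (d : V -> V -> R) (r alpha beta : R).
Variables (D : nat) (cmu cd Cf Cv : R) (B M : nat) (al a1 a2 cg : R).
Hypothesis HV : countably_infinite V.
Hypothesis Hnd : forall x, NoDup (nbrs x).
Hypothesis Hirr : forall x, ~ adj nbrs x x.
Hypothesis Hsym : forall x y, adj nbrs x y -> adj nbrs y x.
Hypothesis Hconn : forall x y, clos_refl_trans V (adj nbrs) x y.
Hypothesis Hdeg : forall x, (length (nbrs x) <= D)%nat.
Hypothesis Hcmu : 0 < cmu.
Hypothesis Hmu : forall x y, adj nbrs x y -> cmu <= mu x y <= / cmu.
Hypothesis HT1 : tree_T1 pi.
Hypothesis HT2 : tree_T2 pi.
Hypothesis HK : is_partition nbrs pi phi K.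
Hypothesis Hmin : minimal_part pi K.
Hypothesis Hcon : connected_part nbrs pi K.
Hypothesis Hd : is_metric d.
Hypothesis HCf : 0 < Cf.
Hypothesis HF1 : forall x y z, adj nbrs x y -> x <> z -> d x y <= Cf * d x z.
Hypothesis HB : forall w, T_e pi K w -> ~ Lam_e pi K w -> card_le B (fun v => pi v = w).
Hypothesis Hal : 0 < al.
Hypothesis Hthick : forall w, T_e pi K w -> exists x, In x (K w) /\
    forall v, Lam_sMx d pi K (al * gd d K (pi w)) 1 x v -> desc pi v w.
Hypothesis Ha1 : 0 < a1.
Hypothesis Ha2 : 0 < a2.
Hypothesis Hadapt : forall x s, 0 < s ->
    (forall y, dball d x (a1 * s) y -> U_M d pi K M x s y) /\
    (forall y, U_M d pi K M x s y -> dball d x (a2 * s) y).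
Hypothesis Hr : 0 < r < 1.
Hypothesis Hcg : 0 < cg.
Hypothesis Hgd : forall w z, T_e pi K w -> is_height pi phi w z ->
    cg * powerRZ r z <= gd d K w <= powerRZ r z / cg.
Hypothesis Hab : 1 <= alpha < beta.
Hypothesis Hcd : 0 < cd.
Hypothesis Hd1 : forall x y, adj nbrs x y -> cd <= d x y <= / cd.
Hypothesis HCv : 0 < Cv.
Hypothesis Hvol : forall x s t, 0 < t -> t < s ->
    Rbar_le (Vd nbrs mu d x s) (Rbar_mult (Finite (Cv * Rpower (s / t) alpha)) (Vd nbrs mu d x t)).

Notation iter n w := (Nat.iter n pi w).
Notation rz := (powerRZ r).
Notation Te := (T_e pi K).
Notation Le := (Lam_e pi K).

Lemma d_nonneg x y : 0 <= d x y.
Proof. apply Hd. Qed.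
Lemma d_refl x : d x x = 0.
Proof. apply Hd. reflexivity. Qed.
Lemma d_sym x y : d x y = d y x.
Proof. apply Hd. Qed.
Lemma d_tri x y z : d x z <= d x y + d y z.
Proof. apply Hd. Qed.

Lemma iter_plus n m w : iter (n + m) w = iter n (iter m w).
Proof. apply Nat.iter_add. Qed.

Lemma iter_S_r n w : iter (S n) w = iter n (pi w).
Proof. rewrite <- Nat.add_1_r, iter_plus. reflexivity. Qed.

Lemma ex_height w : exists z, is_height pi phi w z.
Proof. destruct (HT1 w phi) as [n [m H]]. exists (Z.of_nat n - Z.of_nat m)%Z, n, m. auto. Qed.

(** Continuing the first relation up to [n'] steps gives two equal iterates of [phi]; if their
    exponents differed, some ancestor of [phi] would be periodic, against (T2). *)
Lemma height_unique_le w n m n' m' : (n <= n')%nat ->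
  iter n w = iter m phi -> iter n' w = iter m' phi ->
  (Z.of_nat n - Z.of_nat m = Z.of_nat n' - Z.of_nat m')%Z.
Proof.
  intros Hle H H'. replace n' with ((n' - n) + n)%nat in H' by lia.
  rewrite iter_plus, H, <- iter_plus in H'.
  assert (HE : ((n' - n) + m = m')%nat); [|lia].
  destruct (Nat.lt_trichotomy ((n' - n) + m) m') as [Hlt|[|Hlt]]; auto; exfalso.
  - replace m' with ((m' - ((n' - n) + m)) + ((n' - n) + m))%nat in H' by lia.
    rewrite (iter_plus (m' - _)) in H'.
    eapply HT2; [|symmetry; exact H']. lia.
  - replace ((n' - n) + m)%nat with ((((n' - n) + m) - m') + m')%nat in H' by lia.
    rewrite iter_plus in H'.
    eapply HT2; [|exact H']. lia.
Qed.

Lemma height_unique w z z' : is_height pi phi w z -> is_height pi phi w z' -> z = z'.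
Proof.
  intros [n [m [H ->]]] [n' [m' [H' ->]]].
  destruct (Nat.le_ge_cases n n') as [Hle|Hle].
  - eapply height_unique_le; eauto.
  - symmetry. eapply height_unique_le; eauto.
Qed.

Definition ht (w : T) : Z := proj1_sig (constructive_indefinite_description _ (ex_height w)).

Lemma ht_spec w : is_height pi phi w (ht w).
Proof. unfold ht. apply proj2_sig. Qed.

Lemma ht_eq w z : is_height pi phi w z -> z = ht w.
Proof. intros H. eapply height_unique; eauto using ht_spec. Qed.

Lemma ht_height w z : ht w = z -> is_height pi phi w z.
Proof. intros <-. apply ht_spec. Qed.

Lemma ht_pi w : ht (pi w) = (ht w - 1)%Z.
Proof.
  symmetry. apply ht_eq. destruct (ht_spec w) as [n [m [H ->]]].
  destruct n as [|n].
  - exists 0%nat, (S m). split; [simpl in *; congruence|lia].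
  - exists n, m. split; [rewrite <- iter_S_r; auto|lia].
Qed.

Lemma ht_iter n w : ht (iter n w) = (ht w - Z.of_nat n)%Z.
Proof.
  induction n as [|n IH]; [simpl; lia|].
  change (iter (S n) w) with (pi (iter n w)). rewrite ht_pi, IH. lia.
Qed.

(** [Z.to_nat] truncates: if [m] exceeds the height of [w], the value is [w] itself. Being an
    ancestor thus holds without conditions, having height [m] does not. *)
Definition anc (m : Z) (w : T) : T := iter (Z.to_nat (ht w - m)) w.

Lemma ht_anc m w : (m <= ht w)%Z -> ht (anc m w) = m.
Proof. intros H. unfold anc. rewrite ht_iter. lia. Qed.

Lemma desc_anc m w : desc pi w (anc m w).
Proof. eexists. reflexivity. Qed.

Lemma anc_self w : anc (ht w) w = w.
Proof. unfold anc. rewrite Z.sub_diag. reflexivity. Qed.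

Lemma desc_refl w : desc pi w w.
Proof. exists 0%nat. reflexivity. Qed.

Lemma desc_trans u v w : desc pi u v -> desc pi v w -> desc pi u w.
Proof. intros [n <-] [m <-]. exists (m + n)%nat. apply iter_plus. Qed.

Lemma desc_ht v w : desc pi v w -> (ht w <= ht v)%Z.
Proof. intros [n <-]. rewrite ht_iter. lia. Qed.

Lemma desc_eq_anc v w : desc pi v w -> w = anc (ht w) v.
Proof. intros [n <-]. unfold anc. rewrite ht_iter. f_equal. lia. Qed.

Lemma desc_unique v w w' : desc pi v w -> desc pi v w' -> ht w = ht w' -> w = w'.
Proof. intros H H' He. rewrite (desc_eq_anc _ _ H), (desc_eq_anc _ _ H'), He. reflexivity. Qed.

Lemma NoDup_K w : NoDup (K w).
Proof. apply HK. Qed.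

Lemma K_pi w : incl (K w) (K (pi w)).
Proof. intros x Hx. destruct HK as [_ [H _]]. apply (H (pi w)). eauto. Qed.

Lemma K_desc v w : desc pi v w -> incl (K v) (K w).
Proof.
  intros [n <-]. induction n as [|n IH]; [apply incl_refl|].
  eapply incl_tran; [exact IH|]. apply K_pi.
Qed.

Lemma K_child x w : In x (K w) -> exists v, pi v = w /\ In x (K v).
Proof. intros Hx. destruct HK as [_ [H _]]. apply (H w). exact Hx. Qed.

Lemma Te_desc v w : Te v -> desc pi v w -> Te w.
Proof.
  intros Hv [n <-]. induction n as [|n IH]; [exact Hv|].
  unfold T_e in *. eapply Nat.lt_le_trans; [exact IH|].
  apply NoDup_incl_length; [apply NoDup_K|]. simpl. apply K_pi.
Qed.

Lemma adj_neq x y : adj nbrs x y -> x <> y.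
Proof. intros H ->. exact (Hirr _ H). Qed.

(* PG2 applied to a ray in [Sigma^*] through [w] all of whose cells contain [x]. *)
Lemma edge_below x w : In x (K w) ->
  exists v a b, desc pi v w /\ In x (K v) /\ adj nbrs a b /\ same_set (K v) (fun z => z = a \/ z = b).
Proof.
  intros Hx.
  assert (Hch : exists ch : T -> T, forall v, In x (K v) -> pi (ch v) = v /\ In x (K (ch v))).
  { apply (functional_choice (fun v c => In x (K v) -> pi c = v /\ In x (K c))). intros v.
    destruct (classic (In x (K v))) as [H|H]; [|exists v; tauto].
    destruct (K_child _ _ H) as [c Hc]. eauto. }
  destruct Hch as [ch Hch].
  set (s := fun n => Nat.iter n ch w).
  assert (Hs : forall n, In x (K (s n))).
  { induction n as [|n IH]; [exact Hx|]. apply (Hch (s n)). exact IH. }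
  assert (Hsp : forall n, pi (s (S n)) = s n) by (intros n; apply (Hch (s n)); apply Hs).
  assert (Hsh : forall n, ht (s n) = (ht w + Z.of_nat n)%Z).
  { induction n as [|n IH]; [simpl; lia|]. assert (H := ht_pi (s (S n))). rewrite Hsp in H. lia. }
  assert (Hsd : forall n, desc pi (s n) w).
  { induction n as [|n IH]; [apply desc_refl|]. apply desc_trans with (s n); auto.
    exists 1%nat. apply Hsp. }
  (* The ray follows the ancestors of [w] up to the height of [w] and the chosen descendants beyond
     it; the two pieces meet at [w]. *)
  set (om := fun z => if Z_le_dec z (ht w) then anc z w else s (Z.to_nat (z - ht w))).
  assert (Hom : in_Sigma pi phi om).
  { intros z. unfold om. split.
    - destruct (Z_le_dec z (ht w)) as [Hz|Hz].
      + rewrite <- (ht_anc z w Hz) at 2. apply ht_spec.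
      + replace z with (ht (s (Z.to_nat (z - ht w)))) at 2; [apply ht_spec|]. rewrite Hsh. lia.
    - destruct (Z_le_dec (z + 1) (ht w)) as [H1|H1]; destruct (Z_le_dec z (ht w)) as [H2|H2]; try lia.
      + unfold anc. replace (Z.to_nat (ht w - z)) with (S (Z.to_nat (ht w - (z + 1)))) by lia. reflexivity.
      + replace (Z.to_nat (z + 1 - ht w)) with 1%nat by lia. rewrite Hsp.
        replace z with (ht w) by lia. rewrite anc_self. reflexivity.
      + replace (Z.to_nat (z + 1 - ht w)) with (S (Z.to_nat (z - ht w))) by lia. apply Hsp. }
  destruct HK as [_ [_ [H2 _]]]. destruct (H2 om Hom) as [n0 [a [b [Hadj Hn]]]].
  set (z := Z.max n0 (ht w + 1)). specialize (Hn z ltac:(lia)).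
  assert (Hz : om z = s (Z.to_nat (z - ht w))).
  { unfold om. destruct (Z_le_dec z (ht w)); [lia|reflexivity]. }
  rewrite Hz in Hn. exists (s (Z.to_nat (z - ht w))), a, b. auto.
Qed.

(** (PG2) puts both ends of an edge into [K e], and a set of two vertices containing them is that
    edge. *)
Lemma Le_edge e : Le e -> exists a b, adj nbrs a b /\ K e = a :: b :: nil.
Proof.
  intros [Hl Ht]. destruct (K e) as [|p [|q [|? ?]]] eqn:HE; simpl in Hl; try discriminate.
  assert (Hp : In p (K e)) by (rewrite HE; simpl; auto).
  destruct (edge_below _ _ Hp) as [v [a [b [Hv [_ [Hadj Hs]]]]]].
  exists p, q. split; auto.
  assert (Ha : In a (K e)) by (apply (K_desc _ _ Hv); apply Hs; auto).
  assert (Hb : In b (K e)) by (apply (K_desc _ _ Hv); apply Hs; auto).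
  rewrite HE in Ha, Hb. simpl in Ha, Hb. assert (Hn := adj_neq _ _ Hadj).
  destruct Ha as [<-|[<-|[]]]; destruct Hb as [<-|[<-|[]]]; try congruence; auto.
Qed.

Lemma len_K_ge2 x w : In x (K w) -> (2 <= length (K w))%nat.
Proof.
  intros Hx. destruct (edge_below _ _ Hx) as [v [a [b [Hv [_ [Hadj Hs]]]]]].
  rewrite <- (NoDup_pair _ _ _ (NoDup_K v) (adj_neq _ _ Hadj) Hs).
  apply NoDup_incl_length; [apply NoDup_K|apply K_desc; auto].
Qed.

(** Start at an edge cell below [w] and climb. Nonempty cells have at least two vertices, so the
    size stays 2 until it first exceeds 2; the cell just before is in [Lam_e]. If this never happens
    below [w], then [w] itself is in [Lam_e]. *)
Lemma Le_below w x : Te w -> In x (K w) -> exists e, Le e /\ desc pi e w /\ In x (K e).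
Proof.
  intros Hw Hx. destruct (edge_below _ _ Hx) as [v [a [b [[n Hn] [Hxv [Hadj Hs]]]]]].
  assert (Hl := NoDup_pair _ _ _ (NoDup_K v) (adj_neq _ _ Hadj) Hs). clear a b Hadj Hs.
  revert v Hn Hxv Hl. induction n as [|n IH]; intros v Hn Hxv Hl.
  - simpl in Hn. subst v. exists w. repeat split; auto using desc_refl.
  - destruct (Nat.lt_ge_cases 2 (length (K (pi v)))) as [Hlt|Hge].
    + exists v. repeat split; auto. exists (S n). exact Hn.
    + apply (IH (pi v)).
      * rewrite <- iter_S_r. exact Hn.
      * apply K_pi; auto.
      * assert (H := len_K_ge2 _ _ (K_pi v _ Hxv)). lia.
Qed.

Lemma ex_neq2 x y : exists z : V, z <> x /\ z <> y.
Proof.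
  destruct HV as [e [_ Hinj]].
  destruct (classic (e 0%nat <> x /\ e 0%nat <> y)) as [H|H0]; [eauto|].
  destruct (classic (e 1%nat <> x /\ e 1%nat <> y)) as [H|H1]; [eauto|].
  exists (e 2%nat).
  assert (e 0%nat <> e 1%nat) by (intros E; apply Hinj in E; discriminate).
  assert (e 0%nat <> e 2%nat) by (intros E; apply Hinj in E; discriminate).
  assert (e 1%nat <> e 2%nat) by (intros E; apply Hinj in E; discriminate).
  destruct (classic (e 0%nat = x)); destruct (classic (e 0%nat = y));
  destruct (classic (e 1%nat = x)); destruct (classic (e 1%nat = y));
  split; try congruence; tauto.
Qed.

Lemma has_nbr x : exists y, adj nbrs x y.
Proof.
  destruct (ex_neq2 x x) as [z [Hz _]].
  apply (clos_rt_first _ x z); auto.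
Qed.

(** A cell carrying the edge and a cell carrying an edge at a third vertex have a common ancestor by
    (T1), and that ancestor has at least three vertices. Climbing towards it from the first cell
    passes through [Lam_e]. *)
Lemma edge_Le x y : adj nbrs x y -> exists e, Le e /\ In x (K e) /\ In y (K e).
Proof.
  intros Hxy. destruct HK as [_ [_ [_ H3]]].
  destruct (ex_neq2 x y) as [z [Hzx Hzy]]. destruct (has_nbr z) as [z' Hz'].
  destruct (H3 _ _ Hxy) as [w Hw]. destruct (H3 _ _ Hz') as [w' Hw'].
  destruct (HT1 w w') as [n [m Hnm]].
  assert (Hxy' := adj_neq _ _ Hxy).
  assert (Hlong : (2 < length (K (iter n w)))%nat).
  { assert (Hnd3 : NoDup (x :: y :: z :: nil)).
    { repeat constructor; simpl; intuition. }
    apply (NoDup_incl_length Hnd3). intros v Hv.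
    destruct Hv as [<-|[<-|[<-|[]]]].
    - apply (K_desc w); [exists n; reflexivity|]. apply Hw; auto.
    - apply (K_desc w); [exists n; reflexivity|]. apply Hw; auto.
    - rewrite Hnm. apply (K_desc w'); [exists m; reflexivity|]. apply Hw'; auto. }
  assert (Hl := NoDup_pair _ _ _ (NoDup_K w) Hxy' Hw).
  assert (Hx : In x (K w)) by (apply Hw; auto).
  assert (Hy : In y (K w)) by (apply Hw; auto).
  clear Hw Hnm. revert w Hl Hx Hy Hlong. induction n as [|n IH]; intros w Hl Hx Hy Hlong.
  - simpl in Hlong. lia.
  - destruct (Nat.lt_ge_cases 2 (length (K (pi w)))) as [Hlt|Hge].
    + exists w. repeat split; auto.
    + apply (IH (pi w)); try (apply K_pi; auto).
      * assert (H := len_K_ge2 _ _ (K_pi w _ Hx)). lia.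
      * rewrite <- iter_S_r. exact Hlong.
Qed.

Lemma vertex_Le x : exists e, Le e /\ In x (K e).
Proof. destruct (has_nbr x) as [y Hy]. destruct (edge_Le _ _ Hy) as [e He]. exists e. tauto. Qed.

Lemma Le_unique e e' x y : Le e -> Le e' -> x <> y ->
  In x (K e) -> In y (K e) -> In x (K e') -> In y (K e') -> e = e'.
Proof.
  intros He He' Hne H1 H2 H3 H4. apply NNPP. intros Hn. apply (Hmin _ _ He He' Hn).
  assert (Hs : forall f, Le f -> In x (K f) -> In y (K f) -> forall z, In z (K f) <-> z = x \/ z = y).
  { intros f Hf Hxf Hyf z. destruct (Le_edge _ Hf) as [a [b [_ HE]]]. rewrite HE in *. simpl in *.
    destruct Hxf as [<-|[<-|[]]]; destruct Hyf as [<-|[<-|[]]]; try congruence; intuition. }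
  intros z. rewrite (Hs e), (Hs e'); tauto.
Qed.

(** By minimality a cell in [Lam_e] is determined by its edge, so the degree bounds the number of
    those at [x]. *)
Lemma fin_le_Le x : fin_le D (fun e => Le e /\ In x (K e)).
Proof.
  apply fin_le_sub with (n := (D * 1)%nat)
    (B := fun e => exists y, In y (nbrs x) /\ (Le e /\ In x (K e) /\ In y (K e) /\ x <> y)).
  - apply fin_le_bind.
    + exists (nbrs x). split; auto.
    + intros y _. apply card_fin_le. intros l Hndl Hl.
      destruct l as [|e [|e' l]]; simpl; try lia. exfalso.
      destruct (Hl e) as [E1 [E2 [E3 E4]]]; [simpl; auto|].
      destruct (Hl e') as [E1' [E2' [E3' E4']]]; [simpl; auto|].
      assert (e = e') by (apply (Le_unique e e' x y); auto). subst.
      inversion Hndl as [|? ? Hn _]; subst. apply Hn. simpl. auto.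
  - lia.
  - intros e [He Hx]. destruct (Le_edge _ He) as [a [b [Hadj HE]]].
    rewrite HE in Hx. simpl in Hx. assert (Hn := adj_neq _ _ Hadj).
    destruct Hx as [<-|[<-|[]]]; [exists b|exists a]; rewrite HE;
        (split; [first [exact Hadj | exact (Hsym _ _ Hadj)]|
                 split; [exact He|simpl; intuition congruence]]).
Qed.

(** * Diameters of cells and scales *)

Lemma fold_Rmax_ub (l : list R) x : In x l -> x <= fold_right Rmax 0 l.
Proof.
  induction l as [|a l IH]; intros []; simpl.
  - subst. apply Rmax_l.
  - eapply Rle_trans; [apply IH; auto|apply Rmax_r].
Qed.

Lemma fold_Rmax_lub (l : list R) s : 0 <= s -> (forall x, In x l -> x <= s) -> fold_right Rmax 0 l <= s.
Proof.
  intros Hs. induction l as [|a l IH]; intros H; simpl; auto.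
  apply Rmax_lub; [apply H; simpl; auto|]. apply IH. intros; apply H; simpl; auto.
Qed.

Lemma gd_ub w x y : In x (K w) -> In y (K w) -> d x y <= gd d K w.
Proof.
  intros Hx Hy. unfold gd.
  apply Rle_trans with (fold_right Rmax 0 (map (d x) (K w))).
  - apply fold_Rmax_ub. apply in_map. exact Hy.
  - apply fold_Rmax_ub. apply in_map_iff. eauto.
Qed.

Lemma gd_lub w s : 0 <= s -> (forall x y, In x (K w) -> In y (K w) -> d x y <= s) -> gd d K w <= s.
Proof.
  intros Hs H. unfold gd. apply fold_Rmax_lub; auto. intros t Ht.
  apply in_map_iff in Ht. destruct Ht as [x [<- Hx]]. apply fold_Rmax_lub; auto.
  intros t Ht. apply in_map_iff in Ht. destruct Ht as [y [<- Hy]]. auto.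
Qed.

Lemma gd_desc v w : desc pi v w -> gd d K v <= gd d K w.
Proof.
  intros H. apply gd_lub.
  - unfold gd. destruct (K w) as [|x l] eqn:E; [simpl; lra|].
    simpl. eapply Rle_trans; [|apply Rmax_l]. eapply Rle_trans; [|apply Rmax_l]. apply d_nonneg.
  - intros x y Hx Hy. apply gd_ub; apply (K_desc v w); auto.
Qed.

Lemma gd_le w : Te w -> gd d K w <= rz (ht w) / cg.
Proof. intros H. apply (Hgd _ _ H (ht_spec w)). Qed.

Lemma gd_ge w : Te w -> cg * rz (ht w) <= gd d K w.
Proof. intros H. apply (Hgd _ _ H (ht_spec w)). Qed.

Lemma d_in_cell w x y : Te w -> In x (K w) -> In y (K w) -> d x y <= rz (ht w) / cg.
Proof. intros Hw Hx Hy. eapply Rle_trans; [apply gd_ub; eauto|apply gd_le; auto]. Qed.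

Lemma rz_pos z : 0 < rz z.
Proof. apply powerRZ_lt. lra. Qed.

Lemma rz_add z z' : rz (z + z') = rz z * rz z'.
Proof. apply powerRZ_add. lra. Qed.

Lemma rz_exp z : rz z = exp (IZR z * ln r).
Proof. rewrite powerRZ_Rpower by lra. reflexivity. Qed.

Lemma ln_r_neg : ln r < 0.
Proof. rewrite <- ln_1. apply ln_increasing; lra. Qed.

Lemma rz_large A : exists m, forall z, (z <= m)%Z -> A < rz z.
Proof.
  destruct (Rle_or_lt A 0) as [HA|HA].
  - exists 0%Z. intros z _. assert (H := rz_pos z). lra.
  - assert (Hl := ln_r_neg).
    (* [up y] can reach [y + 1]; subtracting 2 keeps [z] strictly below the quotient, and [ln r < 0]
       reverses the inequality. *)
    exists (up (ln A / ln r) - 2)%Z. intros z Hz. rewrite rz_exp.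
    destruct (archimed (ln A / ln r)) as [_ H].
    apply IZR_le in Hz. rewrite minus_IZR in Hz.
    rewrite <- (exp_ln A HA). apply exp_increasing.
    assert (HE : ln A = ln A / ln r * ln r) by (field; lra).
    rewrite HE at 1. nra.
Qed.

Lemma Le_Te e : Le e -> Te e.
Proof. intros H. apply H. Qed.

Lemma Le_gd e : Le e -> gd d K e <= / cd.
Proof.
  intros He. destruct (Le_edge _ He) as [a [b [Hadj HE]]].
  assert (0 < / cd) by (apply Rinv_0_lt_compat; auto).
  apply gd_lub; [lra|]. intros x y Hx Hy. rewrite HE in Hx, Hy. simpl in Hx, Hy.
  destruct Hx as [<-|[<-|[]]]; destruct Hy as [<-|[<-|[]]]; try (rewrite d_refl; lra).
  - apply Hd1; auto.
  - apply Hd1; auto.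
Qed.

(** An edge cell has diameter at most [/ cd], whereas a cell of height [z] has diameter at least
    [cg * r^z], which is unbounded as [z] decreases. *)
Lemma Le_ht_lower : exists m0, forall e, Le e -> (m0 <= ht e)%Z.
Proof.
  destruct (rz_large (/ cd / cg)) as [m Hm]. exists m. intros e He.
  apply Znot_gt_le. intros Hgt. specialize (Hm (ht e) ltac:(lia)).
  assert (H1 := gd_ge e (Le_Te _ He)). assert (H2 := Le_gd e He).
  assert (/ cd / cg * cg < rz (ht e) * cg) by (apply Rmult_lt_compat_r; auto).
  replace (/ cd / cg * cg) with (/ cd) in H by (field; lra). lra.
Qed.

(** (F1) bounds the distance to any other point below by a multiple of the length of an edge at [x];
    hence [cd / Cf]. Balls of this radius are singletons. *)
Lemma dmin_ex : exists dm, 0 < dm /\ forall x z, x <> z -> dm <= d x z.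
Proof.
  exists (cd / Cf). split; [apply Rdiv_lt_0_compat; auto|]. intros x z Hxz.
  destruct (has_nbr x) as [y Hy]. assert (H1 := HF1 _ _ _ Hy Hxz). assert (H2 := Hd1 _ _ Hy).
  apply Rmult_le_reg_l with Cf; auto. replace (Cf * (cd / Cf)) with cd by (field; lra). lra.
Qed.

(** * Volumes of balls *)

Lemma mu_v_bounds : exists a, 0 < a /\ forall x, a <= mu_v nbrs mu x <= / a.
Proof.
  assert (Hi : 0 < / cmu) by (apply Rinv_0_lt_compat; auto).
  assert (HD := pos_INR D).
  (* The measure of a vertex lies between [cmu] and [D / cmu]; since [D + 1 >= 1], a single constant
     covers both sides. *)
  exists (/ (/ cmu * (INR D + 1))).
  assert (Hp : 0 < / cmu * (INR D + 1)) by (apply Rmult_lt_0_compat; lra).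
  split; [apply Rinv_0_lt_compat; auto|]. intros x. rewrite Rinv_inv. split.
  - apply Rle_trans with cmu.
    + rewrite <- (Rinv_inv cmu) at 2. apply Rinv_le_contravar; auto. nra.
    + destruct (has_nbr x) as [y Hy]. unfold mu_v.
      apply Rle_trans with (sumR (map (fun _ => cmu) (nbrs x))).
      * rewrite sumR_map_const. unfold adj in Hy. destruct (nbrs x) as [|q l]; [destruct Hy|].
        change (length (q :: l)) with (S (length l)). rewrite S_INR.
        assert (H := pos_INR (length l)). nra.
      * apply sumR_map_le. intros z Hz. apply Hmu. exact Hz.
  - unfold mu_v. apply Rle_trans with (sumR (map (fun _ => / cmu) (nbrs x))).
    + apply sumR_map_le. intros z Hz. apply Hmu. exact Hz.
    + rewrite sumR_map_const. assert (H := le_INR _ _ (Hdeg x)). nra.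
Qed.

Lemma mu_v_nonneg x : 0 <= mu_v nbrs mu x.
Proof. destruct mu_v_bounds as [a [Ha H]]. destruct (H x). lra. Qed.

Lemma Vd_ub x s l : NoDup l -> (forall y, In y l -> d x y < s) ->
  Rbar_le (Finite (sumR (map (mu_v nbrs mu) l))) (Vd nbrs mu d x s).
Proof.
  intros Hl Hin. unfold Vd, mu_set.
  apply (Lub_Rbar_correct (fun z => exists l, NoDup l /\ (forall y, In y l -> dball d x s y) /\
           z = sumR (map (mu_v nbrs mu) l))).
  exists l. repeat split; auto.
Qed.

Lemma Vd_lub x s b :
  (forall l, NoDup l -> (forall y, In y l -> d x y < s) -> sumR (map (mu_v nbrs mu) l) <= b) ->
  Rbar_le (Vd nbrs mu d x s) (Finite b).
Proof.
  intros H. unfold Vd, mu_set.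
  apply (Lub_Rbar_correct (fun z => exists l, NoDup l /\ (forall y, In y l -> dball d x s y) /\
           z = sumR (map (mu_v nbrs mu) l))).
  intros z [l [Hl [Hin ->]]]. simpl. apply H; auto.
Qed.

Lemma Vd_nonneg x s : Rbar_le (Finite 0) (Vd nbrs mu d x s).
Proof. apply (Vd_ub x s nil); [constructor|intros y []]. Qed.

Lemma Vd_mono x y s t : (forall z, d x z < s -> d y z < t) ->
  Rbar_le (Vd nbrs mu d x s) (Vd nbrs mu d y t).
Proof.
  intros H. unfold Vd at 1, mu_set.
  apply (Lub_Rbar_correct (fun z => exists l, NoDup l /\ (forall z, In z l -> dball d x s z) /\
           z = sumR (map (mu_v nbrs mu) l))).
  intros z [l [Hl [Hin ->]]]. apply Vd_ub; auto. intros q Hq. apply H. apply Hin; auto.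
Qed.

Definition vol (x : V) (s : R) : R := real (Vd nbrs mu d x s).

(** A ball of radius [dm] is a single vertex, and the volume growth hypothesis carries finiteness
    from there to every radius. The larger radius is chosen to exceed both [s] and [dm]. *)
Lemma Vd_finite x s : Vd nbrs mu d x s = Finite (vol x s).
Proof.
  destruct dmin_ex as [dm [Hdm Hmind]].
  assert (Hsmall : Rbar_le (Vd nbrs mu d x dm) (Finite (mu_v nbrs mu x))).
  { apply Vd_lub. intros l Hl Hin.
    apply Rle_trans with (sumR (map (mu_v nbrs mu) (x :: nil))).
    - apply sumR_incl; auto using mu_v_nonneg. intros y Hy.
      left. apply NNPP. intros Hne. specialize (Hmind _ _ Hne). specialize (Hin _ Hy). lra.
    - unfold sumR. simpl. lra. }
  assert (Hs : dm < Rmax s 0 + 2 * dm) by (assert (H := Rmax_r s 0); lra).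
  assert (H1 := Hvol x _ _ Hdm Hs).
  assert (H2 : Rbar_le (Vd nbrs mu d x s) (Vd nbrs mu d x (Rmax s 0 + 2 * dm))).
  { apply Vd_mono. intros z Hz. assert (H := Rmax_l s 0). lra. }
  assert (H3 := Rbar_le_trans _ _ _ H2 H1).
  assert (H4 := Vd_nonneg x s). assert (H5 := Vd_nonneg x dm). unfold vol.
  destruct (Vd nbrs mu d x dm) as [v| |]; simpl in Hsmall, H5; try contradiction.
  destruct (Vd nbrs mu d x s); simpl in *; try contradiction; auto.
Qed.

Lemma vol_ub x s l : NoDup l -> (forall y, In y l -> d x y < s) -> sumR (map (mu_v nbrs mu) l) <= vol x s.
Proof. intros Hl Hin. assert (H := Vd_ub x s l Hl Hin). rewrite Vd_finite in H. exact H. Qed.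

Lemma vol_lub x s b :
  (forall l, NoDup l -> (forall y, In y l -> d x y < s) -> sumR (map (mu_v nbrs mu) l) <= b) -> vol x s <= b.
Proof. intros H. assert (H1 := Vd_lub x s b H). rewrite Vd_finite in H1. exact H1. Qed.

Lemma vol_mono x y s t : (forall z, d x z < s -> d y z < t) -> vol x s <= vol y t.
Proof. intros H. assert (H1 := Vd_mono x y s t H). rewrite !Vd_finite in H1. exact H1. Qed.

Lemma vol_growth x s t : 0 < t -> t < s -> vol x s <= Cv * Rpower (s / t) alpha * vol x t.
Proof. intros H1 H2. assert (H := Hvol x _ _ H1 H2). rewrite !Vd_finite in H. exact H. Qed.

Lemma vol_lower : exists a, 0 < a /\ forall x s, 0 < s -> a <= vol x s.
Proof.
  destruct mu_v_bounds as [a [Ha H]]. exists a. split; auto. intros x s Hs.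
  apply Rle_trans with (sumR (map (mu_v nbrs mu) (x :: nil))).
  - unfold sumR. simpl. destruct (H x). lra.
  - apply vol_ub; [repeat constructor; intros []|]. intros y [<-|[]]. rewrite d_refl. exact Hs.
Qed.

Lemma vol_pos x s : 0 < s -> 0 < vol x s.
Proof. intros Hs. destruct vol_lower as [a [Ha H]]. specialize (H x s Hs). lra. Qed.

(** The ball about [y] lies in the ball of radius [2 A s] about [x]. The summand 1 makes the ratio
    of radii exceed 1, as the growth hypothesis requires. *)
Lemma vol_compare A : 0 < A -> exists C, 0 < C /\
  forall x y s t, 0 < s -> d x y <= A * s -> t <= A * s -> vol y t <= C * vol x s.
Proof.
  intros HA. exists (Cv * Rpower (2 * A + 1) alpha).
  assert (HC : 0 < Cv * Rpower (2 * A + 1) alpha) by (apply Rmult_lt_0_compat; auto; apply exp_pos).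
  split; auto. intros x y s t Hs Hxy Ht.
  apply Rle_trans with (vol x ((2 * A + 1) * s)).
  - apply vol_mono. intros z Hz. assert (H := d_tri x y z). nra.
  - replace (2 * A + 1) with ((2 * A + 1) * s / s) at 2 by (field; lra).
    apply vol_growth; auto. nra.
Qed.

Lemma nat_above (x : R) : exists n : nat, forall m, INR m <= x -> (m <= n)%nat.
Proof.
  destruct (ex_INR_gt x) as [N HN]. exists N. intros m Hm.
  destruct (Nat.le_gt_cases m N) as [H|H]; auto. specialize (HN m ltac:(lia)). lra.
Qed.

Lemma vol_upper s : exists C, 0 < C /\ forall x, vol x s <= C.
Proof.
  destruct dmin_ex as [dm [Hdm Hmind]]. destruct mu_v_bounds as [a [Ha Hmua]].
  assert (Hs0 := Rmax_r s 0).
  destruct (vol_compare ((Rmax s 0 + 1) / dm)) as [C [HC H]]; [apply Rdiv_lt_0_compat; lra|].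
  exists (C * / a). split; [apply Rmult_lt_0_compat; auto; apply Rinv_0_lt_compat; auto|]. intros x.
  apply Rle_trans with (C * vol x dm).
  - assert (HE : (Rmax s 0 + 1) / dm * dm = Rmax s 0 + 1) by (field; lra).
    apply H; auto; rewrite HE; [rewrite d_refl|]; assert (H' := Rmax_l s 0); lra.
  - apply Rmult_le_compat_l; [lra|]. apply vol_lub. intros l Hl Hin.
    apply Rle_trans with (sumR (map (mu_v nbrs mu) (x :: nil))).
    + apply sumR_incl; auto using mu_v_nonneg. intros y Hy.
      left. apply NNPP. intros Hne. specialize (Hmind _ _ Hne). specialize (Hin _ Hy). lra.
    + unfold sumR. simpl. destruct (Hmua x). lra.
Qed.

Lemma length_le_mu : exists a, 0 < a /\
  forall l, a * INR (length l) <= sumR (map (mu_v nbrs mu) l) <= / a * INR (length l).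
Proof.
  destruct mu_v_bounds as [a [Ha H]]. exists a. split; auto. intros l. split.
  - rewrite Rmult_comm, <- (sumR_map_const a l). apply sumR_map_le. intros x _. apply H.
  - rewrite Rmult_comm, <- (sumR_map_const (/ a) l). apply sumR_map_le. intros x _. apply H.
Qed.

Lemma ball_card s : exists C : nat, forall x l, NoDup l -> (forall y, In y l -> d x y < s) -> (length l <= C)%nat.
Proof.
  destruct (vol_upper s) as [C [HC HCv']]. destruct length_le_mu as [a [Ha Hl]].
  destruct (nat_above (C / a)) as [n Hn]. exists n. intros x l Hndl Hin. apply Hn.
  assert (H1 := vol_ub x s l Hndl Hin). assert (H2 := HCv' x). destruct (Hl l) as [H3 _].
  apply Rmult_le_reg_l with a; auto. replace (a * (C / a)) with C by (field; lra). lra.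
Qed.

(** * Cells of the refined tree at a fixed level *)

(** A piece of a cable is represented by the whole edge, so that [K (base u)] is nonempty even if
    the piece contains no vertex. *)
Definition base (u : Tr T) : T := match u with Old w => w | New w _ _ => w end.
Definition cell (z : Z) (u : Tr T) : Prop := validTr pi K r u /\ htr pi phi u z.
(** Stronger than [In x (K (base u))]: two cells touched by the same vertex really meet in the cable
    system, while two pieces of the same cable need not. *)
Definition touch (u : Tr T) (x : V) : Prop := cellK pi K r u (CV x).

Notation J := (Jh pi phi K r).

Lemma cell_inv z u : cell z u ->
  (exists w, u = Old w /\ Te w /\ ht w = z) \/
  (exists e m k, u = New e m k /\ Le e /\ (1 <= m)%nat /\ (k < 2 ^ nref r m)%nat /\ z = (ht e + Z.of_nat m)%Z).
Proof.
  destruct u as [w|e m k]; intros [Hv Hh]; simpl in *.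
  - left. exists w. repeat split; auto. symmetry. apply ht_eq. auto.
  - right. exists e, m, k. destruct Hv as [H1 [H2 H3]]. destruct Hh as [z0 [H4 ->]].
    rewrite (ht_eq _ _ H4). auto 6.
Qed.

Lemma cell_Old w : Te w -> cell (ht w) (Old w).
Proof. intros H. split; simpl; auto using ht_spec. Qed.

Lemma cell_New e m k : Le e -> (1 <= m)%nat -> (k < 2 ^ nref r m)%nat ->
  cell (ht e + Z.of_nat m) (New e m k).
Proof. intros H1 H2 H3. split; simpl; auto. exists (ht e). auto using ht_spec. Qed.

Lemma cell_Te z u : cell z u -> Te (base u).
Proof.
  intros H. destruct (cell_inv _ _ H) as [[w [-> [H1 _]]]|[e [m [k [-> [H1 _]]]]]]; simpl; auto using Le_Te.
Qed.

Lemma Te_nonempty w : Te w -> exists x, In x (K w).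
Proof. intros H. destruct (Hthick _ H) as [x [Hx _]]. eauto. Qed.

Lemma touch_In u x : touch u x -> In x (K (base u)).
Proof.
  unfold touch. destruct u as [v|e m k]; simpl.
  - intros [u0 [H0 [H1 [t [_ [[_ [a [b [HE Hp]]]]|[[_ [a [b [HE Hp]]]]|[_ Hp]]]]]]]]; try discriminate;
    injection Hp as ->; apply (K_desc _ _ H1); rewrite HE; simpl; auto.
  - intros [t [_ [[_ [a [b [HE Hp]]]]|[[_ [a [b [HE Hp]]]]|[_ Hp]]]]]; try discriminate;
    injection Hp as ->; rewrite HE; simpl; auto.
Qed.

Lemma touch_Old w x : Te w -> In x (K w) -> touch (Old w) x.
Proof.
  intros Hw Hx. destruct (Le_below _ _ Hw Hx) as [e [He [Hd' Hxe]]].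
  destruct (Le_edge _ He) as [a [b [_ HE]]]. exists e. split; auto. split; auto.
  rewrite HE in Hxe. destruct Hxe as [<-|[<-|[]]].
  - exists 0. split; [lra|]. left. split; auto. exists a, b. auto.
  - exists 1. split; [lra|]. right; left. split; auto. exists a, b. auto.
Qed.

Lemma pow2_pos n : 0 < 2 ^ n.
Proof. apply pow_lt. lra. Qed.

Lemma pow2_ge1 n : (1 <= 2 ^ n)%nat.
Proof. assert (H := Nat.pow_nonzero 2 n ltac:(lia)). lia. Qed.

Lemma INR_pow2 n : INR (2 ^ n) = 2 ^ n.
Proof. rewrite pow_INR. reflexivity. Qed.

Lemma touch_first e m a b : K e = a :: b :: nil -> touch (New e m 0) a.
Proof.
  intros HE. exists 0. assert (H := pow2_pos (nref r m)). split.
  - split; [simpl; unfold Rdiv; lra|]. apply Rdiv_le_0_compat; simpl; lra.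
  - left. split; auto. exists a, b. auto.
Qed.

Lemma touch_last e m a b : K e = a :: b :: nil -> touch (New e m (2 ^ nref r m - 1)) b.
Proof.
  intros HE. exists 1. assert (H := pow2_pos (nref r m)).
  assert (HI : INR (2 ^ nref r m - 1) + 1 = 2 ^ nref r m).
  { assert (Hn : (1 <= 2 ^ nref r m)%nat) by apply pow2_ge1.
    rewrite minus_INR, INR_pow2 by auto. simpl. lra. }
  split.
  - rewrite HI. replace (INR (2 ^ nref r m - 1)) with (2 ^ nref r m - 1) by lra. split.
    + apply Rmult_le_reg_r with (2 ^ nref r m); auto. unfold Rdiv. rewrite Rmult_assoc, Rinv_l; lra.
    + right. field. lra.
  - right; left. split; auto. exists a, b. auto.
Qed.

Lemma J_sym z u v : J z u v -> J z v u.
Proof.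
  intros [H1 [H2 [H3 [H4 [H5 [p [H6 H7]]]]]]].
  split; [exact H2|]. split; [exact H1|]. split; [exact H4|]. split; [exact H3|].
  split; [congruence|]. exists p. auto.
Qed.

Lemma J_cell z u v : J z u v -> cell z u /\ cell z v.
Proof. intros [H1 [H2 [H3 [H4 _]]]]. unfold cell. auto. Qed.

Lemma share_J z u v p : cell z u -> cell z v -> cellK pi K r u p -> cellK pi K r v p ->
  within (J z) 1 u v.
Proof.
  intros [H1 H2] [H3 H4] H5 H6. destruct (classic (u = v)) as [->|Hne]; [apply within_refl|].
  apply within_one. unfold Jh. eauto 10.
Qed.

Lemma share_J_Old w v x : Te w -> Te v -> ht w = ht v -> In x (K w) -> In x (K v) ->
  within (J (ht w)) 1 (Old w) (Old v).
Proof.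
  intros Hw Hv Hh Hxw Hxv. apply share_J with (CV x).
  - apply cell_Old; auto.
  - rewrite Hh. apply cell_Old; auto.
  - apply touch_Old; auto.
  - apply touch_Old; auto.
Qed.

Lemma edge_chain e m j i : Le e -> (1 <= m)%nat -> (j + i < 2 ^ nref r m)%nat ->
  within (J (ht e + Z.of_nat m)) i (New e m j) (New e m (j + i)).
Proof.
  intros He Hm. induction i as [|i IH]; intros Hi.
  - rewrite Nat.add_0_r. reflexivity.
  - replace (S i) with (i + 1)%nat at 1 by lia.
    apply within_trans with (New e m (j + i)); [apply IH; lia|].
    assert (H := pow2_pos (nref r m)).
    assert (Hlt : INR (j + i) + 1 < 2 ^ nref r m).
    { replace (2 ^ nref r m) with (INR (2 ^ nref r m)) by apply INR_pow2.
      rewrite <- S_INR. apply lt_INR. lia. }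
    assert (H0 := pos_INR (j + i)).
    (* The common end of two consecutive pieces, an interior point of the cable because a further
       piece follows. *)
    set (t := (INR (j + i) + 1) / 2 ^ nref r m).
    assert (Ht : 0 < t < 1).
    { unfold t. split; [apply Rdiv_lt_0_compat; lra|].
      apply Rmult_lt_reg_r with (2 ^ nref r m); auto. unfold Rdiv. rewrite Rmult_assoc, Rinv_l; lra. }
    apply share_J with (CI e t).
    + apply cell_New; auto; lia.
    + apply cell_New; auto; lia.
    + exists t. split; [|right; right; auto]. unfold t. split; [|lra].
      apply Rmult_le_compat_r; [left; apply Rinv_0_lt_compat; auto|lra].
    + exists t. split; [|right; right; auto]. rewrite Nat.add_succ_r, S_INR. unfold t. split; [lra|].
      apply Rmult_le_compat_r; [left; apply Rinv_0_lt_compat; auto|lra].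
Qed.

Lemma cellK_interior u e t : validTr pi K r u -> cellK pi K r u (CI e t) -> Le e /\ desc pi e (base u).
Proof.
  destruct u as [v|e' m k]; simpl.
  - intros _ [u0 [H0 [H1 [t' [_ [[_ [a [b [_ Hp]]]]|[[_ [a [b [_ Hp]]]]|[_ Hp]]]]]]]]; try discriminate.
    injection Hp as -> ->. auto.
  - intros [H1 _] [t' [_ [[_ [a [b [_ Hp]]]]|[[_ [a [b [_ Hp]]]]|[_ Hp]]]]]; try discriminate.
    injection Hp as -> ->. auto using desc_refl.
Qed.

(** If the cells meet only at an interior point of the cable of [e], then [e] lies below both bases,
    which therefore share the vertices of [e]. *)
Lemma J_common z u v : J z u v -> exists x, In x (K (base u)) /\ In x (K (base v)).
Proof.
  intros [H1 [H2 [_ [_ [_ [[x|e t] [H3 H4]]]]]]].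
  - exists x. split; apply touch_In; auto.
  - destruct (cellK_interior _ _ _ H1 H3) as [He Hu].
    destruct (cellK_interior _ _ _ H2 H4) as [_ Hv].
    destruct (Te_nonempty e (Le_Te _ He)) as [x Hx]. exists x.
    split; [apply (K_desc _ _ Hu)|apply (K_desc _ _ Hv)]; auto.
Qed.

(** Heights in [Lam_e] are bounded below, so on a given level every cable is cut into boundedly many
    pieces. *)
Lemma nref_bound z : exists N, forall e, Le e -> (2 ^ nref r (Z.to_nat (z - ht e)) <= N)%nat.
Proof.
  destruct Le_ht_lower as [m0 Hm0].
  assert (H : forall n, exists N, forall m, (m <= n)%nat -> (2 ^ nref r m <= N)%nat).
  { induction n as [|n [N HN]].
    - exists (2 ^ nref r 0)%nat. intros m Hm. replace m with 0%nat by lia. auto.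
    - exists (max N (2 ^ nref r (S n))). intros m Hm.
      destruct (Nat.eq_dec m (S n)) as [->|Hne]; [apply Nat.le_max_r|].
      eapply Nat.le_trans; [apply HN; lia|apply Nat.le_max_l]. }
  destruct (H (Z.to_nat (z - m0))) as [N HN]. exists N. intros e He. apply HN.
  specialize (Hm0 e He). lia.
Qed.

(** If the edge cell is at level [z] or finer, its ancestor on level [z] contains both ends;
    otherwise its cable is subdivided at level [z], and the chain of pieces joins the two ends. *)
Lemma edge_cells z : exists L, forall e a b, Le e -> In a (K e) -> In b (K e) ->
  exists u v, cell z u /\ cell z v /\ touch u a /\ touch v b /\ within (J z) L u v.
Proof.
  destruct (nref_bound z) as [N HN]. exists N. intros e a b He Ha Hb.
  destruct (Z_le_dec z (ht e)) as [Hz|Hz].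
  - assert (Hw : Te (anc z e)) by (apply Te_desc with e; auto using Le_Te, desc_anc).
    assert (Hc : cell z (Old (anc z e))) by (rewrite <- (ht_anc z e Hz) at 1; apply cell_Old; auto).
    exists (Old (anc z e)), (Old (anc z e)).
    repeat split; try apply Hc; try apply within_refl;
      apply touch_Old; auto; apply (K_desc _ _ (desc_anc z e)); auto.
  - specialize (HN e He). set (m := Z.to_nat (z - ht e)) in *.
    assert (Hm : (1 <= m)%nat) by lia. assert (Hzm : z = (ht e + Z.of_nat m)%Z) by lia.
    destruct (Le_edge _ He) as [p [q [_ HE]]].
    assert (Hpos : (1 <= 2 ^ nref r m)%nat) by apply pow2_ge1.
    assert (C1 : cell z (New e m 0)) by (rewrite Hzm; apply cell_New; auto).
    assert (C2 : cell z (New e m (2 ^ nref r m - 1))) by (rewrite Hzm; apply cell_New; auto; lia).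
    assert (T1 := touch_first e m p q HE). assert (T2 := touch_last e m p q HE).
    assert (W : within (J z) N (New e m 0) (New e m (2 ^ nref r m - 1))).
    { apply within_mono with (E := J z) (n := (2 ^ nref r m - 1)%nat); auto; [lia|].
      rewrite Hzm. apply (edge_chain e m 0); auto. lia. }
    assert (W' := within_sym _ _ _ _ (J_sym z) W).
    rewrite HE in Ha, Hb. simpl in Ha, Hb.
    destruct Ha as [<-|[<-|[]]]; destruct Hb as [<-|[<-|[]]].
    + exists (New e m 0), (New e m 0). auto using within_refl.
    + exists (New e m 0), (New e m (2 ^ nref r m - 1)). auto.
    + exists (New e m (2 ^ nref r m - 1)), (New e m 0). auto.
    + exists (New e m (2 ^ nref r m - 1)), (New e m (2 ^ nref r m - 1)). auto 6 using within_refl.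
Qed.

Lemma touch_ex z x : exists u, cell z u /\ touch u x.
Proof.
  destruct (edge_cells z) as [L HL]. destruct (vertex_Le x) as [e [He Hx]].
  destruct (HL e x x He Hx Hx) as [u [v [H1 [_ [H2 _]]]]]. eauto.
Qed.

Lemma adj_cells z : exists L, forall x y u v, adj nbrs x y -> cell z u -> cell z v ->
  touch u x -> touch v y -> within (J z) L u v.
Proof.
  destruct (edge_cells z) as [L HL]. exists (1 + (L + 1))%nat. intros x y u v Hxy Hu Hv Hux Hvy.
  destruct (edge_Le _ _ Hxy) as [e [He [Hx Hy]]].
  destruct (HL e x y He Hx Hy) as [u' [v' [H1 [H2 [H3 [H4 H5]]]]]].
  apply within_trans with u'; [apply share_J with (CV x); auto|].
  apply within_trans with v'; [auto|apply share_J with (CV y); auto].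
Qed.

(** Every such cell is accounted for by an edge cell [e] at [x]: it is the ancestor of [e] on level
    [z] or one of the at most [N] pieces of its cable. *)
Lemma cells_at_vertex z : exists C, forall x, fin_le C (fun u => cell z u /\ In x (K (base u))).
Proof.
  destruct (nref_bound z) as [N HN]. exists (D * (1 + N))%nat. intros x.
  apply fin_le_sub with (n := (D * (1 + N))%nat)
    (B := fun u => exists e, (Le e /\ In x (K e)) /\
       (u = Old (anc z e) \/ exists k, (k < N)%nat /\ u = New e (Z.to_nat (z - ht e)) k)); auto.
  - apply fin_le_bind with (P := fun e u =>
       u = Old (anc z e) \/ exists k, (k < N)%nat /\ u = New e (Z.to_nat (z - ht e)) k).
    + apply fin_le_Le.
    + intros e _. exists (Old (anc z e) :: map (fun k => New e (Z.to_nat (z - ht e)) k) (seq 0 N)).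
      split; [simpl; rewrite length_map, length_seq; lia|].
      intros u [->|[k [Hk ->]]]; simpl; auto. right.
      apply (in_map (fun k => New e (Z.to_nat (z - ht e)) k)). apply in_seq. lia.
  - intros u [Hu Hx].
    destruct (cell_inv _ _ Hu) as [[w [-> [H1 H2]]]|[e [m [k [-> [H1 [H2 [H3 ->]]]]]]]]; simpl in Hx.
    + destruct (Le_below _ _ H1 Hx) as [e [He [Hew Hxe]]]. exists e. split; auto. left.
      f_equal. rewrite <- H2. apply desc_eq_anc. exact Hew.
    + exists e. split; auto. right. exists k.
      specialize (HN e H1).
      replace (Z.to_nat (ht e + Z.of_nat m - ht e)) with m in * by lia. split; auto. lia.
Qed.

Lemma cell_size z : exists C : nat, forall u, cell z u -> (length (K (base u)) <= C)%nat.
Proof.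
  destruct (ball_card (rz z / cg + 1)) as [C HC]. exists (2 + C)%nat. intros u Hu.
  destruct (cell_inv _ _ Hu) as [[w [-> [H1 H2]]]|[e [m [k [-> [H1 _]]]]]]; simpl.
  - destruct (Te_nonempty _ H1) as [x Hx].
    apply Nat.le_trans with C; [|lia]. apply (HC x); [apply NoDup_K|].
    intros y Hy. assert (H := d_in_cell _ _ _ H1 Hx Hy). rewrite H2 in H. lra.
  - destruct H1 as [-> _]. lia.
Qed.

Lemma J_degree z : exists C, forall u, fin_le C (fun v => J z u v).
Proof.
  destruct (cells_at_vertex z) as [C HC]. destruct (cell_size z) as [S HS].
  exists (S * C)%nat. intros u.
  destruct (classic (cell z u)) as [Hu|Hu].
  - eapply fin_le_sub with (n := (S * C)%nat); [apply fin_le_bind with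
      (B := fun x => In x (K (base u))) (P := fun x v => cell z v /\ In x (K (base v)))| |].
    + exists (K (base u)). split; auto.
    + intros x _. apply HC.
    + auto.
    + intros v Hv. destruct (J_common _ _ _ Hv) as [x [H1 H2]]. exists x.
      destruct (J_cell _ _ _ Hv). auto.
  - exists nil. split; [simpl; lia|]. intros v Hv. destruct (J_cell _ _ _ Hv). contradiction.
Qed.

Lemma iter_pir_Old n w : Nat.iter n (pir pi r) (Old w) = Old (iter n w).
Proof. induction n as [|n IH]; [reflexivity|]. simpl. rewrite IH. reflexivity. Qed.

Lemma iter_pir_New e m : forall k, Nat.iter (S m) (pir pi r) (New e (S m) k) = Old e.
Proof.
  induction m as [|m IH]; intros k; [reflexivity|].
  rewrite Nat.iter_succ_r. apply IH.
Qed.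

(** The hypothesis on heights says that [k] steps lead out of the cable, after which the subdivision
    indices are forgotten. *)
Lemma iter_pir_anc z u k : cell z u -> (z - Z.of_nat k <= ht (base u))%Z ->
  Nat.iter k (pir pi r) u = Old (anc (z - Z.of_nat k) (base u)).
Proof.
  intros Hu Hk.
  destruct (cell_inv _ _ Hu) as [[w [-> [H1 H2]]]|[e [m [j [-> [H1 [H2 [H3 ->]]]]]]]]; cbn [base] in *.
  - rewrite iter_pir_Old. unfold anc. do 2 f_equal. lia.
  - assert (E : Nat.iter k (pir pi r) (New e m j) =
      Nat.iter (k - m) (pir pi r) (Nat.iter m (pir pi r) (New e m j))).
    { rewrite <- Nat.iter_add. f_equal. lia. }
    rewrite E.
    destruct m as [|m]; [lia|]. rewrite iter_pir_New, iter_pir_Old. unfold anc. do 2 f_equal. lia.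
Qed.

(** The cell may be an interior piece of a cable; [u'] is a cell on the same level with the same
    base, hence with the same coarse ancestors, that does contain a vertex. *)
Lemma cell_center z u : cell z u ->
  exists x u', cell z u' /\ touch u' x /\ base u' = base u /\ In x (K (base u)).
Proof.
  intros Hu.
  destruct (cell_inv _ _ Hu) as [[w [-> [H1 H2]]]|[e [m [j [-> [H1 [H2 [H3 ->]]]]]]]]; simpl.
  - destruct (Te_nonempty _ H1) as [x Hx]. exists x, (Old w). auto using touch_Old.
  - destruct (Le_edge _ H1) as [a [b [_ HE]]]. exists a, (New e m 0). split; [|split; [|split]].
    + apply cell_New; auto. lia.
    + apply (touch_first e m a b HE).
    + reflexivity.
    + rewrite HE. simpl. auto.
Qed.

Lemma cell_ex u : validTr pi K r u -> exists z, cell z u.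
Proof.
  destruct u as [w|e m k]; intros Hv.
  - exists (ht w). split; simpl; auto using ht_spec.
  - exists (ht e + Z.of_nat m)%Z. split; auto. exists (ht e). auto using ht_spec.
Qed.

(** * Cells at coarse levels *)

(** On levels up to [mO] there are no cable pieces, and each cell has more than two vertices, so
    children of cells stay in [T_e] and their number is bounded. *)
Lemma coarse_level : exists mO, forall e, Le e -> (mO < ht e)%Z.
Proof. destruct Le_ht_lower as [m0 H]. exists (m0 - 1)%Z. intros e He. specialize (H e He). lia. Qed.

Lemma rz_le_inv z z' : rz z' <= rz z -> (z <= z')%Z.
Proof.
  intros H. apply Znot_gt_le. intros Hgt. assert (Hl := ln_r_neg). rewrite !rz_exp in H.
  assert (Hlt : IZR z' < IZR z) by (apply IZR_lt; lia).
  apply Rle_not_lt in H. apply H. apply exp_increasing. nra.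
Qed.

Lemma coarse_cell mO m u : (forall e, Le e -> (mO < ht e)%Z) -> (m <= mO)%Z -> cell m u ->
  exists w, u = Old w /\ Te w /\ ht w = m.
Proof.
  intros HO Hm Hu. destruct (cell_inv _ _ Hu) as [H|[e [j [k [-> [H1 [H2 [H3 ->]]]]]]]]; auto.
  specialize (HO e H1). lia.
Qed.

Lemma Te_anc w m : Te w -> Te (anc m w).
Proof. intros H. apply Te_desc with w; auto using desc_anc. Qed.

Lemma Lam_s_ht s m w : s <= cg * rz m -> Lam_s d pi K s w -> (m <= ht w)%Z.
Proof.
  intros Hs [Hw [H1 _]]. apply rz_le_inv. apply Rmult_le_reg_l with cg; auto.
  assert (H := gd_ge w Hw). lra.
Qed.

(** Adaptedness at scale [s = cg * r^m] joins [x] to [y] by an [M]-step walk in [Lam_s]. Its cells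
    have height at least [m], so their ancestors on level [m] form a walk there. One step at each
    end leads from [w] and to [v], as the cells share [x] and [y]. *)
Lemma close_cells : exists delta N, 0 < delta /\ forall m x y w v,
  d x y < delta * rz m -> Te w -> Te v -> ht w = m -> ht v = m -> In x (K w) -> In y (K v) ->
  within (J m) N (Old w) (Old v).
Proof.
  exists (a1 * cg), (1 + (M + 1))%nat. split; [apply Rmult_lt_0_compat; auto|].
  intros m x y w v Hxy Hw Hv Hhw Hhv Hx Hy.
  assert (Hs : 0 < cg * rz m) by (apply Rmult_lt_0_compat; auto using rz_pos).
  destruct (Hadapt x _ Hs) as [HU _].
  assert (HU' : U_M d pi K M x (cg * rz m) y) by (apply HU; unfold dball; lra).
  destruct HU' as [[_ ->]|[v0 [[w0 [Hw0 [Hxw0 [Hv0 Hch]]]] Hyv0]]].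
  - apply within_mono with (E := J m) (n := 1%nat); auto; [lia|].
    rewrite <- Hhw. apply share_J_Old with x; auto. congruence.
  - set (s := cg * rz m) in *.
    assert (Hht : forall a, Lam_s d pi K s a -> (m <= ht a)%Z) by (intros a; apply Lam_s_ht; apply Rle_refl).
    assert (HL : forall a b y', E_s d pi K s a b -> y' = Old (anc m a) ->
              exists z, z = Old (anc m b) /\ (y' = z \/ J m y' z)).
    { intros a b y' [Ha [Hb [_ [z [Hza Hzb]]]]] ->. exists (Old (anc m b)). split; auto.
      assert (H : within (J (ht (anc m a))) 1 (Old (anc m a)) (Old (anc m b))).
      { apply share_J_Old with z.
        - apply Te_anc. apply Ha.
        - apply Te_anc. apply Hb.
        - rewrite !ht_anc; auto.
        - apply (K_desc _ _ (desc_anc m a)); auto.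
        - apply (K_desc _ _ (desc_anc m b)); auto. }
      rewrite ht_anc in H by auto. destruct H as [H|[c [H1 H2]]]; [left; exact H|].
      simpl in H1. subst c. right. exact H2. }
    destruct (within_lift _ (J m) (fun a b => b = Old (anc m a)) HL M w0 v0 _ Hch eq_refl)
      as [v0' [-> Hch']].
    apply within_trans with (Old (anc m w0)).
    + rewrite <- Hhw. apply share_J_Old with x; auto.
      * apply Te_anc. apply Hw0.
      * rewrite ht_anc; auto. rewrite Hhw. auto.
      * apply (K_desc _ _ (desc_anc _ w0)); auto.
    + apply within_trans with (Old (anc m v0)); auto.
      assert (Hh : ht (anc m v0) = m) by (apply ht_anc; auto).
      rewrite <- Hh. rewrite Hh at 2. apply share_J_Old with y; auto.
      * apply Te_anc. apply Hv0.
      * rewrite Hh. auto.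
      * apply (K_desc _ _ (desc_anc _ v0)); auto.
Qed.

Lemma K_child_iter a : forall x v, In x (K v) -> exists u, iter a u = v /\ In x (K u).
Proof.
  induction a as [|a IH]; intros x v Hx; [exists v; auto|].
  destruct (K_child _ _ Hx) as [c [Hc Hxc]]. destruct (IH _ _ Hxc) as [u [Hu Hxu]].
  exists u. split; auto. simpl. congruence.
Qed.

Lemma Te_child mO v c : (forall e, Le e -> (mO < ht e)%Z) -> Te v -> (ht v <= mO)%Z -> pi c = v -> Te c.
Proof.
  intros HO Hv Hh <-. unfold T_e.
  destruct (Te_nonempty _ Hv) as [x Hx]. assert (H2 := len_K_ge2 _ _ Hx).
  destruct (Nat.eq_dec (length (K (pi c))) 2) as [He|Hne]; [|lia].
  specialize (HO (pi c)). assert (Le (pi c)) by (split; auto). specialize (HO H). lia.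
Qed.

Lemma Te_below mO : (forall e, Le e -> (mO < ht e)%Z) -> forall a v u,
  Te v -> (ht v + Z.of_nat a <= mO + 1)%Z -> iter a u = v -> Te u.
Proof.
  intros HO a. induction a as [|a IH]; intros v u Hv Hh Hu; [simpl in Hu; congruence|].
  assert (Hc : Te (iter a u)) by (apply (Te_child mO v); auto; lia).
  apply (IH (iter a u)); auto.
  assert (H := ht_pi (iter a u)). change (pi (iter a u)) with (iter (S a) u) in H. rewrite Hu in H. lia.
Qed.

Lemma fin_le_below mO : (forall e, Le e -> (mO < ht e)%Z) -> forall a v,
  Te v -> (ht v + Z.of_nat a <= mO + 1)%Z -> fin_le (B ^ a) (fun u => iter a u = v).
Proof.
  intros HO a. induction a as [|a IH]; intros v Hv Hh.
  - exists (v :: nil). split; [simpl; lia|]. intros u Hu. simpl in *. auto.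
  - apply fin_le_sub with (n := (B * B ^ a)%nat)
      (B := fun u => exists c, pi c = v /\ iter a u = c).
    + apply fin_le_bind.
      * apply card_fin_le. apply HB; auto. intros Hl. specialize (HO v Hl). lia.
      * intros c Hc. apply IH; [apply (Te_child mO v); auto; lia|].
        assert (H := ht_pi c). rewrite Hc in H. lia.
    + simpl. lia.
    + intros u Hu. exists (iter a u). auto.
Qed.

(** A path inside the connected set [K v] visits descendants of [v] on level [m]. On coarse levels
    an edge is shorter than [delta * r^m], so consecutive descendants are close. The path can be
    long, but only [B^a] descendants exist, and the walk is shortened accordingly. *)
Lemma sibling_cells (a : nat) : exists N m1, forall m v u u', (m <= m1)%Z ->
  Te v -> (ht v = m - Z.of_nat a)%Z -> iter a u = v -> iter a u' = v ->
  within (J m) N (Old u) (Old u').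
Proof.
  destruct close_cells as [delta [N [Hdel HN]]]. destruct coarse_level as [mO HO].
  destruct (rz_large (/ cd / delta)) as [m2 Hm2].
  exists (B ^ a * N)%nat, (Z.min mO m2). intros m v u u' Hm Hv Hh Hu Hu'.
  assert (Hedge : / cd < delta * rz m).
  { specialize (Hm2 m ltac:(lia)). apply Rmult_lt_reg_r with (/ delta); [apply Rinv_0_lt_compat; auto|].
    replace (delta * rz m * / delta) with (rz m) by (field; lra). exact Hm2. }
  assert (HS : forall t, iter a t = v -> Te t /\ ht t = m).
  { intros t Ht. split; [apply (Te_below mO HO a v); auto; lia|].
    assert (H := ht_iter a t). rewrite Ht in H. lia. }
  set (R := fun t t' => within (J m) N (Old t) (Old t')).
  assert (Hstep : forall x y t t', d x y < delta * rz m -> iter a t = v -> iter a t' = v ->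
            In x (K t) -> In y (K t') -> R t t').
  { intros x y t t' Hxy Ht Ht' Hx Hy. destruct (HS _ Ht). destruct (HS _ Ht').
    apply (HN m x y); auto. }
  assert (Hpath : forall x y,
     clos_refl_trans_1n V (fun a b => adj nbrs a b /\ In a (K v) /\ In b (K v)) x y ->
     forall t t', iter a t = v -> iter a t' = v -> In x (K t) -> In y (K t') ->
     clos_refl_trans T (fun p q => R p q /\ iter a p = v /\ iter a q = v) t t').
  { intros x y H. induction H as [x|x x1 y [Hadj [Hx Hx1]] _ IH]; intros t t' Ht Ht' Hxt Hyt'.
    - apply rt_step. split; auto. apply (Hstep x x); auto. rewrite d_refl.
      apply Rmult_lt_0_compat; auto using rz_pos.
    - destruct (K_child_iter a _ _ Hx1) as [t1 [Ht1 Hxt1]].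
      apply rt_trans with t1; [|apply IH; auto].
      apply rt_step. split; auto. apply (Hstep x x1); auto.
      eapply Rle_lt_trans; [apply (Hd1 _ _ Hadj)|auto]. }
  destruct (HS _ Hu) as [HTu _]. destruct (HS _ Hu') as [HTu' _].
  destruct (Te_nonempty _ HTu) as [x Hx]. destruct (Te_nonempty _ HTu') as [y Hy].
  assert (Hxv : In x (K v)) by (apply (K_desc u); auto; exists a; auto).
  assert (Hyv : In y (K v)) by (apply (K_desc u'); auto; exists a; auto).
  assert (Hrt := Hcon _ Hv _ _ Hxv Hyv). apply clos_rt_rt1n in Hrt.
  assert (Hw : within R (B ^ a) u u').
  { apply within_shorten with (fun t => iter a t = v); auto.
    - apply (fin_le_below mO HO); auto. lia.
    - apply (Hpath x y); auto. }
  apply within_steps with (E := fun p q => within (J m) N p q); auto.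
  assert (HL : forall p q p', R p q -> p' = Old p ->
            exists q', q' = Old q /\ (p' = q' \/ within (J m) N p' q')).
  { intros p q p' Hpq ->. exists (Old q). auto. }
  destruct (within_lift R (fun p q => within (J m) N p q) (fun p q => q = Old p) HL
    _ _ _ _ Hw eq_refl) as [q [-> Hq]]; auto.
Qed.

(** [close_cells] reaches only distances below [delta * r^m]. For the [a]-th ancestors, with
    [r^(-a) > A / delta], the distance is small enough. Each step of the walk between ancestors is
    imitated on level [m] by moving among descendants to a vertex shared by the two ancestors, then
    changing cell there: at most [1 + Da] steps each. *)
Lemma far_cells (A : R) : exists N m1, forall m x y w v, (m <= m1)%Z ->
  d x y < A * rz m -> Te w -> Te v -> ht w = m -> ht v = m -> In x (K w) -> In y (K v) ->
  within (J m) N (Old w) (Old v).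
Proof.
  destruct close_cells as [delta [N0 [Hdel HN0]]]. destruct coarse_level as [mO HO].
  destruct (rz_large (A / delta)) as [m' Hm'].
  set (a := Z.to_nat (- m')).
  destruct (sibling_cells a) as [Da [m2 HDa]].
  exists (Da + N0 * (1 + Da))%nat, (Z.min mO m2). intros m x y w v Hm Hxy Hw Hv Hhw Hhv Hx Hy.
  set (p := (m - Z.of_nat a)%Z).
  assert (Hd' : d x y < delta * rz p).
  { unfold p. replace (m - Z.of_nat a)%Z with (- Z.of_nat a + m)%Z by lia. rewrite rz_add.
    specialize (Hm' (- Z.of_nat a)%Z ltac:(lia)). assert (H := rz_pos m).
    assert (HA : A < delta * rz (- Z.of_nat a)).
    { apply Rmult_lt_reg_r with (/ delta); [apply Rinv_0_lt_compat; auto|].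
      replace (delta * rz (- Z.of_nat a) * / delta) with (rz (- Z.of_nat a)) by (field; lra). exact Hm'. }
    eapply Rlt_trans; [exact Hxy|]. rewrite <- Rmult_assoc. apply Rmult_lt_compat_r; auto. }
  assert (HTw : Te (iter a w)) by (apply Te_desc with w; auto; exists a; auto).
  assert (HTv : Te (iter a v)) by (apply Te_desc with v; auto; exists a; auto).
  assert (Hhw' : ht (iter a w) = p) by (rewrite ht_iter; unfold p; lia).
  assert (Hhv' : ht (iter a v) = p) by (rewrite ht_iter; unfold p; lia).
  assert (Hch : within (J p) N0 (Old (iter a w)) (Old (iter a v))).
  { apply (HN0 p x y); auto; [apply (K_desc w)|apply (K_desc v)]; auto; exists a; auto. }
  assert (Hind : forall n w2 u2, within (J p) n (Old (iter a w)) (Old w2) -> Te w2 -> ht w2 = p ->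
            iter a u2 = w2 -> within (J m) (Da + n * (1 + Da)) (Old w) (Old u2)).
  { induction n as [|n IH]; intros w2 u2 Hn HT2' Hh2 Hu2.
    - simpl in Hn. injection Hn as <-. rewrite Nat.add_0_r. apply (HDa m (iter a w)); auto. lia.
    - destruct Hn as [Hn|[c [Hn HJ]]].
      + apply within_mono with (E := J m) (n := (Da + n * (1 + Da))%nat); auto; [lia|].
        apply (IH w2); auto.
      + destruct (J_cell _ _ _ HJ) as [Hc _].
        destruct (coarse_cell mO p c HO ltac:(lia) Hc) as [w3 [-> [HT3 Hh3]]].
        destruct (J_common _ _ _ HJ) as [z [Hz3 Hz2]]. simpl in Hz3, Hz2.
        destruct (K_child_iter a _ _ Hz3) as [t3 [Ht3 Hzt3]].
        destruct (K_child_iter a _ _ Hz2) as [t2 [Ht2 Hzt2]].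
        assert (E3 : ht t3 = m) by (assert (H := ht_iter a t3); rewrite Ht3 in H; lia).
        assert (E2 : ht t2 = m) by (assert (H := ht_iter a t2); rewrite Ht2 in H; lia).
        replace (Da + S n * (1 + Da))%nat with ((Da + n * (1 + Da)) + (1 + Da))%nat by lia.
        apply within_trans with (Old t3); [apply (IH w3); auto|].
        apply within_trans with (Old t2).
        * rewrite <- E3. apply share_J_Old with z; auto; try congruence.
          -- apply (Te_below mO HO a w3); auto. lia.
          -- apply (Te_below mO HO a w2); auto. lia.
        * apply (HDa m w2); auto. lia. }
  apply (Hind N0 (iter a v)); auto.
Qed.

Lemma chain_dist mO m n w : (forall e, Le e -> (mO < ht e)%Z) -> (m <= mO)%Z -> Te w -> ht w = m ->
  forall v x y, within (J m) n (Old w) (Old v) -> Te v -> ht v = m -> In x (K w) -> In y (K v) ->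
  d x y <= (INR n + 1) * (rz m / cg).
Proof.
  intros HO Hm Hw Hhw. induction n as [|n IH]; intros v x y Hn Hv Hhv Hx Hy.
  - simpl in Hn. injection Hn as <-. simpl. rewrite Rplus_0_l, Rmult_1_l, <- Hhw. apply d_in_cell; auto.
  - assert (Hp : 0 < rz m / cg) by (apply Rdiv_lt_0_compat; auto using rz_pos).
    rewrite S_INR. destruct Hn as [Hn|[c [Hn HJ]]].
    + assert (H := IH v x y Hn Hv Hhv Hx Hy). lra.
    + destruct (J_cell _ _ _ HJ) as [Hc _].
      destruct (coarse_cell mO m c HO Hm Hc) as [w3 [-> [HT3 Hh3]]].
      destruct (J_common _ _ _ HJ) as [z [Hz3 Hz2]]. simpl in Hz3, Hz2.
      assert (H1 := IH w3 x z Hn HT3 Hh3 Hx Hz3).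
      assert (H2 := d_in_cell v z y Hv Hz2 Hy). rewrite Hhv in H2.
      assert (H3 := d_tri x z y). lra.
Qed.

(** * Thickness *)

(** Diameters are unbounded along the ancestors of [v], so climbing reaches a last cell of diameter
    at most [s]. *)
Lemma Lam_proj s v : Te v -> gd d K v <= s -> exists v', Lam_s d pi K s v' /\ desc pi v v'.
Proof.
  intros Hv Hs.
  assert (Hn : exists n, s < gd d K (iter n v)).
  { destruct (rz_large (s / cg)) as [m Hm]. exists (Z.to_nat (ht v - m)).
    assert (HT : Te (iter (Z.to_nat (ht v - m)) v)) by (apply Te_desc with v; auto; eexists; reflexivity).
    assert (H := gd_ge _ HT). eapply Rlt_le_trans; [|exact H].
    specialize (Hm (ht (iter (Z.to_nat (ht v - m)) v))). rewrite ht_iter in *.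
    specialize (Hm ltac:(lia)). apply Rmult_lt_reg_r with (/ cg); [apply Rinv_0_lt_compat; auto|].
    replace (cg * rz (ht v - Z.of_nat (Z.to_nat (ht v - m))) * / cg)
      with (rz (ht v - Z.of_nat (Z.to_nat (ht v - m)))) by (field; lra). exact Hm. }
  destruct Hn as [n Hn]. revert v Hv Hs Hn. induction n as [|n IH]; intros v Hv Hs Hn.
  - simpl in Hn. lra.
  - destruct (Rlt_or_le s (gd d K (pi v))) as [Hlt|Hge].
    + exists v. split; [|apply desc_refl]. split; auto.
    + assert (HT : Te (pi v)) by (apply Te_desc with v; auto; exists 1%nat; reflexivity).
      destruct (IH (pi v) HT Hge) as [v' [H1 H2]].
      { rewrite <- iter_S_r. exact Hn. }
      exists v'. split; auto. apply desc_trans with (pi v); auto. exists 1%nat. reflexivity.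
Qed.

(** Neighbourhoods of a smaller scale lie below those of a larger scale: intersecting cells project
    to equal or intersecting cells, so the walk does not get longer. *)
Lemma Lam_sMx_coarsen s1 s n x v : s1 <= s -> Lam_sMx d pi K s1 n x v ->
  exists v', Lam_sMx d pi K s n x v' /\ desc pi v v'.
Proof.
  intros Hs [w [Hw [Hxw [Hv Hch]]]].
  assert (Hproj : forall a, Lam_s d pi K s1 a -> exists a', Lam_s d pi K s a' /\ desc pi a a').
  { intros a [Ha1' [Ha2' _]]. apply Lam_proj; auto. lra. }
  destruct (Hproj w Hw) as [w' [Hw' Hww']].
  assert (HL : forall a b a', E_s d pi K s1 a b -> Lam_s d pi K s a' /\ desc pi a a' ->
            exists b', (Lam_s d pi K s b' /\ desc pi b b') /\ (a' = b' \/ E_s d pi K s a' b')).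
  { intros a b a' [Ha [Hb [_ [z [Hza Hzb]]]]] [Ha' Haa'].
    destruct (Hproj b Hb) as [b' [Hb' Hbb']]. exists b'. split; auto.
    destruct (classic (a' = b')) as [E|E]; auto. right. split; auto. split; auto. split; auto.
    exists z. split; [apply (K_desc _ _ Haa')|apply (K_desc _ _ Hbb')]; auto. }
  destruct (within_lift _ (E_s d pi K s) (fun a a' => Lam_s d pi K s a' /\ desc pi a a') HL
    _ _ _ _ Hch (conj Hw' Hww')) as [v' [[Hv' Hvv'] Hch']].
  exists v'. split; auto. exists w'. split; auto. split; [apply (K_desc _ _ Hww'); auto|]. split; auto.
Qed.

(* Thickness for neighbourhoods of radius [n + 1] at [w]: use thickness at a cell [v] of [Lam_s]
   deep inside [w]; everything within [n] steps of its centre lies in [v], and one more step stays in [w]. *)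
Lemma thick_radius n : exists al' H, 0 < al' /\ forall w, Te w -> H <= gd d K (pi w) ->
  exists x, In x (K w) /\ forall v, Lam_sMx d pi K (al' * gd d K (pi w)) n x v -> desc pi v w.
Proof.
  set (al0 := Rmin al 1).
  assert (Hal0 : 0 < al0 <= 1) by (unfold al0; split; [apply Rmin_glb_lt; lra|apply Rmin_r]).
  assert (Hal1 : al0 <= al) by apply Rmin_l.
  assert (Hgp : forall w, Te w -> 0 < gd d K (pi w)).
  { intros w Hw. apply Rlt_le_trans with (gd d K w); [|apply gd_desc; exists 1%nat; reflexivity].
    eapply Rlt_le_trans; [|apply gd_ge; auto]. apply Rmult_lt_0_compat; auto using rz_pos. }
  assert (H1 : forall w, Te w -> exists x, In x (K w) /\
            forall v, Lam_sMx d pi K (al0 * gd d K (pi w)) 1 x v -> desc pi v w).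
  { intros w Hw. destruct (Hthick w Hw) as [x [Hx H]]. exists x. split; auto. intros v Hv.
    assert (Hle : al0 * gd d K (pi w) <= al * gd d K (pi w)) by (specialize (Hgp w Hw); nra).
    destruct (Lam_sMx_coarsen _ _ _ _ _ Hle Hv) as [v' [H1 H2]].
    apply desc_trans with v'; auto. }
  (* The induction also carries [al' <= al0], which makes the inner scale [s1] at most the outer
     scale [s0]. *)
  cut (exists al' H, 0 < al' <= al0 /\ forall w, Te w -> H <= gd d K (pi w) ->
    exists x, In x (K w) /\ forall v, Lam_sMx d pi K (al' * gd d K (pi w)) n x v -> desc pi v w).
  { intros [al' [H [H2 H3]]]. exists al', H. split; [lra|auto]. }
  induction n as [|n [aln [Hn [Haln IH]]]].
  - exists al0, 0. split; [lra|]. intros w Hw _. destruct (H1 w Hw) as [x [Hx H]].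
    exists x. split; auto. intros v [w0 [E1 [E2 [E3 E4]]]]. apply H.
    exists w0. split; auto. split; auto. split; auto. left. auto.
  (* The threshold gives [s0 >= / cd], so that an edge cell at [x] lies below some cell [v] of
     [Lam_s] at scale [s0], and [s0 >= Hn], so that the induction hypothesis applies to [v]. *)
  - exists (aln * al0), (Rmax Hn (/ cd) / al0). split.
    { split; [apply Rmult_lt_0_compat; lra|]. nra. }
    intros w Hw Hbig. destruct (H1 w Hw) as [x [Hx Hx1]].
    set (s0 := al0 * gd d K (pi w)) in *.
    assert (Hs0 : Rmax Hn (/ cd) <= s0).
    { unfold s0. apply Rmult_le_reg_r with (/ al0); [apply Rinv_0_lt_compat; lra|].
      replace (al0 * gd d K (pi w) * / al0) with (gd d K (pi w)) by (field; lra). exact Hbig. }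
    assert (Hs1 := Rmax_l Hn (/ cd)). assert (Hs2 := Rmax_r Hn (/ cd)).
    destruct (vertex_Le x) as [e [He Hxe]].
    destruct (Lam_proj s0 e (Le_Te _ He)) as [v [Hv Hev]].
    { apply Rle_trans with (/ cd); [apply Le_gd; auto|lra]. }
    assert (Hxv : In x (K v)) by (apply (K_desc _ _ Hev); auto).
    assert (Hvw : desc pi v w).
    { apply Hx1. exists v. split; auto. split; auto. split; auto. apply within_refl. }
    destruct (IH v) as [x' [Hx' Hx'1]]; [apply Hv|destruct Hv as [_ [_ Hv]]; lra|].
    exists x'. split; [apply (K_desc _ _ Hvw); auto|]. intros u0 Hu0.
    assert (Hgv : s0 < gd d K (pi v)) by apply Hv.
    set (s1 := aln * gd d K (pi v)) in *.
    assert (Hle : aln * al0 * gd d K (pi w) <= s1).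
    { unfold s1. rewrite Rmult_assoc. apply Rmult_le_compat_l; [lra|]. fold s0. lra. }
    destruct (Lam_sMx_coarsen _ _ _ _ _ Hle Hu0) as [u [Hu Hu0u]].
    apply desc_trans with u; auto.
    destruct Hu as [w0 [Hw0 [Hxw0 [Hu Hch]]]]. destruct Hch as [Hch|[c [Hch Hcu]]].
    { apply desc_trans with v; auto. apply Hx'1. exists w0. split; auto. split; auto. split; auto. }
    destruct Hcu as [Hc [_ [_ [t [Htc Htu]]]]].
    assert (Hcv : desc pi c v).
    { apply Hx'1. exists w0. split; auto. split; auto. split; auto. }
    assert (Htv : In t (K v)) by (apply (K_desc _ _ Hcv); auto).
    assert (Hs10 : s1 <= s0).
    { unfold s1, s0. apply Rmult_le_compat; try lra; [left; apply Hgp; apply Hv|].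
      apply gd_desc. destruct Hvw as [k Hk]. exists k.
      rewrite <- iter_S_r. simpl. rewrite Hk. reflexivity. }
    destruct (Lam_proj s0 u) as [u' [Hu' Huu']]; [apply Hu|destruct Hu as [_ [Hu _]]; lra|].
    assert (Htu' : In t (K u')) by (apply (K_desc _ _ Huu'); auto).
    apply desc_trans with u'; auto. apply Hx1. exists v. split; auto. split; auto. split; auto.
    destruct (classic (v = u')) as [<-|Hne]; [apply within_refl|].
    apply within_one. split; auto. split; auto. split; auto. exists t. auto.
Qed.

(** Adaptedness covers a ball about the centre by an [M]-step neighbourhood, and thickness for
    radius [M] keeps that neighbourhood below [w]. This is why thickness had to be extended beyond
    radius 1. *)
Lemma inner_ball : exists delta m1, 0 < delta /\ forall w, Te w -> (ht w <= m1)%Z ->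
  exists x, In x (K w) /\ forall y, d x y < delta * rz (ht w) -> In y (K w).
Proof.
  destruct (thick_radius M) as [al' [H [Hal' Ht]]].
  destruct (rz_large (H / cg)) as [m Hm].
  exists (a1 * (al' * cg)), m. split; [repeat apply Rmult_lt_0_compat; auto|]. intros w Hw Hh.
  assert (Hge : cg * rz (ht w) <= gd d K (pi w)).
  { eapply Rle_trans; [apply gd_ge; auto|]. apply gd_desc. exists 1%nat. reflexivity. }
  destruct (Ht w Hw) as [x [Hx Hx1]].
  { eapply Rle_trans; [|exact Hge]. specialize (Hm _ Hh). left.
    apply Rmult_lt_reg_r with (/ cg); [apply Rinv_0_lt_compat; auto|].
    replace (cg * rz (ht w) * / cg) with (rz (ht w)) by (field; lra). exact Hm. }
  exists x. split; auto. intros y Hy.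
  assert (Hp := rz_pos (ht w)).
  assert (Hs : 0 < al' * gd d K (pi w)) by (apply Rmult_lt_0_compat; auto; nra).
  destruct (Hadapt x _ Hs) as [HU _].
  assert (HU' : U_M d pi K M x (al' * gd d K (pi w)) y).
  { apply HU. unfold dball. eapply Rlt_le_trans; [exact Hy|].
    rewrite Rmult_assoc. apply Rmult_le_compat_l; [lra|]. rewrite Rmult_assoc.
    apply Rmult_le_compat_l; [lra|]. exact Hge. }
  destruct HU' as [[_ ->]|[v [Hv Hyv]]]; auto.
  apply (K_desc v w); auto.
Qed.

(** * Counting cells *)

Notation P k := ((/ r) ^ k).

Lemma P_ge1 k : 1 <= P k.
Proof.
  apply pow_R1_Rle. rewrite <- Rinv_1. apply Rinv_le_contravar; lra.
Qed.

Lemma rz_level z k : rz (z - Z.of_nat k) = rz z * P k.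
Proof.
  unfold Z.sub. rewrite rz_add. f_equal. rewrite powerRZ_neg', pow_inv, pow_powerRZ. reflexivity.
Qed.

(** Since [(/ r)^k >= 1], the fixed distance between the two centres is absorbed into the
    constant. *)
Lemma vol_le_origin x0 x1 A : exists C, 0 < C /\ forall k t, t <= A * P k -> vol x1 t <= C * vol x0 (P k).
Proof.
  assert (H0 := d_nonneg x0 x1). assert (HA := Rabs_pos A).
  destruct (vol_compare (Rabs A + d x0 x1 + 1)) as [C [HC H]]; [lra|].
  exists C. split; auto. intros k t Ht. assert (HP := P_ge1 k). assert (HA' := Rle_abs A).
  apply H; nra.
Qed.

Lemma vol_ge_origin x0 x1 A A' : 0 < A -> exists C, 0 < C /\ forall k y t,
  d x1 y <= A' * P k -> A * P k <= t -> vol x0 (P k) <= C * vol y t.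
Proof.
  intros HA. assert (H0 := d_nonneg x0 x1). assert (HA' := Rabs_pos A').
  destruct (vol_compare ((Rabs A' + d x0 x1 + 1) / A)) as [C [HC H]]; [apply Rdiv_lt_0_compat; lra|].
  exists C. split; auto. intros k y t Hy Ht. assert (HP := P_ge1 k). assert (Hab' := Rle_abs A').
  apply Rle_trans with (C * vol y (A * P k)).
  - assert (HE : (Rabs A' + d x0 x1 + 1) / A * (A * P k) = (Rabs A' + d x0 x1 + 1) * P k) by (field; lra).
    apply H; rewrite ?HE; [nra| |nra].
    assert (Ht' := d_tri y x1 x0). rewrite (d_sym y x1), (d_sym x1 x0) in Ht'. nra.
  - apply Rmult_le_compat_l; [lra|]. apply vol_mono. intros q Hq. lra.
Qed.

Lemma htr_iter_pir k : forall u z, cell z u ->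
  htr pi phi (Nat.iter k (pir pi r) u) (z - Z.of_nat k).
Proof.
  (* The side condition excludes [New _ 0 _], which is no cell and whose parent has the same
     height. *)
  assert (H : forall k u z, htr pi phi u z -> (match u with Old _ => True | New _ m _ => (1 <= m)%nat end) ->
    htr pi phi (Nat.iter k (pir pi r) u) (z - Z.of_nat k)).
  { induction k0 as [|n IH]; intros u z Hh Hw; [rewrite Z.sub_0_r; exact Hh|].
    rewrite Nat.iter_succ_r. replace (z - Z.of_nat (S n))%Z with ((z - 1) - Z.of_nat n)%Z by lia.
    destruct u as [w|e [|[|m]] j]; simpl in Hh, Hw; [| lia| |].
    - apply IH; auto. simpl. rewrite (ht_eq _ _ Hh), <- ht_pi. apply ht_spec.
    - destruct Hh as [z0 [H0 ->]]. apply IH; simpl; auto.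
      replace (z0 + 1 - 1)%Z with z0 by lia. exact H0.
    - destruct Hh as [z0 [H0 ->]]. apply IH; [|simpl; lia].
      exists z0. split; auto. lia. }
  intros u z Hu. apply H; [apply Hu|].
  destruct u as [w|e m j]; auto. apply Hu.
Qed.

Lemma coarse_ancestor mO z u k : (forall e, Le e -> (mO < ht e)%Z) -> cell z u ->
  (z - Z.of_nat k <= mO)%Z ->
  (z - Z.of_nat k <= ht (base u))%Z /\
  Nat.iter k (pir pi r) u = Old (anc (z - Z.of_nat k) (base u)) /\
  Te (anc (z - Z.of_nat k) (base u)) /\ ht (anc (z - Z.of_nat k) (base u)) = (z - Z.of_nat k)%Z /\
  incl (K (base u)) (K (anc (z - Z.of_nat k) (base u))).
Proof.
  intros HO Hu Hk.
  assert (Hle : (z - Z.of_nat k <= ht (base u))%Z).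
  { destruct (cell_inv _ _ Hu) as [[w [-> [H1 H2]]]|[e [m [j [-> [H1 [H2 [H3 ->]]]]]]]]; cbn [base] in *; [lia|].
    specialize (HO e H1). lia. }
  split; auto. split; [apply iter_pir_anc; auto|]. split; [apply Te_anc, (cell_Te z); auto|].
  split; [apply ht_anc; auto|]. apply K_desc, desc_anc.
Qed.

Lemma count_cells x0 w : validTr pi K r w -> exists C k0, 0 < C /\ forall k, (k0 <= k)%nat ->
  exists n : nat, cardR (Sk pi K r k (fun u => u = Nat.iter k (pir pi r) w)) = Finite (INR n) /\
    vol x0 (P k) <= C * INR n /\ INR n <= C * vol x0 (P k).
Proof.
  intros Hv. destruct (cell_ex _ Hv) as [z Hw]. destruct coarse_level as [mO HO].
  destruct inner_ball as [delta [m1 [Hdel Hball]]].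
  destruct (cells_at_vertex z) as [Cv' HCv']. destruct (cell_size z) as [S HS].
  destruct length_le_mu as [a [Ha Hlen]].
  destruct (Te_nonempty _ (cell_Te _ _ Hw)) as [x1 Hx1].
  assert (Hrz := rz_pos z).
  (* Balls are open, so twice the diameter bound is taken as the radius containing the ancestor
     cell. *)
  destruct (vol_le_origin x0 x1 (2 * (rz z / cg))) as [C1 [HC1 HV1]].
  destruct (vol_ge_origin x0 x1 (delta * rz z) (rz z / cg)) as [C2 [HC2 HV2]]; [apply Rmult_lt_0_compat; auto|].
  assert (Hia : 0 < / a) by (apply Rinv_0_lt_compat; auto).
  assert (HS0 := pos_INR S). assert (HC0 := pos_INR Cv').
  exists (C2 * / a * INR S + INR Cv' * / a * C1 + 1), (Z.to_nat (z - Z.min mO m1)). split.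
  { assert (0 <= C2 * / a * INR S) by (apply Rmult_le_pos; auto; left; apply Rmult_lt_0_compat; auto).
    assert (0 <= INR Cv' * / a * C1) by (repeat apply Rmult_le_pos; lra). lra. }
  intros k Hk. set (m := (z - Z.of_nat k)%Z).
  destruct (coarse_ancestor mO z w k HO Hw ltac:(lia)) as [Hle [Hit [HTa [Hha Hinc]]]].
  fold m in Hle, Hit, HTa, Hha, Hinc. set (ak := anc m (base w)) in *.
  (* [Sk] ranges over valid cells of all levels; the height of the [k]-th ancestor forces level
     [z]. *)
  assert (HA : forall u, Sk pi K r k (fun u => u = Nat.iter k (pir pi r) w) u <->
                 cell z u /\ anc m (base u) = ak).
  { intros u. unfold Sk. rewrite Hit. split.
    - intros [Hvu Hu]. destruct (cell_ex _ Hvu) as [z' Hz'].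
      assert (Hz : z' = z).
      { assert (H := htr_iter_pir k _ _ Hz'). rewrite Hu in H. simpl in H.
        assert (H' := ht_eq _ _ H). rewrite Hha in H'. unfold m in H'. lia. }
      subst z'. split; auto.
      destruct (coarse_ancestor mO z u k HO Hz' ltac:(lia)) as [_ [Hitu _]]. rewrite Hitu in Hu.
      injection Hu as Hu. exact Hu.
    - intros [Hu Ha']. split; [apply Hu|].
      destruct (coarse_ancestor mO z u k HO Hu ltac:(lia)) as [_ [Hitu _]]. rewrite Hitu. f_equal. exact Ha'. }
  assert (Hfin : fin_le (length (K ak) * Cv') (Sk pi K r k (fun u => u = Nat.iter k (pir pi r) w))).
  { apply fin_le_sub with (n := (length (K ak) * Cv')%nat)
      (B := fun u => exists x, In x (K ak) /\ (cell z u /\ In x (K (base u)))); auto.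
    - apply fin_le_bind; [exists (K ak); split; auto|]. intros x _. apply HCv'.
    - intros u Hu. apply HA in Hu. destruct Hu as [Hu Hau].
      destruct (Te_nonempty _ (cell_Te _ _ Hu)) as [x Hx]. exists x. split; auto.
      rewrite <- Hau. apply (K_desc _ _ (desc_anc m (base u))). exact Hx. }
  destruct (cardR_finite _ _ Hfin) as [l [Hndl [Hl Hcard]]].
  exists (length l). split; auto.
  assert (Hx1a : In x1 (K ak)) by (apply Hinc; auto).
  assert (Hvk := vol_pos x0 (P k) ltac:(assert (H := P_ge1 k); lra)).
  assert (Hlak : INR (length (K ak)) <= / a * (C1 * vol x0 (P k))).
  { apply Rmult_le_reg_l with a; auto. rewrite <- Rmult_assoc, Rinv_r, Rmult_1_l by lra.
    apply Rle_trans with (sumR (map (mu_v nbrs mu) (K ak))); [apply Hlen|].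
    apply Rle_trans with (vol x1 (2 * (rz z / cg) * P k)); [|apply HV1; lra].
    apply vol_ub; [apply NoDup_K|]. intros y Hy.
    assert (H := d_in_cell _ _ _ HTa Hx1a Hy). rewrite Hha in H. unfold m in H. rewrite rz_level in H.
    assert (HP := P_ge1 k). assert (Hp : 0 < rz z / cg) by (apply Rdiv_lt_0_compat; auto).
    replace (rz z * P k / cg) with (rz z / cg * P k) in H by (field; lra). nra. }
  split.
  - destruct (Hball ak HTa ltac:(lia)) as [x' [Hx' Hx'b]].
    assert (Hsz : (length (K ak) <= length l * S)%nat).
    { apply (fin_le_card (length l * S)) with (A := fun y => In y (K ak)); auto using NoDup_K.
      apply fin_le_sub with (n := (length l * S)%nat)
        (B := fun y => exists u, In u l /\ In y (K (base u))); auto.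
      - apply fin_le_bind; [exists l; auto|]. intros u Hu. exists (K (base u)). split; auto.
        apply HS. apply Hl in Hu. apply HA in Hu. apply Hu.
      (* Every vertex of the ancestor belongs to the base of a cell of level [z] below it: an edge
         cell at [y] is replaced by its ancestor on level [z] or, if it is coarser than that level,
         by a piece of its cable. *)
      - intros y Hy. destruct (Le_below _ _ HTa Hy) as [e [He [Hea Hye]]].
        assert (Hmz : (m <= z)%Z) by (unfold m; lia).
        assert (Hme : (m <= ht e)%Z) by (rewrite <- Hha; apply desc_ht; auto).
        destruct (Z_le_dec z (ht e)) as [Hz|Hz].
        + exists (Old (anc z e)). split; [apply Hl, HA; split|].
          * rewrite <- (ht_anc z e Hz) at 1. apply cell_Old, Te_anc, Le_Te; auto.
          * simpl. apply (desc_unique e).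
            -- apply desc_trans with (anc z e); apply desc_anc.
            -- exact Hea.
            -- rewrite ht_anc, Hha; auto. rewrite ht_anc; auto.
          * apply (K_desc _ _ (desc_anc z e)); auto.
        + exists (New e (Z.to_nat (z - ht e)) 0). split; [apply Hl, HA; split|].
          * replace z with (ht e + Z.of_nat (Z.to_nat (z - ht e)))%Z at 1 by lia.
            apply cell_New; auto; [lia|]. apply pow2_ge1.
          * simpl. apply (desc_unique e); auto using desc_anc. rewrite ht_anc, Hha; auto.
          * exact Hye. }
    assert (Hd1' : d x1 x' <= rz z / cg * P k).
    { assert (H := d_in_cell _ _ _ HTa Hx1a Hx'). rewrite Hha in H. unfold m in H. rewrite rz_level in H.
      replace (rz z / cg * P k) with (rz z * P k / cg) by (field; lra). exact H. }
    assert (Hvv : vol x0 (P k) <= C2 * vol x' (delta * rz (ht ak))).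
    { apply HV2; auto. rewrite Hha. unfold m. rewrite rz_level. lra. }
    assert (Hvol' : vol x' (delta * rz (ht ak)) <= / a * INR (length (K ak))).
    { apply vol_lub. intros l' Hl' Hin. eapply Rle_trans; [apply Hlen|].
      apply Rmult_le_compat_l; [lra|]. apply le_INR. apply NoDup_incl_length; auto.
      intros y Hy. apply Hx'b. auto. }
    assert (Hn : INR (length (K ak)) <= INR (length l) * INR S) by (rewrite <- mult_INR; apply le_INR; auto).
    assert (Hl0 := pos_INR (length l)).
    apply Rle_trans with (C2 * / a * INR S * INR (length l)).
    + eapply Rle_trans; [exact Hvv|]. rewrite !Rmult_assoc. apply Rmult_le_compat_l; [lra|].
      eapply Rle_trans; [exact Hvol'|]. apply Rmult_le_compat_l; [lra|]. lra.
    + apply Rmult_le_compat_r; auto.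
      assert (0 <= INR Cv' * / a * C1) by (repeat apply Rmult_le_pos; lra). lra.
  - assert (Hn : INR (length l) <= INR (length (K ak)) * INR Cv').
    { rewrite <- mult_INR. apply le_INR. apply (fin_le_card _ _ Hfin l Hndl). intros u Hu. apply Hl; auto. }
    apply Rle_trans with (INR Cv' * / a * C1 * vol x0 (P k)).
    + eapply Rle_trans; [exact Hn|]. rewrite (Rmult_comm (INR (length (K ak)))), !Rmult_assoc.
      apply Rmult_le_compat_l; auto.
    + apply Rmult_le_compat_r; [lra|].
      assert (0 <= C2 * / a * INR S) by (repeat apply Rmult_le_pos; lra). lra.
Qed.

(** * Energies *)

Lemma sqd_sum_weight f l :
  sumR (map (fun x => sumR (map (fun y => (f x - f y) ^ 2) (nbrs x))) l) =
  sumR (map (sqd f) (flat_map (fun x => map (pair x) (nbrs x)) l)).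
Proof.
  rewrite sumR_flat_map. f_equal. apply map_ext. intros x. rewrite map_map. reflexivity.
Qed.

(** The 2 undoes the factor 1/2 of the energy, and [cmu] bounds the conductances below. *)
Lemma qbound_of_energy f e : energy nbrs mu f = Finite e -> qbound (adj nbrs) f (2 / cmu * e).
Proof.
  intros He l Hl Hadj.
  assert (Hdec : forall a b : V, {a = b} + {a <> b}) by (intros; apply excluded_middle_informative).
  set (l1 := nodup Hdec (map fst l)).
  assert (Hub : / 2 * sumR (map (fun x => sumR (map (fun y => (f x - f y) ^ 2 * mu x y) (nbrs x))) l1) <= e).
  { destruct (Lub_Rbar_correct (fun z => exists l, NoDup l /\
     z = / 2 * sumR (map (fun x => sumR (map (fun y => (f x - f y) ^ 2 * mu x y) (nbrs x))) l))) as [H _].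
    unfold energy in He. rewrite He in H. apply (H _). exists l1. split; [apply NoDup_nodup|reflexivity]. }
  assert (H1 : sumR (map (sqd f) l) <= sumR (map (sqd f) (flat_map (fun x => map (pair x) (nbrs x)) l1))).
  { apply sumR_incl; auto using sqd_nonneg. intros [x y] Hq. apply in_flat_map. exists x. split.
    - apply nodup_In. apply (in_map fst _ _ Hq).
    - apply in_map. apply (Hadj _ Hq). }
  rewrite <- sqd_sum_weight in H1.
  assert (H2 : cmu * sumR (map (fun x => sumR (map (fun y => (f x - f y) ^ 2) (nbrs x))) l1) <=
     sumR (map (fun x => sumR (map (fun y => (f x - f y) ^ 2 * mu x y) (nbrs x))) l1)).
  { assert (E : forall (g : V -> R) l, cmu * sumR (map g l) = sumR (map (fun x => cmu * g x) l)).
    { intros g l0. induction l0 as [|b l0 IH]; [unfold sumR; simpl; ring|].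
      rewrite !map_cons, !sumR_cons, <- IH. ring. }
    rewrite E. apply sumR_map_le. intros x _. rewrite E. apply sumR_map_le. intros y Hy.
    rewrite Rmult_comm. apply Rmult_le_compat_l; [apply pow2_ge_0|]. apply Hmu. exact Hy. }
  apply Rmult_le_reg_l with cmu; auto. replace (cmu * (2 / cmu * e)) with (2 * e) by (field; lra).
  assert (H3 : cmu * sumR (map (sqd f) l) <=
    cmu * sumR (map (fun x => sumR (map (fun y => (f x - f y) ^ 2) (nbrs x))) l1)) by (apply Rmult_le_compat_l; lra).
  lra.
Qed.

Lemma energy_of_qbound f e : qbound (adj nbrs) f e ->
  exists e', energy nbrs mu f = Finite e' /\ e' <= / 2 * / cmu * e.
Proof.
  intros He. unfold energy.
  destruct (Lub_bounded (fun z => exists l, NoDup l /\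
     z = / 2 * sumR (map (fun x => sumR (map (fun y => (f x - f y) ^ 2 * mu x y) (nbrs x))) l))
     (/ 2 * / cmu * e)) as [v [H1 [H2 _]]].
  - exists (/ 2 * 0), nil. split; [constructor|reflexivity].
  - intros z [l [Hl ->]]. rewrite Rmult_assoc. apply Rmult_le_compat_l; [lra|].
    apply Rle_trans with (/ cmu * sumR (map (sqd f) (flat_map (fun x => map (pair x) (nbrs x)) l))).
    + rewrite <- sqd_sum_weight.
      assert (E : forall (g : V -> R) l, / cmu * sumR (map g l) = sumR (map (fun x => / cmu * g x) l)).
      { intros g l0. induction l0 as [|b l0 IH]; [unfold sumR; simpl; ring|].
        rewrite !map_cons, !sumR_cons, <- IH. ring. }
      rewrite E. apply sumR_map_le. intros x _. rewrite E. apply sumR_map_le. intros y Hy.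
      rewrite Rmult_comm. apply Rmult_le_compat_r; [apply pow2_ge_0|]. apply Hmu. exact Hy.
    + apply Rmult_le_compat_l; [left; apply Rinv_0_lt_compat; auto|]. apply He.
      * apply NoDup_edge_pairs; auto.
      * intros [x y] Hq. apply in_flat_map in Hq. destruct Hq as [x' [_ Hq]].
        apply in_map_iff in Hq. destruct Hq as [y' [E Hy']]. injection E as <- <-. exact Hy'.
  - eauto.
Qed.

Lemma level_energy_pairs f l : / 2 * sumR (map (fun q : Tr T * Tr T => Rabs (f (fst q) - f (snd q)) ^ 2) l) =
  / 2 * sumR (map (sqd f) l).
Proof. f_equal. f_equal. apply map_ext. intros q. unfold sqd. apply pow2_abs. Qed.

Lemma qbound_of_level_energy N z f e : level_energy pi phi K r 2 N z f = Finite e ->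
  qbound (JhN pi phi K r N z) f (2 * e).
Proof.
  intros He l Hl Hin. unfold level_energy in He.
  destruct (Lub_Rbar_correct (fun z0 => exists l : list (Tr T * Tr T), NoDup l /\
     (forall q, In q l -> JhN pi phi K r N z (fst q) (snd q)) /\
     z0 = / 2 * sumR (map (fun q => Rabs (f (fst q) - f (snd q)) ^ 2) l))) as [H _].
  rewrite He in H. assert (H1 : / 2 * sumR (map (sqd f) l) <= e).
  { rewrite <- level_energy_pairs. apply (H _). exists l. auto. }
  lra.
Qed.

Lemma level_energy_of_qbound N z f e : qbound (JhN pi phi K r N z) f e ->
  exists e', level_energy pi phi K r 2 N z f = Finite e' /\ e' <= / 2 * e.
Proof.
  intros He. unfold level_energy.
  destruct (Lub_bounded (fun z0 => exists l : list (Tr T * Tr T), NoDup l /\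
     (forall q, In q l -> JhN pi phi K r N z (fst q) (snd q)) /\
     z0 = / 2 * sumR (map (fun q => Rabs (f (fst q) - f (snd q)) ^ 2) l)) (/ 2 * e)) as [v [H1 [H2 _]]].
  - exists (/ 2 * 0), nil. split; [constructor|]. split; [intros q []|reflexivity].
  - intros z0 [l [Hl [Hin ->]]]. rewrite level_energy_pairs. apply Rmult_le_compat_l; [lra|]. apply He; auto.
  - eauto.
Qed.

(** * Resistance estimates as energy estimates *)

Variables (lam Cl Cu : R).
Hypothesis Hlam : 0 < lam.
Hypothesis HCl : 0 < Cl.
Hypothesis Hreslow : forall x s, Rbar_lt (rx d x) (Finite s) ->
      Rbar_le (Finite (Cl * Rpower s beta))
        (Rbar_mult (resistance nbrs mu (dball d x (lam * s)) (fun y => ~ dball d x s y)) (Vd nbrs mu d x s)).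
Hypothesis HCu : 0 < Cu.
Hypothesis Hresup : forall x s, Rbar_lt (rx d x) (Finite s) ->
      Rbar_le (Rbar_mult (resistance nbrs mu (fun y => y = x) (fun y => ~ dball d x s y)) (Vd nbrs mu d x s))
        (Finite (Cu * Rpower s beta)).

Lemma rx_lt x s : / cd < s -> Rbar_lt (rx d x) (Finite s).
Proof.
  intros Hs. destruct (has_nbr x) as [y Hy].
  apply Rbar_le_lt_trans with (Finite (d x y)).
  - apply (Glb_Rbar_correct (fun z => exists y, y <> x /\ z = d x y)).
    exists y. split; auto. intros ->. exact (Hirr _ Hy).
  - simpl. destruct (Hd1 _ _ Hy). lra.
Qed.

Lemma energy_nonneg f e : energy nbrs mu f = Finite e -> 0 <= e.
Proof.
  intros He. destruct (Lub_Rbar_correct (fun z => exists l, NoDup l /\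
     z = / 2 * sumR (map (fun x => sumR (map (fun y => (f x - f y) ^ 2 * mu x y) (nbrs x))) l))) as [H _].
  unfold energy in He. rewrite He in H.
  assert (H1 : / 2 * 0 <= e); [|lra].
  apply (H _). exists nil. split; [constructor|reflexivity].
Qed.

(** A near-minimiser of the variational problem defining the resistance; the factor 2 leaves room
    above an infimum that may not be attained. *)
Lemma cutoff_function x s : / cd < s -> exists f e,
  (forall y, d x y < lam * s -> f y = 1) /\ (forall y, ~ d x y < s -> f y = 0) /\
  energy nbrs mu f = Finite e /\ e <= 2 / Cl * (vol x s / Rpower s beta).
Proof.
  intros Hs. assert (H := Hreslow x s (rx_lt x s Hs)). rewrite Vd_finite in H. unfold resistance in H.
  assert (Hcd' : 0 < / cd) by (apply Rinv_0_lt_compat; auto).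
  assert (Hv : 0 < vol x s) by (apply vol_pos; lra).
  assert (Hp : 0 < Rpower s beta) by apply exp_pos.
  assert (HCp : 0 < Cl * Rpower s beta) by (apply Rmult_lt_0_compat; auto).
  assert (Hq : 0 < / Cl * (vol x s / Rpower s beta)).
  { apply Rmult_lt_0_compat; [apply Rinv_0_lt_compat; auto|apply Rdiv_lt_0_compat; auto]. }
  set (E := fun e => exists f : V -> R, (forall y, dball d x (lam * s) y -> f y = 1) /\
     (forall y, ~ dball d x s y -> f y = 0) /\ energy nbrs mu f = Finite e) in *.
  destruct (classic (exists e, E e)) as [Hex|Hno].
  - destruct (Glb_bounded E 0 Hex) as [g [HG [Hg0 [_ Hgc]]]].
    { intros e [f [_ [_ He]]]. apply (energy_nonneg f). exact He. }
    rewrite HG in H. unfold Rbar_recip in H.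
    assert (Hg : g < 2 / Cl * (vol x s / Rpower s beta)).
    (* If the infimum is 0, the resistance is infinite and the bound on [g] is trivial. *)
    { destruct (Req_dec_T g 0) as [->|Hne]; [lra|]. simpl in H.
      assert (Hgp : 0 < g) by lra.
      apply Rle_lt_trans with (/ Cl * (vol x s / Rpower s beta)); [|lra].
      apply Rmult_le_reg_l with (Cl * Rpower s beta); auto.
      replace (Cl * Rpower s beta * (/ Cl * (vol x s / Rpower s beta))) with (vol x s) by (field; lra).
      apply Rmult_le_compat_r with (r := g) in H; [|lra].
      replace (/ g * vol x s * g) with (vol x s) in H by (field; lra). exact H. }
    destruct (Hgc _ Hg) as [e [[f [H1 [H2 H3]]] He]].
    exists f, e. repeat split; auto. lra.
  (* Without a competitor the infimum is [p_infty] and the resistance 0, against its lower bound. *)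
  - exfalso. assert (HG : Glb_Rbar E = p_infty).
    { apply is_glb_Rbar_unique. split; [intros e He; exfalso; eauto|]. intros b _. destruct b; simpl; auto. }
    rewrite HG in H. simpl in H. rewrite Rmult_0_l in H. lra.
Qed.

Lemma energy_lower x s f e : / cd < s -> f x = 1 -> (forall y, ~ d x y < s -> f y = 0) ->
  energy nbrs mu f = Finite e -> vol x s / Rpower s beta <= Cu * e.
Proof.
  intros Hs H1 H2 He. assert (H := Hresup x s (rx_lt x s Hs)). rewrite Vd_finite in H. unfold resistance in H.
  assert (Hcd' : 0 < / cd) by (apply Rinv_0_lt_compat; auto).
  assert (Hv : 0 < vol x s) by (apply vol_pos; lra).
  assert (Hp : 0 < Rpower s beta) by apply exp_pos.
  set (E := fun e => exists f : V -> R, (forall y, y = x -> f y = 1) /\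
     (forall y, ~ dball d x s y -> f y = 0) /\ energy nbrs mu f = Finite e) in *.
  assert (HEe : E e) by (exists f; split; [intros y ->; auto|]; auto).
  destruct (Glb_bounded E 0 (ex_intro _ e HEe)) as [g [HG [Hg0 [Hlb _]]]].
  { intros e' [f' [_ [_ He']]]. apply (energy_nonneg f'). exact He'. }
  rewrite HG in H. unfold Rbar_recip in H. specialize (Hlb e HEe).
  destruct (Req_dec_T g 0) as [->|Hne].
  (* A vanishing infimum makes the resistance infinite, and with it the product with the positive
     volume, against the upper bound. *)
  - exfalso. unfold Rbar_mult, Rbar_mult' in H. destruct (Rle_dec 0 (vol x s)) as [Hle|]; [|lra].
    destruct (Rle_lt_or_eq_dec 0 (vol x s) Hle); [exact H|lra].
  - simpl in H. apply Rle_trans with (Cu * g); [|apply Rmult_le_compat_l; lra].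
    apply Rmult_le_reg_r with (Rpower s beta); auto. unfold Rdiv. rewrite Rmult_assoc, Rinv_l, Rmult_1_r by lra.
    apply Rmult_le_compat_r with (r := g) in H; [|lra].
    replace (/ g * vol x s * g) with (vol x s) in H by (field; lra). lra.
Qed.

(** * Transfer of energies between vertices and cells *)

Lemma within_J_cell z n u v : within (J z) n u v -> u = v \/ (cell z u /\ cell z v).
Proof.
  revert v. induction n as [|n IH]; intros v H; [left; exact H|].
  destruct H as [H|[c [H1 H2]]]; auto.
  destruct (J_cell _ _ _ H2) as [Hc Hv]. right. split; auto. destruct (IH _ H1) as [->|[Hu _]]; auto.
Qed.

(** Each of the at most [N + 1] cells is connected with at most [S] vertices, so it is crossed in
    [S] steps; neighbouring cells share a vertex of their bases. *)
Lemma cells_to_path z N : exists L, forall u v x y, within (J z) N u v -> cell z u -> cell z v ->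
  In x (K (base u)) -> In y (K (base v)) -> within (adj nbrs) L x y.
Proof.
  destruct (cell_size z) as [S HS]. exists ((N + 1) * S)%nat.
  assert (H1 : forall u x y, cell z u -> In x (K (base u)) -> In y (K (base u)) -> within (adj nbrs) S x y).
  { intros u x y Hu Hx Hy. apply within_shorten with (fun t => In t (K (base u))); auto.
    - exists (K (base u)). split; auto.
    - apply (Hcon _ (cell_Te _ _ Hu)); auto. }
  intros u v x y Hw Hu Hv Hx Hy. revert v y Hw Hv Hy. induction N as [|N IH]; intros v y Hw Hv Hy.
  - simpl in Hw. subst v. rewrite Nat.add_0_l, Nat.mul_1_l. apply (H1 u); auto.
  - replace ((Datatypes.S N + 1) * S)%nat with ((N + 1) * S + S)%nat by lia.
    destruct Hw as [Hw|[c [Hw HJ]]].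
    + apply within_trans with y; [apply (IH v); auto|apply within_refl].
    + destruct (J_cell _ _ _ HJ) as [Hc _]. destruct (J_common _ _ _ HJ) as [t [Ht1 Ht2]].
      apply within_trans with t; [apply (IH c); auto|apply (H1 v); auto].
Qed.

Lemma fin_le_adj x : fin_le D (fun y => adj nbrs x y).
Proof. exists (nbrs x). split; auto. Qed.

Lemma fin_le_adj_r x : fin_le D (fun y => adj nbrs y x).
Proof. exists (nbrs x). split; auto. intros y Hy. apply Hsym. exact Hy. Qed.

(** [rep] takes each value on boundedly many cells and sends neighbouring cells to vertices at
    bounded graph distance. The constant depends on [z] and [N] only, hence not on the scale of
    [f]. *)
Lemma energy_to_cells z N : exists C, 0 <= C /\ forall (rep : Tr T -> V) f e,
  (forall u, cell z u -> In (rep u) (K (base u))) -> energy nbrs mu f = Finite e ->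
  exists e', level_energy pi phi K r 2 N z (fun u => f (rep u)) = Finite e' /\ e' <= C * e.
Proof.
  destruct (cells_to_path z N) as [L HL]. destruct (cells_at_vertex z) as [Cz HCz].
  destruct (qbound_within (adj nbrs) D fin_le_adj fin_le_adj_r L) as [C1 [HC1 Hq]].
  assert (Hi : 0 < / cmu) by (apply Rinv_0_lt_compat; auto).
  assert (HCp := pos_INR (Cz * Cz)).
  exists (/ 2 * (INR (Cz * Cz) * (C1 * (2 / cmu)))). split.
  { apply Rmult_le_pos; [lra|]. apply Rmult_le_pos; auto. apply Rmult_le_pos; auto. unfold Rdiv. lra. }
  intros rep f e Hrep He.
  destruct (level_energy_of_qbound N z (fun u => f (rep u)) (INR (Cz * Cz) * (C1 * (2 / cmu * e)))) as [e' [H1 H2]].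
  - apply qbound_pullback with (E := within (adj nbrs) L) (D := cell z).
    + apply Hq. apply qbound_of_energy. exact He.
    + intros x. apply fin_le_sub with (n := Cz) (B := fun u => cell z u /\ In x (K (base u))); auto.
      intros u [Hu <-]. auto.
    + intros u v [Hne Hw]. destruct (within_J_cell _ _ _ _ Hw) as [E|[Hu Hv]]; [contradiction|].
      split; auto. split; auto. apply (HL u v); auto.
  - exists e'. split; auto. eapply Rle_trans; [exact H2|]. right. ring.
Qed.

Lemma energy_to_vertices z N : (1 <= N)%nat -> exists C, 0 <= C /\ forall (sel : V -> Tr T) f e,
  (forall x, cell z (sel x) /\ touch (sel x) x) -> level_energy pi phi K r 2 N z f = Finite e ->
  exists e', energy nbrs mu (fun x => f (sel x)) = Finite e' /\ e' <= C * e.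
Proof.
  intros HN. destruct (adj_cells z) as [L HL]. destruct (J_degree z) as [DJ HDJ].
  destruct (cell_size z) as [S HS].
  assert (HDJ' : forall u, fin_le DJ (fun v => J z v u)).
  { intros u. apply fin_le_sub with (n := DJ) (B := fun v => J z u v); auto. intros v Hv. apply J_sym; auto. }
  destruct (qbound_within (J z) DJ HDJ HDJ' L) as [C1 [HC1 Hq]].
  assert (Hi : 0 < / cmu) by (apply Rinv_0_lt_compat; auto).
  assert (HCp := pos_INR (S * S)).
  exists (/ 2 * / cmu * (INR (S * S) * (C1 * 2))). split.
  { apply Rmult_le_pos; [lra|]. apply Rmult_le_pos; auto. lra. }
  intros sel f e Hsel He.
  destruct (energy_of_qbound (fun x => f (sel x)) (INR (S * S) * (C1 * (2 * e)))) as [e' [H1 H2]].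
  - apply qbound_pullback with (E := within (J z) L) (D := fun _ => True).
    + apply Hq. apply qbound_sub with (JhN pi phi K r N z); [apply qbound_of_level_energy; auto|].
      intros u v HJ. split; [apply HJ|].
      apply within_mono with (E := J z) (n := 1%nat); auto. apply within_one; auto.
    + intros u. destruct (classic (cell z u)) as [Hu|Hu].
      * exists (K (base u)). split; auto. intros x [_ <-]. apply touch_In. apply Hsel.
      * exists nil. split; [simpl; lia|]. intros x [_ <-]. apply Hu. apply Hsel.
    + intros x y Hxy. split; auto. split; auto. apply (HL x y); auto; apply Hsel.
  - exists e'. split; auto. eapply Rle_trans; [exact H2|]. right. ring.
Qed.

(** The boundary conditions of [Epk], with the level given directly. When [w] is the [k]-th ancestor
    of a cell of level [z], that level is [z] for all [k]. *)
Definition admissible (N1 N2 k : nat) (w : Tr T) (z : Z) (f : Tr T -> R) : Prop :=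
  forall v, htr pi phi v z -> validTr pi K r v ->
    (Sk pi K r k (Gam pi phi K r N1 w) v -> f v = 1) /\ (~ Sk pi K r k (Gam pi phi K r N2 w) v -> f v = 0).

Lemma Rpower_scale A k : 0 < A -> Rpower (A * P k) beta = Rpower A beta * Rpower (P k) beta.
Proof. intros HA. symmetry. apply Rpower_mult_distr; auto. assert (H := P_ge1 k). lra. Qed.

Lemma scale_large A z : 0 < A -> exists k0, forall k, (k0 <= k)%nat -> / cd < A * rz (z - Z.of_nat k).
Proof.
  intros HA. destruct (rz_large (/ cd / A)) as [m Hm]. exists (Z.to_nat (z - m)). intros k Hk.
  specialize (Hm (z - Z.of_nat k)%Z ltac:(lia)).
  apply Rmult_lt_reg_r with (/ A); [apply Rinv_0_lt_compat; auto|].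
  replace (A * rz (z - Z.of_nat k) * / A) with (rz (z - Z.of_nat k)) by (field; lra). exact Hm.
Qed.

(** A cutoff function at radius [s = A * r^m] is transplanted to cells. [A] is chosen so that
    [lam * s] exceeds the extent [(N1 + 1) * r^m / cg] of the [N1]-neighbourhood, where the function
    must be 1. [far_cells] for this [A] then yields [N2_0]: outside the [N2_0]-neighbourhood the
    ball of radius [s] is left and the function is 0. Hence [N2_0] is independent of [N], [z] and
    [w]. *)
Lemma cells_energy_upper x0 N1 : exists N2_0, forall N2 N z w, (N2_0 <= N2)%nat -> cell z w ->
  exists C k0, 0 < C /\ forall k, (k0 <= k)%nat ->
    exists f e, admissible N1 N2 k (Nat.iter k (pir pi r) w) z f /\
      level_energy pi phi K r 2 N z f = Finite e /\ e <= C * (vol x0 (P k) / Rpower (P k) beta).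
Proof.
  assert (HN0 := pos_INR N1).
  set (A := (INR N1 + 2) / (cg * lam)).
  assert (HA : 0 < A) by (apply Rdiv_lt_0_compat; [lra|apply Rmult_lt_0_compat; auto]).
  destruct (far_cells A) as [N2_0 [m1 Hfar]]. destruct coarse_level as [mO HO].
  exists N2_0. intros N2 N z w HN2 Hw.
  destruct (Te_nonempty _ (cell_Te _ _ Hw)) as [x1 Hx1].
  assert (Hrz := rz_pos z).
  destruct (energy_to_cells z N) as [C1 [HC1 HE]].
  destruct (vol_le_origin x0 x1 (A * rz z)) as [C2 [HC2 HVo]].
  destruct (scale_large A z HA) as [k1 Hk1].
  assert (HAz : 0 < A * rz z) by (apply Rmult_lt_0_compat; auto).
  assert (HRp : 0 < Rpower (A * rz z) beta) by apply exp_pos.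
  exists (C1 * (2 / Cl * (C2 / Rpower (A * rz z) beta)) + 1), (max k1 (Z.to_nat (z - Z.min mO m1))).
  assert (HCpos : 0 <= C1 * (2 / Cl * (C2 / Rpower (A * rz z) beta))).
  { apply Rmult_le_pos; auto. left. apply Rmult_lt_0_compat; apply Rdiv_lt_0_compat; lra. }
  split; [lra|]. intros k Hk. set (m := (z - Z.of_nat k)%Z).
  destruct (coarse_ancestor mO z w k HO Hw ltac:(lia)) as [Hle [Hit [HTa [Hha Hinc]]]].
  fold m in Hle, Hit, HTa, Hha, Hinc. set (ak := anc m (base w)) in *.
  set (s := A * rz m).
  destruct (cutoff_function x1 s (Hk1 k ltac:(lia))) as [f [e [Hf1 [Hf0 [He Hes]]]]].
  set (rep := fun u : Tr T => hd x0 (K (base u))).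
  assert (Hrep : forall u, cell z u -> In (rep u) (K (base u))).
  { intros u Hu. destruct (Te_nonempty _ (cell_Te _ _ Hu)) as [x Hx]. unfold rep.
    destruct (K (base u)); [destruct Hx|simpl; auto]. }
  destruct (HE rep f e Hrep He) as [e' [He' Hee']].
  exists (fun u => f (rep u)), e'. split; [|split; auto].
  - intros v Hhv Hvv. assert (Hv : cell z v) by (split; auto).
    destruct (coarse_ancestor mO z v k HO Hv ltac:(lia)) as [_ [Hitv [HTv [Hhv' Hincv]]]].
    fold m in Hitv, HTv, Hhv', Hincv.
    assert (Hx1a : In x1 (K ak)) by (apply Hinc; auto).
    assert (Hrv : In (rep v) (K (anc m (base v)))) by (apply Hincv; auto).
    unfold Sk. rewrite Hitv, Hit. split.
    + intros [_ [z' [Hz1 [_ [_ Hch]]]]]. simpl in Hz1. apply ht_eq in Hz1. rewrite Hha in Hz1. subst z'.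
      apply Hf1. assert (H := chain_dist mO m N1 ak HO ltac:(lia) HTa Hha _ _ _ Hch HTv Hhv' Hx1a Hrv).
      eapply Rle_lt_trans; [exact H|]. unfold s, A.
      replace (lam * ((INR N1 + 2) / (cg * lam) * rz m)) with ((INR N1 + 2) * (rz m / cg)) by (field; lra).
      apply Rmult_lt_compat_r; [|lra]. apply Rdiv_lt_0_compat; auto using rz_pos.
    + intros Hn. apply Hf0. intros Hlt. apply Hn. split; auto. exists m.
      split; [apply ht_height; auto|].
      split; [apply ht_height; auto|]. split; [exact HTv|].
      apply within_mono with (E := J m) (n := N2_0); auto.
      apply (Hfar m x1 (rep v)); auto. lia.
  - assert (HP := P_ge1 k). assert (HRP : 0 < Rpower (P k) beta) by apply exp_pos.
    assert (Hsk : s = A * rz z * P k) by (unfold s, m; rewrite rz_level; ring).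
    rewrite Hsk, Rpower_scale in Hes by auto.
    assert (HVk : vol x1 (A * rz z * P k) <= C2 * vol x0 (P k)) by (apply HVo; lra).
    assert (Hvk : 0 < vol x0 (P k)) by (apply vol_pos; lra).
    apply Rle_trans with (C1 * (2 / Cl * (C2 / Rpower (A * rz z) beta)) * (vol x0 (P k) / Rpower (P k) beta)).
    + eapply Rle_trans; [exact Hee'|]. rewrite Rmult_assoc. apply Rmult_le_compat_l; auto.
      eapply Rle_trans; [exact Hes|]. rewrite (Rmult_assoc (2 / Cl)).
      apply Rmult_le_compat_l; [left; apply Rdiv_lt_0_compat; lra|].
      replace (C2 / Rpower (A * rz z) beta * (vol x0 (P k) / Rpower (P k) beta))
        with (C2 * vol x0 (P k) / (Rpower (A * rz z) beta * Rpower (P k) beta)) by (field; lra).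
      apply Rmult_le_compat_r; auto. left. apply Rinv_0_lt_compat. apply Rmult_lt_0_compat; auto.
    + apply Rmult_le_compat_r; [|lra]. left. apply Rdiv_lt_0_compat; auto.
Qed.

(** An admissible function transplanted to vertices is 1 at [x1] and vanishes off the ball of radius
    [A * r^m], because the [N2]-neighbourhood extends at most [(N2 + 1) * r^m / cg] from [x1]. The
    upper resistance bound then applies. *)
Lemma cells_energy_lower x0 N1 N2 N z w : (1 <= N)%nat -> cell z w ->
  exists C k0, 0 < C /\ forall k f e, (k0 <= k)%nat ->
    admissible N1 N2 k (Nat.iter k (pir pi r) w) z f ->
    level_energy pi phi K r 2 N z f = Finite e -> vol x0 (P k) / Rpower (P k) beta <= C * e.
Proof.
  intros HN Hw. assert (HN0 := pos_INR N2).
  set (A := (INR N2 + 2) / cg).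
  assert (HA : 0 < A) by (apply Rdiv_lt_0_compat; lra).
  destruct coarse_level as [mO HO].
  destruct (cell_center _ _ Hw) as [x1 [u1 [Hu1 [Htu1 [Hbu1 Hx1]]]]].
  destruct (energy_to_vertices z N HN) as [C1 [HC1 HE]].
  assert (Hrz := rz_pos z). assert (HAz : 0 < A * rz z) by (apply Rmult_lt_0_compat; auto).
  destruct (vol_ge_origin x0 x1 (A * rz z) 1 HAz) as [C2 [HC2 HVo]].
  destruct (scale_large A z HA) as [k1 Hk1].
  assert (HRp : 0 < Rpower (A * rz z) beta) by apply exp_pos.
  (* [x1] may touch several cells of level [z] with different ancestors; it is sent to the one with
     the base of [w], whose [k]-th ancestor is that of [w], so that the function is 1 there. *)
  assert (Hsel : exists sel : V -> Tr T, sel x1 = u1 /\ forall y, cell z (sel y) /\ touch (sel y) y).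
  { destruct (functional_choice (fun y u => (y = x1 -> u = u1) /\ cell z u /\ touch u y)) as [sel Hsel].
    - intros y. destruct (classic (y = x1)) as [->|Hne]; [exists u1; auto|].
      destruct (touch_ex z y) as [u Hu]. exists u. split; [contradiction|]. exact Hu.
    - exists sel. split; [apply Hsel; auto|]. intros y. apply Hsel. }
  destruct Hsel as [sel [Hsel1 Hsel]].
  assert (HCpos : 0 <= C2 * Rpower (A * rz z) beta * (Cu * C1)) by (repeat apply Rmult_le_pos; lra).
  exists (C2 * Rpower (A * rz z) beta * (Cu * C1) + 1), (max k1 (Z.to_nat (z - mO))).
  split; [lra|]. intros k f e Hk Hf He. set (m := (z - Z.of_nat k)%Z).
  destruct (coarse_ancestor mO z w k HO Hw ltac:(lia)) as [Hle [Hit [HTa [Hha Hinc]]]].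
  fold m in Hle, Hit, HTa, Hha, Hinc. rewrite Hit in Hf. set (ak := anc m (base w)) in *.
  destruct (HE sel f e Hsel He) as [e' [He' Hee']].
  set (s := A * rz m).
  assert (Hx1a : In x1 (K ak)) by (apply Hinc; auto).
  assert (Hlow : vol x1 s / Rpower s beta <= Cu * e').
  { apply (energy_lower x1 s (fun x => f (sel x))); auto; [apply Hk1; lia| |].
    - rewrite Hsel1. apply Hf; [apply Hu1|apply Hu1|]. split; [apply Hu1|].
      destruct (coarse_ancestor mO z u1 k HO Hu1 ltac:(lia)) as [_ [Hitu _]]. rewrite Hitu, Hbu1. fold m. fold ak.
      exists m. split; [apply ht_height; auto|].
      split; [apply ht_height; auto|]. split; [exact HTa|apply within_refl].
    - intros y Hy. destruct (Hsel y) as [Hcy Hty]. apply Hf; [apply Hcy|apply Hcy|].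
      intros [_ Hg]. apply Hy. destruct (coarse_ancestor mO z (sel y) k HO Hcy ltac:(lia)) as [_ [Hitu [HTu [Hhu Hincu]]]].
      rewrite Hitu in Hg. fold m in Hg, HTu, Hhu, Hincu.
      destruct Hg as [z' [Hz1 [_ [_ Hch]]]]. simpl in Hz1. apply ht_eq in Hz1. rewrite Hha in Hz1. subst z'.
      assert (H := chain_dist mO m N2 ak HO ltac:(lia) HTa Hha _ x1 y Hch HTu Hhu Hx1a ltac:(apply Hincu, touch_In; auto)).
      eapply Rle_lt_trans; [exact H|]. unfold s, A.
      replace ((INR N2 + 2) / cg * rz m) with ((INR N2 + 2) * (rz m / cg)) by (field; lra).
      apply Rmult_lt_compat_r; [|lra]. apply Rdiv_lt_0_compat; auto using rz_pos. }
  assert (HP := P_ge1 k). assert (HRP : 0 < Rpower (P k) beta) by apply exp_pos.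
  assert (Hsk : s = A * rz z * P k) by (unfold s, m; rewrite rz_level; ring).
  rewrite Hsk, Rpower_scale in Hlow by auto.
  assert (HVk : vol x0 (P k) <= C2 * vol x1 (A * rz z * P k)) by (apply HVo; [rewrite d_refl|]; lra).
  assert (He0 : 0 <= e).
  { assert (H := qbound_nonneg _ _ _ (qbound_of_level_energy N z f e He)). lra. }
  apply Rle_trans with (C2 * Rpower (A * rz z) beta * (Cu * C1) * e); [|apply Rmult_le_compat_r; lra].
  apply Rle_trans with (C2 * Rpower (A * rz z) beta *
     (vol x1 (A * rz z * P k) / (Rpower (A * rz z) beta * Rpower (P k) beta))).
  - replace (C2 * Rpower (A * rz z) beta *
     (vol x1 (A * rz z * P k) / (Rpower (A * rz z) beta * Rpower (P k) beta)))
      with (C2 * vol x1 (A * rz z * P k) / Rpower (P k) beta) by (field; lra).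
    apply Rmult_le_compat_r; [left; apply Rinv_0_lt_compat; auto|exact HVk].
  - rewrite (Rmult_assoc (C2 * _)). apply Rmult_le_compat_l; [apply Rmult_le_pos; lra|].
    eapply Rle_trans; [exact Hlow|]. rewrite Rmult_assoc. apply Rmult_le_compat_l; lra.
Qed.

(** [Epk] prescribes values on the level given by the height of the ancestor plus [k]. Uniqueness of
    heights identifies it with the level [z] of [w], so that both energy bounds concern the same
    infimum. *)
Lemma Epk_bounds x0 N1 : exists N2_0, forall N2 N w, (N2_0 <= N2)%nat -> (1 <= N)%nat -> validTr pi K r w ->
  exists C k0, 0 < C /\ forall k, (k0 <= k)%nat ->
    exists e, Epk pi phi K r 2 k (Nat.iter k (pir pi r) w) N1 N2 N = Finite e /\
      vol x0 (P k) / Rpower (P k) beta <= C * e /\ e <= C * (vol x0 (P k) / Rpower (P k) beta).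
Proof.
  destruct (cells_energy_upper x0 N1) as [N2_0 Hup]. destruct coarse_level as [mO HO].
  exists N2_0. intros N2 N w HN2 HN Hvw. destruct (cell_ex _ Hvw) as [z Hw].
  destruct (Hup N2 N z w HN2 Hw) as [C1 [k1 [HC1 Hu]]].
  destruct (cells_energy_lower x0 N1 N2 N z w HN Hw) as [C2 [k2 [HC2 Hl]]].
  exists (C1 + C2), (max (Z.to_nat (z - mO)) (max k1 k2)). split; [lra|]. intros k Hk.
  assert (HP := P_ge1 k).
  assert (HX : 0 < vol x0 (P k) / Rpower (P k) beta).
  { apply Rdiv_lt_0_compat; [apply vol_pos; lra|apply exp_pos]. }
  destruct (coarse_ancestor mO z w k HO Hw ltac:(lia)) as [_ [Hit [_ [Hha _]]]].
  set (w' := Nat.iter k (pir pi r) w) in *.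
  set (E := fun e => exists z (f : Tr T -> R), htr pi phi w' z /\
     (forall v, htr pi phi v (z + Z.of_nat k)%Z -> validTr pi K r v ->
        (Sk pi K r k (Gam pi phi K r N1 w') v -> f v = 1) /\ (~ Sk pi K r k (Gam pi phi K r N2 w') v -> f v = 0)) /\
     level_energy pi phi K r 2 N (z + Z.of_nat k)%Z f = Finite e).
  assert (HzE : (z - Z.of_nat k + Z.of_nat k = z)%Z) by lia.
  assert (HElow : forall e, E e -> vol x0 (P k) / Rpower (P k) beta <= C2 * e).
  { intros e [z' [f [Hz' [Hf He]]]]. rewrite Hit in Hz'. simpl in Hz'. apply ht_eq in Hz'.
    rewrite Hha in Hz'. subst z'. rewrite HzE in Hf, He. apply (Hl k f e); auto. lia. }
  destruct (Hu k ltac:(lia)) as [f [e [Hf [He Hle]]]].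
  assert (HEe : E e).
  { exists (z - Z.of_nat k)%Z, f. rewrite HzE. split; auto. apply htr_iter_pir. exact Hw. }
  destruct (Glb_bounded E (vol x0 (P k) / Rpower (P k) beta / C2) (ex_intro _ e HEe)) as [g [HG [Hg1 [Hg2 _]]]].
  { intros e' He'. specialize (HElow e' He'). apply Rmult_le_reg_l with C2; auto.
    replace (C2 * (vol x0 (P k) / Rpower (P k) beta / C2)) with (vol x0 (P k) / Rpower (P k) beta); auto.
    field. split; [apply Rgt_not_eq, exp_pos|lra]. }
  exists g. split; [exact HG|].
  assert (Hg : vol x0 (P k) / Rpower (P k) beta <= C2 * g).
  { apply Rmult_le_compat_l with (r := C2) in Hg1; [|lra].
    replace (C2 * (vol x0 (P k) / Rpower (P k) beta / C2)) with (vol x0 (P k) / Rpower (P k) beta) in Hg1; auto.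
    field. split; [apply Rgt_not_eq, exp_pos|lra]. }
  assert (Hg0 : 0 < g) by nra.
  split; [nra|]. specialize (Hg2 e HEe). nra.
Qed.

(** * Growth exponents *)

Lemma ln_le_mono x y : 0 < x -> x <= y -> ln x <= ln y.
Proof. intros Hx [H| ->]; [left; apply ln_increasing; auto|lra]. Qed.

Lemma ln_comparable X Y C : 0 < C -> 0 < X -> 0 < Y -> X <= C * Y -> Y <= C * X -> Rabs (ln Y - ln X) <= ln C.
Proof.
  intros HC HX HY H1 H2. apply ln_le_mono in H1; auto. apply ln_le_mono in H2; auto.
  rewrite ln_mult in H1, H2 by auto. apply Rabs_le. lra.
Qed.

Lemma ln_P k : ln (P k) = INR k * - ln r.
Proof. rewrite ln_pow, ln_Rinv; auto; try lra. apply Rinv_0_lt_compat. lra. Qed.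

Variable xo : V.
Definition growth (k : nat) : R := ln (vol xo (P k)) / INR k.

Lemma P_pos k : 0 < P k.
Proof. assert (H := P_ge1 k). lra. Qed.

Lemma volP_pos k : 0 < vol xo (P k).
Proof. apply vol_pos, P_pos. Qed.

Lemma growth_mult k : (1 <= k)%nat -> INR k * growth k = ln (vol xo (P k)).
Proof. intros Hk. unfold growth. field. apply not_0_INR. lia. Qed.

(** Volumes are bounded below by the mass of a vertex and above by polynomial growth, which
    contributes [alpha * - ln r]. Both limits of [growth] are therefore finite. *)
Lemma growth_bounded : exists A, 0 <= A /\ forall k, (1 <= k)%nat -> - A <= growth k <= A.
Proof.
  destruct vol_lower as [a [Ha Hlow]].
  assert (H1 := Rabs_pos (ln a)). assert (H2 := Rabs_pos (ln (Cv * vol xo 1))).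
  assert (Hq : 0 < alpha * - ln r) by (apply Rmult_lt_0_compat; [lra|assert (H := ln_r_neg); lra]).
  exists (Rabs (ln a) + Rabs (ln (Cv * vol xo 1)) + alpha * - ln r). split; [lra|].
  intros k Hk. assert (HI : 1 <= INR k) by (apply (le_INR 1); auto).
  assert (Hup : ln (vol xo (P k)) <= ln (Cv * vol xo 1) + alpha * (INR k * - ln r)).
  { assert (Hv1 : 0 < vol xo 1) by (apply vol_pos; lra).
    assert (HP : 1 < P k).
    { apply Rlt_pow_R1; [|lia]. rewrite <- Rinv_1. apply Rinv_lt_contravar; lra. }
    assert (H := vol_growth xo (P k) 1 ltac:(lra) HP). apply ln_le_mono in H; [|apply volP_pos].
    replace (Cv * Rpower (P k / 1) alpha * vol xo 1) with (Cv * vol xo 1 * Rpower (P k / 1) alpha) in H by ring.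
    rewrite ln_mult in H; [|apply Rmult_lt_0_compat; auto|apply exp_pos].
    unfold Rpower in H at 1. rewrite ln_exp, Rdiv_1_r, ln_P in H. exact H. }
  assert (Hlo : ln a <= ln (vol xo (P k))) by (apply ln_le_mono; auto; apply Hlow, P_pos).
  assert (HE := growth_mult k Hk).
  assert (A1 := Rle_abs (ln a)). assert (A2 := Rle_abs (- ln a)). rewrite Rabs_Ropp in A2.
  assert (A3 := Rle_abs (ln (Cv * vol xo 1))).
  split; apply Rmult_le_reg_l with (INR k); try lra; rewrite HE; nra.
Qed.

Lemma card_growth w lo hi : validTr pi K r w ->
  is_LimInf_seq growth (Finite lo) -> is_LimSup_seq growth (Finite hi) ->
  liminfR (fun k => rootk (cardR (Sk pi K r k (fun u => u = Nat.iter k (pir pi r) w))) k) = Finite (exp lo) /\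
  limsupR (fun k => rootk (cardR (Sk pi K r k (fun u => u = Nat.iter k (pir pi r) w))) k) = Finite (exp hi).
Proof.
  intros Hw Hlo Hhi. destruct (count_cells xo w Hw) as [C [k0 [HC H]]].
  set (u := fun k => cardR (Sk pi K r k (fun u => u = Nat.iter k (pir pi r) w))).
  assert (Hu : forall k, (max k0 1 <= k)%nat -> u k = Finite (real (u k)) /\ 0 < real (u k)).
  { intros k Hk. destruct (H k ltac:(lia)) as [n [Hn [H1 H2]]]. unfold u. rewrite Hn. split; auto.
    simpl. assert (Hv := volP_pos k). nra. }
  assert (Hy : forall k, (max k0 1 <= k)%nat -> Rabs (ln (real (u k)) - INR k * (growth k + 0)) <= ln C).
  { intros k Hk. rewrite Rplus_0_r, growth_mult by lia.
    destruct (Hu k Hk) as [_ Hpos]. destruct (H k ltac:(lia)) as [n [Hn [H1 H2]]].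
    unfold u in *. rewrite Hn in *. apply ln_comparable; auto. apply volP_pos. }
  rewrite <- (Rplus_0_r lo), <- (Rplus_0_r hi). split.
  - apply (liminf_root u _ growth lo 0 _ _ Hlo Hu Hy).
  - apply (limsup_root u _ growth hi 0 _ _ Hhi Hu Hy).
Qed.

(** [N2_0] is quantified before [w], because the supremum in [Rlower] needs one threshold for all
    cells. *)
Lemma energy_growth N1 : exists N2_0, forall N2 N w lo, (N2_0 <= N2)%nat -> (1 <= N)%nat ->
  validTr pi K r w -> is_LimInf_seq growth (Finite lo) ->
  liminfR (fun k => rootk (Epk pi phi K r 2 k (Nat.iter k (pir pi r) w) N1 N2 N) k)
    = Finite (exp (lo + beta * ln r)).
Proof.
  destruct (Epk_bounds xo N1) as [N2_0 HE]. exists N2_0. intros N2 N w lo HN2 HN Hw Hlo.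
  destruct (HE N2 N w HN2 HN Hw) as [C [k0 [HC H]]].
  set (u := fun k => Epk pi phi K r 2 k (Nat.iter k (pir pi r) w) N1 N2 N).
  assert (HX : forall k, 0 < vol xo (P k) / Rpower (P k) beta).
  { intros k. apply Rdiv_lt_0_compat; [apply volP_pos|apply exp_pos]. }
  assert (Hu : forall k, (max k0 1 <= k)%nat -> u k = Finite (real (u k)) /\ 0 < real (u k)).
  { intros k Hk. destruct (H k ltac:(lia)) as [e [He [H1 H2]]]. unfold u. rewrite He. split; auto.
    simpl. specialize (HX k). nra. }
  apply (liminf_root u (fun k => real (u k)) growth lo (beta * ln r) (ln C) (max k0 1) Hlo Hu).
  intros k Hk. rewrite Rmult_plus_distr_l, growth_mult by lia.
  replace (ln (vol xo (P k)) + INR k * (beta * ln r)) with (ln (vol xo (P k) / Rpower (P k) beta)).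
  - destruct (Hu k Hk) as [_ Hpos]. destruct (H k ltac:(lia)) as [e [He [H1 H2]]].
    unfold u in *. rewrite He in *. apply ln_comparable; auto.
  - unfold Rdiv. rewrite ln_mult, ln_Rinv; [|apply exp_pos|apply volP_pos|apply Rinv_0_lt_compat, exp_pos].
    unfold Rpower. rewrite ln_exp, ln_P. ring.
Qed.

(** * Spectral dimensions *)

Variable ch : R.
Hypothesis Hch : 0 < ch.
Hypothesis Hheat : forall x (n : nat), (1 <= n)%nat ->
      Rbar_le (Finite ch) (Rbar_mult (Finite (hk nbrs mu (2 * n) x x)) (Vd nbrs mu d x (Rpower (INR n) (/ beta)))) /\
      Rbar_le (Rbar_mult (Finite (hk nbrs mu (2 * n) x x)) (Vd nbrs mu d x (Rpower (INR n) (/ beta)))) (Finite (/ ch)).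

Lemma heat_log x : exists C, forall n, (1 <= n)%nat ->
  Rabs (- ln (pn nbrs mu (2 * n) x x) - ln (vol x (Rpower (INR n) (/ beta)))) <= C.
Proof.
  destruct mu_v_bounds as [a [Ha Hm]]. assert (Hmx : 0 < mu_v nbrs mu x) by (destruct (Hm x); lra).
  set (m := mu_v nbrs mu x) in *. assert (Hich : 0 < / ch) by (apply Rinv_0_lt_compat; auto).
  exists (Rabs (ln (ch * m)) + Rabs (ln (/ ch * m))). intros n Hn.
  destruct (Hheat x n Hn) as [H1 H2]. rewrite Vd_finite in H1, H2. 
  change (ch <= hk nbrs mu (2 * n) x x * vol x (Rpower (INR n) (/ beta))) in H1.
  change (hk nbrs mu (2 * n) x x * vol x (Rpower (INR n) (/ beta)) <= / ch) in H2.
  unfold hk in H1, H2. fold m in H1, H2.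
  set (p := pn nbrs mu (2 * n) x x) in *. set (v := vol x (Rpower (INR n) (/ beta))) in *.
  assert (Hv : 0 < v) by (apply vol_pos, exp_pos).
  assert (Hpv : p / m * v * m = p * v) by (field; lra).
  assert (H3 : ch * m <= p * v) by (rewrite <- Hpv; apply Rmult_le_compat_r; lra).
  assert (H4 : p * v <= / ch * m) by (rewrite <- Hpv; apply Rmult_le_compat_r; lra).
  assert (Hcm : 0 < ch * m) by (apply Rmult_lt_0_compat; auto).
  assert (Hp : 0 < p) by nra.
  apply ln_le_mono in H3; auto. apply ln_le_mono in H4; [|apply Rmult_lt_0_compat; auto].
  rewrite (ln_mult p v) in H3, H4 by auto.
  assert (A1 := Rle_abs (ln (ch * m))). assert (A2 := Rle_abs (- ln (ch * m))).
  assert (A3 := Rle_abs (ln (/ ch * m))). assert (A4 := Rle_abs (- ln (/ ch * m))).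
  rewrite Rabs_Ropp in A2, A4. apply Rabs_le. lra.
Qed.

(* [ln n] and [beta k |ln r|] within bounded distance means that [n^(1/beta)] and [r^(-k)] are comparable radii. *)
Lemma heat_growth x A : 0 <= A -> exists C, forall n k, (1 <= k)%nat -> (2 <= n)%nat ->
  Rabs (ln (INR n) - beta * (INR k * - ln r)) <= A ->
  Rabs (- ln (pn nbrs mu (2 * n) x x) / ln (INR n) - / (beta * - ln r) * growth k) <= C / ln (INR n).
Proof.
  intros HA. destruct (heat_log x) as [C0 HC0]. destruct growth_bounded as [Ag [HAg Hg]].
  assert (Hq : 0 < - ln r) by (assert (H := ln_r_neg); lra). set (q := - ln r) in *.
  assert (Hb : 0 < beta) by lra. assert (Hbq : 0 < beta * q) by (apply Rmult_lt_0_compat; auto).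
  destruct (vol_le_origin xo x (exp (A / beta))) as [C1 [HC1 HV1]].
  destruct (vol_ge_origin xo x (exp (- (A / beta))) 1 (exp_pos _)) as [C2 [HC2 HV2]].
  (* [C0] is the heat kernel error, [ln (C1 + C2)] the cost of changing the centre and radius of the
     ball, and the last term the cost of replacing [k] by [ln n / (beta * q)], weighted by the bound
     on [growth]. *)
  exists (C0 + ln (C1 + C2) + Ag * (/ (beta * q) * A)). intros n k Hk Hn Hnk.
  assert (HI : 2 <= INR n) by (apply (le_INR 2); auto).
  assert (Hln : 0 < ln (INR n)) by (rewrite <- ln_1; apply ln_increasing; lra).
  set (t := Rpower (INR n) (/ beta)).
  assert (HPe : P k = exp (INR k * q)) by (rewrite <- (exp_ln (P k)) at 1 by apply P_pos; rewrite ln_P; reflexivity).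
  assert (Hnk' := proj1 (Rabs_le_between _ _) Hnk).
  assert (Hdiv : forall y, y / beta * beta = y) by (intros y; field; lra).
  assert (Hexp : forall a b, a <= b -> exp a <= exp b).
  { intros a b [H| ->]; [left; apply exp_increasing; auto|lra]. }
  assert (T1 : t <= exp (A / beta) * P k).
  { rewrite HPe, <- exp_plus. apply Hexp. apply Rmult_le_reg_r with beta; auto.
    rewrite Rmult_plus_distr_r, Hdiv. replace (/ beta * ln (INR n) * beta) with (ln (INR n)) by (field; lra). lra. }
  assert (T2 : exp (- (A / beta)) * P k <= t).
  { rewrite HPe, <- exp_plus. apply Hexp. apply Rmult_le_reg_r with beta; auto.
    rewrite Rmult_plus_distr_r, <- Ropp_mult_distr_l, Hdiv.
    replace (/ beta * ln (INR n) * beta) with (ln (INR n)) by (field; lra). lra. }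
  assert (Hvt : 0 < vol x t) by (apply vol_pos, exp_pos). assert (Hv0 := volP_pos k).
  assert (W1 := HV1 k t T1).
  assert (W2 : vol xo (P k) <= C2 * vol x t).
  { apply HV2; auto. rewrite d_refl. assert (H := P_pos k). lra. }
  assert (W : Rabs (ln (vol x t) - ln (vol xo (P k))) <= ln (C1 + C2)).
  { apply ln_comparable; auto; [lra| |]; nra. }
  specialize (HC0 n ltac:(lia)). fold t in HC0.
  rewrite <- (growth_mult k Hk) in W.
  set (g := growth k) in *. set (Lp := - ln (pn nbrs mu (2 * n) x x)) in *.
  assert (Hgk := Hg k Hk). fold g in Hgk.
  assert (Hdiff : Rabs (INR k - / (beta * q) * ln (INR n)) <= / (beta * q) * A).
  { replace (INR k - / (beta * q) * ln (INR n)) with (- (/ (beta * q) * (ln (INR n) - beta * (INR k * q)))) by (field; lra).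
    rewrite Rabs_Ropp, Rabs_mult, (Rabs_pos_eq (/ (beta * q))) by (left; apply Rinv_0_lt_compat; auto).
    apply Rmult_le_compat_l; [left; apply Rinv_0_lt_compat; auto|exact Hnk]. }
  assert (Hg' : Rabs g <= Ag) by (apply Rabs_le; lra).
  replace (Lp / ln (INR n) - / (beta * q) * g) with
    (((Lp - ln (vol x t)) + (ln (vol x t) - INR k * g) + g * (INR k - / (beta * q) * ln (INR n))) * / ln (INR n))
    by (field; lra).
  rewrite Rabs_mult, (Rabs_pos_eq (/ ln (INR n))) by (left; apply Rinv_0_lt_compat; auto).
  apply Rmult_le_compat_r; [left; apply Rinv_0_lt_compat; auto|].
  eapply Rle_trans; [apply Rabs_triang|]. apply Rplus_le_compat.
  - eapply Rle_trans; [apply Rabs_triang|]. apply Rplus_le_compat; auto.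
  - rewrite Rabs_mult. apply Rmult_le_compat; auto using Rabs_pos.
Qed.

Lemma ln_INR_large A : exists N, forall n, (N <= n)%nat -> (2 <= n)%nat /\ A <= ln (INR n).
Proof.
  destruct (ex_INR_gt (exp A)) as [N HN]. exists (max N 2). intros n Hn. split; [lia|].
  rewrite <- (ln_exp A). left. apply ln_increasing; [apply exp_pos|]. apply HN. lia.
Qed.

(** Spectral dimensions run over all times [n], growth only over radii [r^(-k)]. [kappa n] is the
    least scale with [r^(-beta k) > n], which controls every time; [nu k] is the least integer above
    [r^(-beta k)], which shows that every scale is realised by a time. *)
Lemma dS_growth x lo hi :
  is_LimInf_seq growth (Finite lo) -> is_LimSup_seq growth (Finite hi) ->
  dS_lower nbrs mu x = Finite (2 * (/ (beta * - ln r) * lo)) /\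
  dS_upper nbrs mu x = Finite (2 * (/ (beta * - ln r) * hi)).
Proof.
  intros Hlo Hhi. assert (Hq : 0 < - ln r) by (assert (H := ln_r_neg); lra). set (q := - ln r) in *.
  assert (Hb : 0 < beta) by lra. assert (Hbq : 0 < beta * q) by (apply Rmult_lt_0_compat; auto).
  assert (Hln2 : 0 < ln 2) by (rewrite <- ln_1; apply ln_increasing; lra).
  (* In the logarithm, rounding a time to a scale costs at most [beta * q], and rounding
     [r^(-beta k)] to an integer at most [ln 2]. *)
  destruct (heat_growth x (beta * q + ln 2)) as [C HC]; [lra|]. fold q in HC.
  set (kappa := fun n : nat => Z.to_nat (up (ln (INR n) / (beta * q)))).
  set (nu := fun k : nat => Z.to_nat (up (exp (beta * (INR k * q))))).
  assert (Hkap : forall n, 0 <= ln (INR n) -> (1 <= kappa n)%nat /\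
            0 < beta * (INR (kappa n) * q) - ln (INR n) <= beta * q).
  { intros n Hn. set (y := ln (INR n) / (beta * q)).
    assert (Hy : 0 <= y) by (apply Rdiv_le_0_compat; lra).
    destruct (archimed y) as [Hu1 Hu2].
    assert (Hu : (0 < up y)%Z) by (apply lt_IZR; lra).
    assert (HIk : INR (kappa n) = IZR (up y)) by (unfold kappa; fold y; rewrite INR_IZR_INZ, Z2Nat.id; auto; lia).
    split; [unfold kappa; fold y; lia|]. rewrite HIk.
    assert (HE : ln (INR n) = beta * q * y) by (unfold y; field; lra). rewrite HE.
    replace (beta * (IZR (up y) * q) - beta * q * y) with (beta * q * (IZR (up y) - y)) by ring.
    split; [apply Rmult_lt_0_compat; lra|]. rewrite <- (Rmult_1_r (beta * q)) at 2. apply Rmult_le_compat_l; lra. }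
  assert (Hnu : forall k, (2 <= nu k)%nat /\ exp (beta * (INR k * q)) < INR (nu k) <= 2 * exp (beta * (INR k * q))).
  { intros k. set (y := exp (beta * (INR k * q))).
    assert (Hy : 1 <= y).
    { unfold y. assert (H := exp_ineq1_le (beta * (INR k * q))).
      assert (0 <= beta * (INR k * q)) by (apply Rmult_le_pos; [lra|apply Rmult_le_pos; [apply pos_INR|lra]]). lra. }
    destruct (archimed y) as [Hu1 Hu2].
    assert (Hu : (1 < up y)%Z) by (apply lt_IZR; lra).
    assert (HIk : INR (nu k) = IZR (up y)) by (unfold nu; fold y; rewrite INR_IZR_INZ, Z2Nat.id; auto; lia).
    split; [unfold nu; fold y; lia|]. rewrite HIk. lra. }
  assert (Hkinf : forall m, exists N, forall n, (N <= n)%nat -> (m <= kappa n)%nat).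
  { intros m. destruct (ln_INR_large (beta * q * INR m)) as [N HN]. exists N. intros n Hn.
    destruct (HN n Hn) as [_ H]. assert (Hm := pos_INR m).
    assert (Hn0 : 0 <= ln (INR n)) by (assert (0 <= beta * q * INR m) by (apply Rmult_le_pos; lra); lra).
    destruct (Hkap n Hn0) as [_ [H1 _]]. apply INR_le. left.
    apply Rmult_lt_reg_l with (beta * q); auto.
    replace (beta * q * INR (kappa n)) with (beta * (INR (kappa n) * q)) by ring. lra. }
  assert (Hninf : forall m, exists N, forall k, (N <= k)%nat -> (m <= nu k)%nat).
  { intros m. destruct (ex_INR_gt (INR m / (beta * q))) as [N HN]. exists N. intros k Hk. specialize (HN k Hk).
    destruct (Hnu k) as [_ [H1 _]]. apply INR_le. left.
    assert (H := exp_ineq1_le (beta * (INR k * q))).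
    assert (INR m = INR m / (beta * q) * (beta * q)) by (field; lra).
    assert (INR m / (beta * q) * (beta * q) < INR k * (beta * q)) by (apply Rmult_lt_compat_r; auto). nra. }
  assert (Hsmall : forall eps, 0 < eps -> exists N, forall n, (N <= n)%nat ->
            (2 <= n)%nat /\ 0 <= ln (INR n) /\ C / ln (INR n) <= eps).
  { intros eps He. destruct (ln_INR_large (Rabs C / eps + 1)) as [N HN]. exists N. intros n Hn.
    destruct (HN n Hn) as [H2 H]. assert (H0 : 0 <= Rabs C / eps) by (apply Rdiv_le_0_compat; auto using Rabs_pos).
    split; auto. split; [lra|]. apply Rmult_le_reg_r with (ln (INR n)); [lra|].
    unfold Rdiv. rewrite Rmult_assoc, Rinv_l, Rmult_1_r by lra.
    assert (Rabs C = eps * (Rabs C / eps)) by (field; lra). assert (Hc := Rle_abs C). nra. }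
  set (b := fun n => - ln (pn nbrs mu (2 * n) x x) / ln (INR n)).
  assert (B1 : forall eps, 0 < eps -> exists N, forall n, (N <= n)%nat ->
            Rabs (b n - / (beta * q) * growth (kappa n)) <= eps).
  { intros eps He. destruct (Hsmall eps He) as [N HN]. exists N. intros n Hn.
    destruct (HN n Hn) as [H2 [H0 Hc]]. destruct (Hkap n H0) as [Hk1 Hk2].
    eapply Rle_trans; [apply (HC n (kappa n)); auto|exact Hc]. apply Rabs_le. lra. }
  assert (B2 : forall eps, 0 < eps -> exists N, forall k, (N <= k)%nat ->
            Rabs (b (nu k) - / (beta * q) * growth k) <= eps).
  { intros eps He. destruct (Hsmall eps He) as [N HN]. destruct (Hninf N) as [N' HN'].
    exists (max N' 1). intros k Hk. destruct (HN (nu k) (HN' k ltac:(lia))) as [_ [H0 Hc]].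
    destruct (Hnu k) as [Hn2 [Hn3 Hn4]].
    eapply Rle_trans; [apply (HC (nu k) k); auto; [lia|]|exact Hc].
    assert (Hpos := exp_pos (beta * (INR k * q))).
    apply ln_increasing in Hn3; auto. rewrite ln_exp in Hn3.
    apply ln_le_mono in Hn4; [|apply lt_0_INR; lia].
    rewrite ln_mult, ln_exp in Hn4 by lra. apply Rabs_le. lra. }
  assert (Hiq : 0 < / (beta * q)) by (apply Rinv_0_lt_compat; auto).
  assert (L1 := LimInf_reparam growth b _ lo kappa nu Hiq Hkinf Hninf B1 B2 Hlo).
  assert (L2 := LimSup_reparam growth b _ hi kappa nu Hiq Hkinf Hninf B1 B2 Hhi).
  split.
  - change (dS_lower nbrs mu x) with (Rbar_mult (Finite 2) (liminfR (fun n => Finite (b n)))).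
    rewrite (liminfR_real b _ L1). reflexivity.
  - change (dS_upper nbrs mu x) with (Rbar_mult (Finite 2) (limsupR (fun n => Finite (b n)))).
    rewrite (limsupR_real b _ L2). reflexivity.
Qed.

Lemma spectral_dimensions : forall N1 : nat, exists N2_0 : nat, forall N2 N : nat, (N2_0 <= N2)%nat -> (1 <= N)%nat ->
    exists nlow nup rlow : R,
      Nlower pi K r = Finite nlow /\ Nupper pi K r = Finite nup /\
      Rlower pi phi K r 2 N1 N2 N = Finite rlow /\
      0 < nlow /\ 0 < nup /\ 0 < rlow /\
      forall x : V,
        dS_lower nbrs mu x = Finite (2 * ln nlow / (ln nlow - ln rlow)) /\
        dS_upper nbrs mu x = Finite (2 * ln nup / (ln nlow - ln rlow)).
Proof.
  intros N1. destruct (energy_growth N1) as [N2_0 HE]. exists N2_0. intros N2 N HN2 HN.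
  destruct growth_bounded as [Ag [_ Hg]].
  destruct (ex_LimInf_bounded growth _ _ 1%nat Hg) as [lo Hlo].
  destruct (ex_LimSup_bounded growth _ _ 1%nat Hg) as [hi Hhi].
  (* A valid cell, so that the suprema over cells are not taken over the empty set. *)
  destruct (vertex_Le xo) as [e0 [He0 _]].
  assert (Hval : validTr pi K r (Old e0)) by exact (Le_Te _ He0).
  assert (Hlr := ln_r_neg).
  exists (exp lo), (exp hi), (exp (lo + beta * ln r)).
  split; [|split; [|split; [|split; [apply exp_pos|split; [apply exp_pos|split; [apply exp_pos|]]]]]].
  - apply Rbar_sup_const; [eauto|]. intros e [w [Hw ->]]. apply (card_growth w lo hi); auto.
  - apply Rbar_sup_const; [eauto|]. intros e [w [Hw ->]]. apply (card_growth w lo hi); auto.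
  - apply Rbar_sup_const; [eauto|]. intros e [w [Hw ->]]. apply HE; auto.
  - intros x. destruct (dS_growth x lo hi Hlo Hhi) as [-> ->]. rewrite !ln_exp.
    replace (lo - (lo + beta * ln r)) with (beta * - ln r) by ring.
    split; f_equal; field; split; lra.
Qed.

End Framework.

Theorem theorem4p2
  (V : Type) (nbrs : V -> list V) (mu : V -> V -> R)
  (T : Type) (pi : T -> T) (phi : T) (K : T -> list V)
  (d : V -> V -> R) (r alpha beta : R)
  (* (G,E): connected simple graph, countably infinite vertex set, bounded degree *)
  (HV : countably_infinite V)
  (Hnd : forall x, NoDup (nbrs x))
  (Hirr : forall x, ~ adj nbrs x x)
  (Hsym : forall x y, adj nbrs x y -> adj nbrs y x)
  (Hconn : forall x y, clos_refl_trans V (adj nbrs) x y)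
  (Hdeg : exists D : nat, forall x, (length (nbrs x) <= D)%nat)
  (* conductance, mu_xy comparable to 1 on E *)
  (Hmusym : forall x y, adj nbrs x y -> mu x y = mu y x)
  (Hmu : exists c, 0 < c /\ forall x y, adj nbrs x y -> c <= mu x y <= / c)
  (* bi-infinite tree and minimal connected partition *)
  (HT : countable T) (HT1 : tree_T1 pi) (HT2 : tree_T2 pi)
  (HK : is_partition nbrs pi phi K)
  (Hmin : minimal_part pi K) (Hcon : connected_part nbrs pi K)
  (* metric *)
  (Hd : is_metric d) (Hdiam : infinite_diam d) (Hfit : fits nbrs d)
  (Hbf : basic_framework d pi phi K r)
  (* exponents *)
  (Hab : 1 <= alpha < beta)
  (Hd1 : exists c, 0 < c /\ forall x y, adj nbrs x y -> c <= d x y <= / c)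
  (Hheat : exists c, 0 < c /\ forall x (n : nat), (1 <= n)%nat ->
      Rbar_le (Finite c) (Rbar_mult (Finite (hk nbrs mu (2 * n) x x)) (Vd nbrs mu d x (Rpower (INR n) (/ beta)))) /\
      Rbar_le (Rbar_mult (Finite (hk nbrs mu (2 * n) x x)) (Vd nbrs mu d x (Rpower (INR n) (/ beta)))) (Finite (/ c)))
  (Hreslow : exists lam Cl, 0 < lam /\ 0 < Cl /\ forall x s, Rbar_lt (rx d x) (Finite s) ->
      Rbar_le (Finite (Cl * Rpower s beta))
        (Rbar_mult (resistance nbrs mu (dball d x (lam * s)) (fun y => ~ dball d x s y)) (Vd nbrs mu d x s)))
  (Hresup : exists C', 0 < C' /\ forall x s, Rbar_lt (rx d x) (Finite s) ->
      Rbar_le (Rbar_mult (resistance nbrs mu (fun y => y = x) (fun y => ~ dball d x s y)) (Vd nbrs mu d x s))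
        (Finite (C' * Rpower s beta)))
  (Hvol : exists C'', 0 < C'' /\ forall x s t, 0 < t -> t < s ->
      Rbar_le (Vd nbrs mu d x s) (Rbar_mult (Finite (C'' * Rpower (s / t) alpha)) (Vd nbrs mu d x t))) :
  forall N1 : nat, exists N2_0 : nat, forall N2 N : nat, (N2_0 <= N2)%nat -> (1 <= N)%nat ->
    exists nlow nup rlow : R,
      Nlower pi K r = Finite nlow /\ Nupper pi K r = Finite nup /\
      Rlower pi phi K r 2 N1 N2 N = Finite rlow /\
      0 < nlow /\ 0 < nup /\ 0 < rlow /\
      forall x : V,
        dS_lower nbrs mu x = Finite (2 * ln nlow / (ln nlow - ln rlow)) /\
        dS_upper nbrs mu x = Finite (2 * ln nup / (ln nlow - ln rlow)).
Proof.
  (* The centre of the balls by which volume growth is measured; any vertex serves. *)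
  assert (Hx0 : exists x : V, True) by (destruct HV as [enum _]; exists (enum 0%nat); exact I).
  destruct Hx0 as [x0 _].
  destruct Hdeg as [D HD]. destruct Hmu as [cmu [Hcmu Hmu']].
  destruct Hfit as [[Cf [HCf HF1]] _].
  destruct Hbf as [[B HB] [_ [[al [Hal Hthick]] [[M [a1 [a2 [Ha1 [Ha2 Hadapt]]]]] [Hr [cg [Hcg Hgd]]]]]]].
  destruct Hd1 as [cd [Hcd Hd1']]. destruct Hheat as [ch [Hch Hheat']].
  destruct Hreslow as [lam [Cl [Hlam [HCl Hreslow']]]]. destruct Hresup as [Cu [HCu Hresup']].
  destruct Hvol as [Cv [HCv Hvol']].
  apply (spectral_dimensions V nbrs mu T pi phi K d r alpha beta D cmu cd Cf Cv B M al a1 a2 cg)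
    with (lam := lam) (Cl := Cl) (Cu := Cu) (ch := ch); assumption.
Qed.
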